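(* Let $e_1,e_2,e_3$ be nonzero integers with $e_1+e_2+e_3=0$, $2\,\|\,e_1$, $2\,\|\,e_2$, $4\mid e_3$. Let $n=p_1\cdots p_k$ be an odd positive square-free integer coprime with $e_1e_2e_3$, whose prime factors are quadratic residues modulo each odd prime factor of $e_1e_2e_3$. Assume that - neither $E$ nor $E^{(n)}$ has a rational point of order $4$; - $e_3>0$ and $e_1<0$; - $\left(\frac{p^*}{q}\right)=1$ for all odd primes $p\mid n$, $q\mid e_1e_3$. If $\mathrm{Sel}_2(E/\mathbb{Q})\cong(\mathbb{Z}/2\mathbb{Z})^2$, then every class of $\mathrm{Sel}_2'(E^{(n)})$ has a unique representative $(d_1,d_2,d_3)$ with $d_i$ (possibly negative) divisors of $n$, $d_2>0$ and $d_3\equiv1\pmod 4$, and the map $(d_1,d_2,d_3)\mapsto\begin{pmatrix}\mathbf{y}\\ \mathbf{z}\end{pmatrix}$, where $\mathbf{y}=(v_{p_i}(d_2))_i^{\mathrm T}$, $\mathbf{z}=(v_{p_i}(d_3))_i^{\mathrm T}\in\mathbb{F}_2^k$, induces an isomorphism $$\mathrm{Sel}_2'(E^{(n)})\xrightarrow{\sim}\ker\begin{pmatrix}\mathbf{A}+\mathbf{D}_{-e_1}&\mathbf{D}_{-e_1e_3}\\ \mathbf{D}_{-e_1e_2}&\mathbf{A}^{\mathrm T}+\mathbf{D}_{-e_1}\end{pmatrix}.$$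
   Context: For a nonzero integer $m$, $E^{(m)}$ is $y^2=x(x-e_1m)(x+e_2m)$, $E=E^{(1)}$. For $\Lambda=(d_1,d_2,d_3)$ of nonzero square-free integers with $d_1d_2d_3$ a square, $D^{(m)}_\Lambda\subset\mathbb{P}^3$ is defined by $e_1mt^2+d_2u_2^2-d_3u_3^2=0$, $e_2mt^2+d_3u_3^2-d_1u_1^2=0$, $e_3mt^2+d_1u_1^2-d_2u_2^2=0$. $\mathrm{Sel}_2(E^{(m)}/\mathbb{Q})$ is identified with the group (componentwise multiplication) of $\Lambda\in(\mathbb{Q}^\times/\mathbb{Q}^{\times2})^3$ with $d_1d_2d_3\in\mathbb{Q}^{\times2}$ and $D^{(m)}_\Lambda(\mathbb{A}_{\mathbb{Q}})\ne\emptyset$; rational 2-torsion points correspond to $(1,1,1)$, $(-e_3m,-e_1e_3,e_1m)$, $(-e_2e_3,e_3m,-e_2m)$, $(e_2m,-e_1m,-e_1e_2)$. $\mathrm{Sel}_2'(E^{(m)})=\mathrm{Sel}_2(E^{(m)}/\mathbb{Q})/(E^{(m)}(\mathbb{Q})_{\rm tors}/2E^{(m)}(\mathbb{Q})_{\rm tors})$. $[\alpha,\beta]_v$ is the additive Hilbert symbol, $(\alpha,\beta)_v=(-1)^{[\alpha,\beta]_v}$. $\mathbf{A}=([p_j,-n]_{p_i})_{i,j}\in M_k(\mathbb{F}_2)$. For $u$ coprime to $n$, $\mathbf{D}_u=\mathrm{diag}([u/p_1],\dots,[u/p_k])$, with $[u/p]\in\mathbb{F}_2$ equal to $0$ if $u$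 is a quadratic residue mod $p$ and $1$ otherwise. For an odd integer $m$, $m^*=(-1)^{(m-1)/2}m\equiv1\pmod 4$. $2\,\|\,m$ means $2\mid m$, $4\nmid m$. *)

(* Defs.v *)
From HB Require Import structures.
From mathcomp Require Import all_boot all_order all_algebra.
From mathcomp Require Import boolp Rstruct.
Set Implicit Arguments. Unset Strict Implicit. Unset Printing Implicit Defensive.
Import Order.TTheory GRing.Theory Num.Theory.
Local Open Scope ring_scope.

Definition triple := (int * int * int)%type.
Definition t1 (s : triple) : int := s.1.1.
Definition t2 (s : triple) : int := s.1.2.
Definition t3 (s : triple) : int := s.2.
Definition mul3 (s r : triple) : triple := (t1 s * t1 r, t2 s * t2 r, t3 s * t3 r).

(* square-free nonzero integer (canonical representative of a class of Q^x/Q^x2) *)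
Definition sqfree (z : int) : Prop :=
  z != 0 /\ forall d : nat, (d ^ 2 %| absz z)%N -> d = 1%N.

(* z is a square (of an integer; for integers this is the same as being a rational square) *)
Definition is_sq (z : int) : Prop := exists c : int, z = c * c.

(* componentwise equality in (Q^x/Q^x2)^3 *)
Definition sqeq3 (s r : triple) : Prop :=
  is_sq (t1 s * t1 r) /\ is_sq (t2 s * t2 r) /\ is_sq (t3 s * t3 r).

Definition diagq (R : pzRingType) (N : nat) (c : N.-tuple int) (x : 'I_N -> R) : R :=
  \sum_(i < N) (tnth c i)%:~R * x i ^+ 2.

Definition real_solvable (N : nat) (cs : seq (N.-tuple int)) : Prop :=
  exists x : 'I_N -> Rdefinitions.R,
    (exists i, x i != 0) /\ forall c, c \in cs -> diagq c x = 0.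

(* Q_p-point of the projective variety {forms in cs = 0}: a primitive vector of
   Z_p^N (Z_p = inverse limit of Z/p^k) on which all forms vanish; x k is its
   reduction modulo p^k, the system (x k)_k being compatible. *)
Definition Qp_solvable (p N : nat) (cs : seq (N.-tuple int)) : Prop :=
  exists x : nat -> 'I_N -> int,
    (forall k, exists i, ~~ ((p%:Z) %| x k i)%Z) /\
    (forall k c, c \in cs -> (((p ^ k)%N%:Z) %| diagq c (x k))%Z) /\
    (forall k i, (x k.+1 i == x k i %[mod ((p ^ k)%N%:Z)])%Z).

Definition loc_solvable (N : nat) (cs : seq (N.-tuple int)) : Prop :=
  real_solvable cs /\ forall p : nat, prime p -> Qp_solvable p cs.

(* D^(m)_Lambda in variables (t,u1,u2,u3):
   e1 m t^2 + d2 u2^2 - d3 u3^2 = 0, e2 m t^2 + d3 u3^2 - d1 u1^2 = 0,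
   e3 m t^2 + d1 u1^2 - d2 u2^2 = 0 *)
Definition D_eqs (e1 e2 e3 m : int) (s : triple) : seq (4.-tuple int) :=
  [:: [tuple e1 * m; 0; t2 s; - t3 s];
      [tuple e2 * m; - t1 s; 0; t3 s];
      [tuple e3 * m; t1 s; - t2 s; 0]].

(* Sel_2(E^(m)/Q), with classes represented by square-free integer triples *)
Definition Sel2 (e1 e2 e3 m : int) (s : triple) : Prop :=
  sqfree (t1 s) /\ sqfree (t2 s) /\ sqfree (t3 s) /\
  is_sq (t1 s * t2 s * t3 s) /\ loc_solvable (D_eqs e1 e2 e3 m s).

(* images of the rational 2-torsion points *)
Definition tors (e1 e2 e3 m : int) : seq triple :=
  [:: (1, 1, 1); (- e3 * m, - e1 * e3, e1 * m); (- e2 * e3, e3 * m, - e2 * m);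
      (e2 * m, - e1 * m, - e1 * e2)].

(* s and r define the same class in Sel_2'(E^(m)) = Sel_2 / torsion image *)
Definition equivT (e1 e2 e3 m : int) (s r : triple) : Prop :=
  exists2 t, t \in tors e1 e2 e3 m & sqeq3 (mul3 s r) t.

Definition Sel2_iso_Z2sq (e1 e2 e3 m : int) : Prop :=
  exists f : triple -> 'rV['F_2]_2,
    (forall s r u, Sel2 e1 e2 e3 m s -> Sel2 e1 e2 e3 m r -> Sel2 e1 e2 e3 m u ->
        sqeq3 u (mul3 s r) -> f u = f s + f r) /\
    (forall s r, Sel2 e1 e2 e3 m s -> Sel2 e1 e2 e3 m r -> f s = f r -> s = r) /\
    (forall v, exists2 s, Sel2 e1 e2 e3 m s & f s = v).

(* E^(m) : y^2 = x(x - e1 m)(x + e2 m) = x^3 + a x^2 + b x has a rational point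
   P = (x,y) of order 4, i.e. P, 2P nonzero and 2P of order 2 (y(2P) = 0);
   2P computed with the doubling formula of the group law. *)
Definition has_pt4 (e1 e2 m : int) : Prop :=
  exists x y : rat,
    let a : rat := ((e2 - e1) * m)%:~R in
    let b : rat := (- (e1 * m) * (e2 * m))%:~R in
    let lam := (3 * x ^+ 2 + 2 * a * x + b) / (2 * y) in
    let x2 := lam ^+ 2 - a - 2 * x in
    let y2 := lam * (x - x2) - y in
    [/\ y ^+ 2 = x * (x - (e1 * m)%:~R) * (x + (e2 * m)%:~R), y != 0 & y2 = 0].

Definition two_exact (e : int) : Prop := (2 %| e)%Z /\ ~~ (4 %| e)%Z.

Definition nqr (u : int) (p : nat) : 'F_2 :=
  if [exists x : 'I_p, ((p%:Z) %| (nat_of_ord x)%:Z ^+ 2 - u)%Z] then 0 else 1.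

Definition hilb (p : nat) (a b : int) : 'F_2 :=
  if `[< Qp_solvable p [:: [tuple a; b; -1]] >] then 0 else 1.

(* m^* = (-1)^((m-1)/2) m for odd m *)
Definition pstar (q : nat) : int := if (q %% 4 == 1)%N then q%:Z else - q%:Z.

Definition Amat (k : nat) (p : 'I_k -> nat) (n : nat) : 'M['F_2]_k :=
  \matrix_(i, j) hilb (p i) (p j)%:Z (- n%:Z).

Definition Dmat (k : nat) (p : 'I_k -> nat) (u : int) : 'M['F_2]_k :=
  diag_mx (\row_i nqr u (p i)).

Definition Mmat (e1 e2 e3 : int) (k : nat) (p : 'I_k -> nat) (n : nat) : 'M['F_2]_(k + k) :=
  block_mx (Amat p n + Dmat p (- e1)) (Dmat p (- e1 * e3))
           (Dmat p (- e1 * e2)) ((Amat p n)^T + Dmat p (- e1)).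

Definition yz (k : nat) (p : 'I_k -> nat) (r : triple) : 'cV['F_2]_(k + k) :=
  col_mx (\col_i (odd (logn (p i) (absz (t2 r))))%:R)
         (\col_i (odd (logn (p i) (absz (t3 r))))%:R).

Definition normrep (e1 e2 e3 : int) (n : nat) (r : triple) : Prop :=
  Sel2 e1 e2 e3 n%:Z r /\
  [/\ (t1 r %| n%:Z)%Z, (t2 r %| n%:Z)%Z, (t3 r %| n%:Z)%Z,
      0 < t2 r & (t3 r == 1 %[mod 4])%Z].

(* Main.v *)
(** Write [X_i = d_i u_i^2] and [E_i = e_i m]. A Q_q-point of [D] is a solution of
    [X3 - X2 = E1 t^2], [X1 - X3 = E2 t^2], [X2 - X1 = E3 t^2] with [X_i] in the square class of
    [d_i]; comparing valuations determines the admissible classes. At an odd prime of good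
    reduction all unit classes occur (a character sum), at [p | n] exactly the four torsion
    classes, and at infinity the condition is [d2 > 0]. At 2, once [d2] and [d3] have even
    valuation (which translation by torsion achieves), solubility forces [d3 = 1 mod 4];
    conversely, for [d2 > 0] and [d3 = 1 mod 4] solubility at 2 follows from solubility at all odd
    primes by the product formula for the Hilbert symbols of the conics covered by [D].

    Multiply a Selmer element of [E^(n)] whose [d2] and [d3] have even valuation at 2 by the
    normalized triple with the same valuations at the primes dividing [n], where [d2] is positive
    and [d3] is a product of [p*]. At [q | e1 e3] that triple is a local square, and at the other
    odd [q | e2] it changes at most the signs of [d1] and [d3], which preserves solubility. Hence
    the product lies in [Sel_2(E)], whose four elements are the torsion classes (these are told
    apart by 2-adic parities), so it is trivial and the element was normalized. What remains is
    solubility at the [p_i]: by quadratic reciprocity it is the linear system of the matrix. *)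

Require Import Defs.
From HB Require Import structures.
From mathcomp Require Import all_boot all_order all_algebra.
From mathcomp Require Import fingroup cyclic finfield.
From mathcomp Require Import boolp Rstruct.
From mathcomp Require Import zify ring lra.
Set Implicit Arguments. Unset Strict Implicit. Unset Printing Implicit Defensive.
Import Order.TTheory GRing.Theory Num.Theory.
Local Open Scope ring_scope.

(** * Valuations and unit parts of integers *)

Definition valz (q : nat) (a : int) : nat := logn q `|a|.

Definition unit_part (q : nat) (a : int) : int := (a %/ q%:Z ^+ valz q a)%Z.

Lemma PoszX (q k : nat) : (q ^ k)%N%:Z = q%:Z ^+ k.
Proof. by elim: k => // k IHk; rewrite expnS exprS PoszM IHk. Qed.

Lemma ndvdz_neq0 (d a : int) : ~~ (d %| a)%Z -> a != 0.
Proof. by apply: contraNneq => ->; rewrite dvdz0. Qed.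

Lemma dvdz_expW (q b : int) i j : (i <= j)%N -> (q ^+ j %| b)%Z -> (q ^+ i %| b)%Z.
Proof. by move=> ij; apply: dvdz_trans; exact: dvdz_exp2l. Qed.

Lemma unit_partE q a : a = q%:Z ^+ valz q a * unit_part q a.
Proof. by rewrite mulrC divzK // -PoszX dvdzE pfactor_dvdnn. Qed.

Lemma valzN q a : valz q (- a) = valz q a.
Proof. by rewrite /valz abszN. Qed.

Lemma valzM q a b : a != 0 -> b != 0 -> valz q (a * b) = (valz q a + valz q b)%N.
Proof. by move=> a0 b0; rewrite /valz abszM lognM ?absz_gt0. Qed.

Lemma valz_sqr q c : c != 0 -> valz q (c ^+ 2) = (valz q c).*2.
Proof. by move=> c0; rewrite expr2 valzM // addnn. Qed.

Lemma valz_unit q a : ~~ (q%:Z %| a)%Z -> valz q a = 0%N.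
Proof. by rewrite dvdzE /valz lognE => /negbTE ->; rewrite !andbF. Qed.

Lemma unit_part_unit q a : ~~ (q%:Z %| a)%Z -> unit_part q a = a.
Proof. by move=> qa; rewrite /unit_part valz_unit // divz1. Qed.

Section PrimeValuation.
Variable q : nat.
Hypothesis q_pr : prime q.

Lemma primez_neq0 : q%:Z != 0.
Proof. by rewrite eqz_nat -lt0n prime_gt0. Qed.

Lemma primez_ndvd1 : ~~ (q%:Z %| 1)%Z.
Proof. by rewrite dvdzE dvdn1 neq_ltn prime_gt1 ?orbT. Qed.

Lemma Euclid_dvdzM (a b : int) : (q%:Z %| a * b)%Z = (q%:Z %| a)%Z || (q%:Z %| b)%Z.
Proof. by rewrite !dvdzE abszM Euclid_dvdM. Qed.

Lemma Euclid_dvdzX (a : int) k : (q%:Z %| a ^+ k)%Z = (q%:Z %| a)%Z && (0 < k)%N.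
Proof. by rewrite !dvdzE abszX Euclid_dvdX. Qed.

Lemma valz_ge a k : a != 0 -> (k <= valz q a)%N = (q%:Z ^+ k %| a)%Z.
Proof. by move=> a0; rewrite -PoszX dvdzE pfactor_dvdn ?absz_gt0. Qed.

Lemma valz_gt0 a : a != 0 -> (0 < valz q a)%N = (q%:Z %| a)%Z.
Proof. exact: valz_ge. Qed.

Lemma valz_lt a k : ~~ (q%:Z ^+ k %| a)%Z -> (valz q a < k)%N.
Proof. by move=> qa; rewrite ltnNge valz_ge // (ndvdz_neq0 qa). Qed.

Lemma unit_part_ndvd a : a != 0 -> ~~ (q%:Z %| unit_part q a)%Z.
Proof.
move=> a0; apply/negP => /(dvdz_mul (dvdzz (q%:Z ^+ valz q a))).
by rewrite -unit_partE -exprSr -valz_ge // ltnn.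
Qed.

Lemma valz_expM k u : ~~ (q%:Z %| u)%Z -> valz q (q%:Z ^+ k * u) = k.
Proof.
move=> qu; rewrite valzM ?expf_neq0 ?primez_neq0 ?(ndvdz_neq0 qu) //.
by rewrite (valz_unit qu) addn0 /valz -PoszX pfactorK.
Qed.

Lemma unit_part_expM k u : ~~ (q%:Z %| u)%Z -> unit_part q (q%:Z ^+ k * u) = u.
Proof. by move=> qu; rewrite /unit_part valz_expM // mulKz // expf_neq0 ?primez_neq0. Qed.

Lemma unit_partM a b : a != 0 -> b != 0 -> unit_part q (a * b) = unit_part q a * unit_part q b.
Proof.
move=> a0 b0.
have qab : ~~ (q%:Z %| unit_part q a * unit_part q b)%Z.
  by rewrite Euclid_dvdzM negb_or !unit_part_ndvd.
rewrite -[RHS](unit_part_expM (valz q a + valz q b) qab) exprD mulrACA.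
by rewrite -!unit_partE.
Qed.

Lemma unit_partN1 : unit_part q (-1) = -1.
Proof. by rewrite unit_part_unit // rpredN primez_ndvd1. Qed.

Lemma unit_partN a : a != 0 -> unit_part q (- a) = - unit_part q a.
Proof. by move=> a0; rewrite -mulN1r unit_partM // unit_partN1 mulN1r. Qed.

Lemma unit_partD a b j : a != 0 -> (0 < j)%N -> (q%:Z ^+ (valz q a + j) %| b)%Z ->
  [/\ a + b != 0, valz q (a + b) = valz q a
    & (q%:Z ^+ j %| unit_part q (a + b) - unit_part q a)%Z].
Proof.
move=> a0 j_gt0 /dvdzP [s Eb].
have Eab : a + b = q%:Z ^+ valz q a * (unit_part q a + q%:Z ^+ j * s).
  by rewrite {1}(unit_partE q a) Eb exprD; ring.
have qj : (q%:Z %| q%:Z ^+ j * s)%Z by rewrite dvdz_mulr // dvdz_exp.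
have qu : ~~ (q%:Z %| unit_part q a + q%:Z ^+ j * s)%Z by rewrite rpredDr ?unit_part_ndvd.
split.
- by rewrite Eab mulf_neq0 ?expf_neq0 ?primez_neq0 ?(ndvdz_neq0 qu).
- by rewrite Eab valz_expM.
- by rewrite Eab unit_part_expM // addrC addKr dvdz_mulr.
Qed.

Lemma valzD_lt a b : a != 0 -> b != 0 -> (valz q a < valz q b)%N -> valz q (a + b) = valz q a.
Proof.
move=> a0 b0 lt_ab; have [//||_ -> //] := @unit_partD a b 1 a0.
by rewrite addn1 -valz_ge.
Qed.

End PrimeValuation.

(** * Quadratic residues modulo an odd prime *)

(* Here and below [bool] is the field with two elements, with [+] the exclusive or. *)

(* Euler's criterion as a definition; in particular [0] is not a nonsquare. *)
Definition nonsquare (q : nat) (x : 'F_q) : bool := x ^+ q./2 == -1.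

Definition nonres (q : nat) (u : int) : bool := nonsquare (u%:~R : 'F_q).

Lemma odd_prime_neq2 q : odd q -> q != 2.
Proof. by apply: contraTneq => ->. Qed.

Lemma prime_neq2_odd q : prime q -> q != 2 -> odd q.
Proof. by case/even_prime=> [->|]. Qed.

Section Residues.
Variable q : nat.
Hypotheses (q_pr : prime q) (q_odd : odd q).
Implicit Types (x y : 'F_q) (u v : int).

Lemma natF_eq0 (m : nat) : (m%:R == 0 :> 'F_q) = (q %| m)%N.
Proof. by rewrite (dvdn_pcharf (pchar_Fp q_pr)). Qed.

Lemma intF_eq0 u : (u%:~R == 0 :> 'F_q) = (q%:Z %| u)%Z.
Proof. by case: u => m; rewrite ?NegzE ?mulrNz ?oppr_eq0 dvdzE natF_eq0. Qed.

Lemma intF_eq u v : (u%:~R == v%:~R :> 'F_q) = (q%:Z %| u - v)%Z.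
Proof. by rewrite -subr_eq0 -mulrzBr intF_eq0. Qed.

Lemma intF_ord x : (nat_of_ord x)%:Z%:~R = x.
Proof. by rewrite -pmulrn natr_Zp. Qed.

Lemma Fq_N1_neq1 : -1 != 1 :> 'F_q.
Proof.
rewrite eq_sym -subr_eq0 opprK (natF_eq0 2).
by apply/negP => /dvdn_leq -/(_ isT); have := odd_prime_gt2 q_odd q_pr; lia.
Qed.

Lemma exp_half x : x != 0 -> x ^+ q./2 = (-1) ^+ nonsquare x.
Proof.
move=> x0; suff /eqP : (x ^+ q./2) ^+ 2 = 1.
  rewrite sqrf_eq1 /nonsquare => /orP [] /eqP ->; last by rewrite eqxx.
  by rewrite eq_sym (negbTE Fq_N1_neq1).
apply: (mulfI x0); rewrite mulr1 -exprM -exprS.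
have := expf_card x; rewrite card_Fp // => {2}<-; congr (x ^+ _); lia.
Qed.

Lemma nonsquare_sign x (b : bool) : x ^+ q./2 = (-1) ^+ b -> nonsquare x = b.
Proof.
rewrite /nonsquare => ->; case: b; rewrite ?eqxx //.
by rewrite eq_sym (negbTE Fq_N1_neq1).
Qed.

Lemma nonsquare0 : nonsquare (0 : 'F_q) = false.
Proof.
have /negbTE half_neq0 : q./2 != 0 by have := odd_prime_gt2 q_odd q_pr; lia.
by rewrite /nonsquare expr0n half_neq0 eq_sym oppr_eq0 oner_eq0.
Qed.

Lemma nonsquareM x y : x != 0 -> y != 0 -> nonsquare (x * y) = nonsquare x + nonsquare y.
Proof. by move=> x0 y0; apply: nonsquare_sign; rewrite exprMn !exp_half // signr_addb. Qed.

Lemma Fq_generator : exists2 g : 'F_q, g != 0 &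
  (forall x, x != 0 -> exists i, x = g ^+ i) /\ (forall i, g ^+ i = 1 -> (q.-1 %| i)%N).
Proof.
have /cyclicP [g Eg] := field_unit_group_cyclic [set: {unit 'F_q}]%G.
have ord_g : #[g]%g = q.-1 by rewrite /order -Eg card_finField_unit card_Fp.
exists (val g); first by rewrite -unitfE (valP g).
split=> [x x0 | i gi1]; last first.
  by rewrite -ord_g order_dvdn; apply/eqP/val_inj; rewrite /= FinRing.val_unitX.
have Ux : x \is a GRing.unit by rewrite unitfE.
have /cycleP [i Ei] : FinRing.unit 'F_q Ux \in <[g]>%g by rewrite -Eg inE.
by exists i; rewrite -FinRing.val_unitX -Ei.
Qed.

Lemma nonsquare_ex : exists x, nonsquare x.
Proof.
have [g g0 [_ g_ord]] := Fq_generator; exists g; apply: contraT => /negbTE g_sq.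
have := exp_half g0; rewrite g_sq expr0 => /g_ord /dvdn_leq.
by have := odd_prime_gt2 q_odd q_pr; lia.
Qed.

Lemma nonsquareP x : x != 0 -> reflect (exists y, x = y ^+ 2) (~~ nonsquare x).
Proof.
move=> x0; apply: (iffP idP) => [/negbTE x_sq | [y Ey]]; last first.
  have y0 : y != 0 by apply: contraNneq x0 => y0; rewrite Ey y0 expr0n.
  by rewrite Ey nonsquareM // addrr_pchar2.
have [g g0 [g_gen g_ord]] := Fq_generator; have [i Ei] := g_gen x x0.
have := exp_half x0; rewrite x_sq expr0 Ei -exprM => /g_ord.
have -> : q.-1 = (2 * q./2)%N by lia.
have q_gt2 := odd_prime_gt2 q_odd q_pr.
rewrite dvdn_pmul2r; last by lia.
by case/dvdnP=> j ->; exists (g ^+ j); rewrite -exprM.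
Qed.

Lemma nonresM u v : ~~ (q%:Z %| u)%Z -> ~~ (q%:Z %| v)%Z ->
  nonres q (u * v) = nonres q u + nonres q v.
Proof. by rewrite -!intF_eq0 /nonres rmorphM; exact: nonsquareM. Qed.

Lemma nonres_eqmod u v : (q%:Z %| u - v)%Z -> nonres q u = nonres q v.
Proof. by rewrite -intF_eq /nonres => /eqP ->. Qed.

Lemma nonres_sqr v : ~~ (q%:Z %| v)%Z -> nonres q (v ^+ 2) = false.
Proof. by move=> qv; rewrite expr2 nonresM // addrr_pchar2. Qed.

Lemma nonres1 : nonres q 1 = false.
Proof. by rewrite -[1](expr1n _ 2) nonres_sqr // primez_ndvd1. Qed.

Lemma nonresN1 : nonres q (-1) = odd q./2.
Proof. by apply: nonsquare_sign; rewrite rmorphN1 signr_odd. Qed.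

Lemma nonres_sqrt u : ~~ (q%:Z %| u)%Z -> ~~ nonres q u ->
  exists2 v, ~~ (q%:Z %| v)%Z & (q%:Z %| v ^+ 2 - u)%Z.
Proof.
rewrite -intF_eq0 => u0 /(nonsquareP u0) [y Ey].
exists (nat_of_ord y)%:Z; last by rewrite -intF_eq rmorphXn /= intF_ord Ey.
by rewrite -intF_eq0 intF_ord; apply: contraNneq u0 => y0; rewrite Ey y0 expr0n.
Qed.

Lemma nonres_sqr_eqmod u v w : ~~ (q%:Z %| u)%Z -> ~~ (q%:Z %| v)%Z ->
  (q%:Z %| w ^+ 2 - u * v ^+ 2)%Z -> nonres q u = false.
Proof.
move=> qu qv Euv; have qv2 : ~~ (q%:Z %| v ^+ 2)%Z by rewrite Euclid_dvdzX // andbT.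
have quv : ~~ (q%:Z %| u * v ^+ 2)%Z by rewrite Euclid_dvdzM // negb_or qu.
have qw : ~~ (q%:Z %| w)%Z.
  apply: contra quv => qw; have qw2 : (q%:Z %| w ^+ 2)%Z by rewrite dvdz_exp.
  by rewrite -(subKr (w ^+ 2) (u * _)) rpredB.
by have := nonres_eqmod Euv; rewrite nonresM // !nonres_sqr // addr0 => <-.
Qed.

End Residues.

(** * Quadratic reciprocity *)

Section GaussLemma.
Variables (q a : nat).
Hypotheses (q_pr : prime q) (q_odd : odd q) (qa : ~~ (q %| a)%N).
Let h := q./2.

Let residue (x : 'I_h) : nat := (a * x.+1 %% q)%N.
Let exceeds (x : 'I_h) : bool := (h < residue x)%N.
Let abs_residue (x : 'I_h) : nat := if exceeds x then (q - residue x)%N else residue x.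

Let qE : q = (h + h).+1. Proof. by rewrite /h; lia. Qed.

Let succ_ndvd (x : 'I_h) : ~~ (q %| x.+1)%N.
Proof. by apply/negP => /dvdn_leq -/(_ isT); have := ltn_ord x; lia. Qed.

Let residue_gt0 x : (0 < residue x)%N.
Proof. by rewrite lt0n -/(dvdn q _) Euclid_dvdM // negb_or qa succ_ndvd. Qed.

Let residue_lt x : (residue x < q)%N. Proof. by rewrite ltn_mod prime_gt0. Qed.

Let abs_residue_bounds x : (0 < abs_residue x <= h)%N.
Proof.
by rewrite /abs_residue /exceeds; have := residue_gt0 x; have := residue_lt x; case: ifP; lia.
Qed.

Let abs_residue_lt x : ((abs_residue x).-1 < h)%N.
Proof. by have := abs_residue_bounds x; lia. Qed.

Let perm (x : 'I_h) : 'I_h := Ordinal (abs_residue_lt x).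

Let permE x : abs_residue x = (perm x).+1.
Proof. by have := abs_residue_bounds x; rewrite /perm /=; lia. Qed.

Let perm_inj : injective perm.
Proof.
move=> x y /(congr1 (fun i : 'I_h => i.+1)); rewrite -!permE => Exy.
have [lx ly] := (ltn_ord x, ltn_ord y).
have Ex := divn_eq (a * x.+1) q; have Ey := divn_eq (a * y.+1) q.
rewrite -/(residue x) -/(residue y) in Ex Ey.
have [Er|Er] : residue x = residue y \/ (residue x + residue y)%N = q.
  move: Exy; rewrite /abs_residue /exceeds; have := residue_lt x; have := residue_lt y.
  by do 2 case: ifP => _; lia.
- have : (q %| a * x.+1 - a * y.+1)%N /\ (q %| a * y.+1 - a * x.+1)%N.
    by rewrite Ex Ey Er !subnDr -!mulnBl !dvdn_mull.
  rewrite -!mulnBr !Euclid_dvdM // (negbTE qa) /= => -[/dvdn_leq lexy /dvdn_leq leyx].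
  by apply: val_inj => /=; move: lexy leyx; lia.
- have : (q %| a * (x.+1 + y.+1))%N.
    by rewrite mulnDr Ex Ey addnACA Er dvdn_addr // -mulnDl dvdn_mull.
  by rewrite Euclid_dvdM // (negbTE qa) /= => /dvdn_leq -/(_ isT); lia.
Qed.

(* Multiply the numbers [a * x], for [0 < x < q / 2]: up to sign they are a permutation
   of the numbers [x]. *)
Lemma gauss_lemma : nonres q a = odd (\sum_(x < h) (h < a * x.+1 %% q))%N.
Proof.
apply: nonsquare_sign => //; rewrite signr_odd.
have prod_neq0 : \prod_(x < h) (x.+1%:R : 'F_q) != 0.
  by rewrite prodf_seq_neq0; apply/allP => x _ /=; rewrite natF_eq0.
apply: (mulIf prod_neq0).
rewrite -pmulrn -[q./2]card_ord -prodr_const -big_split expr_sum /=.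
rewrite [X in _ = _ * X](reindex_inj perm_inj) -big_split /=.
apply: eq_bigr => x _; rewrite -permE -natrM /abs_residue -/(residue x) -/(exceeds x).
rewrite {1}(divn_eq (a * x.+1) q) natrD natrM (pchar_Fp_0 q_pr) mulr0 add0r -/(residue x).
case: (exceeds x); last by rewrite mul1r.
by rewrite expr1 natrB ?(ltnW (residue_lt x)) // (pchar_Fp_0 q_pr) sub0r mulN1r opprK.
Qed.

Lemma nonres_sum_divn : nonres q a =
  odd (a * \sum_(x < h) x.+1) (+) odd (\sum_(x < h) (a * x.+1) %/ q) (+) odd (\sum_(x < h) x.+1).
Proof.
have sum_abs_residue : (\sum_(x < h) abs_residue x = \sum_(x < h) x.+1)%N.
  by rewrite [RHS](reindex_inj perm_inj); apply: eq_bigr => x _; exact: permE.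
rewrite gauss_lemma -{2}sum_abs_residue big_distrr /= -!oddD -!big_split /=.
elim/big_ind2: _ => // [m1 m2 n1 n2|x _]; first by rewrite !oddD => -> ->.
rewrite {2}(divn_eq (a * x.+1) q) -/(residue x) /abs_residue -/(exceeds x).
rewrite !oddD !oddM q_odd andbT; case: (exceeds x).
  by rewrite oddB ?(ltnW (residue_lt x)) // q_odd; case: (odd (residue x)); case: (odd (_ %/ _)).
by case: (odd (residue x)); case: (odd (_ %/ _)).
Qed.

End GaussLemma.

Lemma nonres_two q : prime q -> odd q -> nonres q 2%N = (q %% 8 == 3)%N || (q %% 8 == 5)%N.
Proof.
move=> q_pr q_odd; rewrite (@nonres_sum_divn q 2) //; last first.
  by apply/negP => /dvdn_leq -/(_ isT); have := odd_prime_gt2 q_odd q_pr; lia.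
rewrite oddM /= [(\sum_(x < _) (_ %/ _))%N]big1 => [|x _]; last first.
  by apply: divn_small; have := ltn_ord x; lia.
have odd_sum h : odd (\sum_(x < h) x.+1) = (h %% 4 == 1)%N || (h %% 4 == 2)%N.
  elim: h => [|h IHh]; first by rewrite big_ord0.
  by rewrite big_ord_recr /= oddD {}IHh; lia.
by rewrite odd_sum; lia.
Qed.

Lemma sum_leq_mul (d k m : nat) : (0 < d)%N ->
  (\sum_(y < k) (d * y.+1 <= m) = minn k (m %/ d))%N.
Proof.
move=> d_gt0; elim: k => [|k IHk]; first by rewrite big_ord0 min0n.
by rewrite big_ord_recr /= IHk mulnC -leq_divRL //; lia.
Qed.

(* [x, y] are lattice points in the rectangle of sides [q / 2] and [r / 2]. *)
Lemma nonres_lattice_points q r : prime q -> odd q -> prime r -> odd r -> q != r ->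
  nonres q r = odd (\sum_(x < q./2) \sum_(y < r./2) (q * y.+1 < r * x.+1))%N.
Proof.
move=> q_pr q_odd r_pr r_odd qr; have qNr : ~~ (q %| r)%N by rewrite dvdn_prime2.
rewrite nonres_sum_divn // oddM r_odd /= addbC addbA addbb addFb; congr odd.
apply: eq_bigr => x _; have ltx := ltn_ord x; set m := (r * x.+1)%N.
have -> : (m %/ q = minn r./2 (m %/ q))%N.
  suff : (m %/ q < r./2.+1)%N by lia.
  by rewrite /m ltn_divLR ?prime_gt0 //; nia.
rewrite -sum_leq_mul ?prime_gt0 //; apply: eq_bigr => y _.
rewrite ltn_neqAle; case: eqP => //= Exy.
have : (q %| m)%N by rewrite -Exy dvdn_mulr.
by rewrite Euclid_dvdM // (negbTE qNr) => /dvdn_leq -/(_ isT); lia.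
Qed.

Theorem quadratic_reciprocity q r : prime q -> prime r -> odd q -> odd r -> q != r ->
  nonres q r = nonres r q + (odd q./2 && odd r./2).
Proof.
move=> q_pr r_pr q_odd r_odd qr.
suff : nonres q r (+) nonres r q = odd q./2 && odd r./2.
  by move=> <-; case: (nonres q r); case: (nonres r q).
rewrite nonres_lattice_points // [nonres r q]nonres_lattice_points //; last by rewrite eq_sym.
rewrite exchange_big -oddD -big_split -oddM /= mulnC; congr odd.
rewrite (eq_bigr (fun=> q./2)) ?sum_nat_const ?card_ord // => y _.
rewrite -big_split /= (eq_bigr (fun=> 1%N)) ?sum_nat_const ?card_ord ?muln1 // => x _.
case: ltngtP => //= Exy; have := ltn_ord x.
have : (q %| r * x.+1)%N by rewrite -Exy dvdn_mulr.
by rewrite Euclid_dvdM // dvdn_prime2 // (negbTE qr) => /dvdn_leq -/(_ isT); lia.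
Qed.

(** * Square classes of the fields Q_q *)

Definition oddval (q : nat) (a : int) : bool := odd (valz q a).

Definition unit_nonres (q : nat) (a : int) : bool := nonres q (unit_part q a).

(* The characters [(u - 1) / 2] and [(u ^ 2 - 1) / 8] of the odd part [u] of [a]. *)
Definition eps2 (a : int) : bool := (unit_part 2 a %% 4)%Z == 3.
Definition omega2 (a : int) : bool := (unit_part 2 a %% 8)%Z \in [:: 3; 5].

(* A complete invariant of the class of a nonzero integer in Q_q^x / Q_q^x2. *)
Definition sqclass (q : nat) (a : int) : bool * bool * bool :=
  (oddval q a, if q == 2 then eps2 a else unit_nonres q a, (q == 2) && omega2 a).

Lemma addrr_bool3 (s : bool * bool * bool) : s + s = 0.
Proof. by case: s => -[[] []] []. Qed.

Lemma oppr_bool3 (s : bool * bool * bool) : - s = s.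
Proof. by case: s => -[]. Qed.

Lemma sqclass_odd q a : odd q -> sqclass q a = (oddval q a, unit_nonres q a, false).
Proof. by move=> /odd_prime_neq2 /negbTE q2; rewrite /sqclass q2. Qed.

Lemma sqclass_oddval q a b : sqclass q a = sqclass q b -> oddval q a = oddval q b.
Proof. by case. Qed.

Lemma sqclass_eps2 a b : sqclass 2 a = sqclass 2 b -> eps2 a = eps2 b.
Proof. by case. Qed.

Lemma oddvalN q a : oddval q (- a) = oddval q a.
Proof. by rewrite /oddval valzN. Qed.

Lemma oddvalM q a b : a != 0 -> b != 0 -> oddval q (a * b) = oddval q a + oddval q b.
Proof. by move=> a0 b0; rewrite /oddval valzM // oddD. Qed.

Lemma oddval_unit q a : ~~ (q%:Z %| a)%Z -> oddval q a = false.
Proof. by move=> qa; rewrite /oddval valz_unit. Qed.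

Lemma odd_mod8 (u : int) : ~~ (2 %| u)%Z ->
  [\/ (u %% 8)%Z = 1, (u %% 8)%Z = 3, (u %% 8)%Z = 5 | (u %% 8)%Z = 7].
Proof.
move=> u_odd; have : (u %% 8)%Z \in [:: 1; 3; 5; 7] by rewrite !inE; lia.
by rewrite !inE => /or4P [] /eqP ->; [constructor 1|constructor 2|constructor 3|constructor 4].
Qed.

Lemma mod4_mod8 (u : int) : (u %% 4)%Z = ((u %% 8)%Z %% 4)%Z.
Proof. lia. Qed.

Lemma eps2M (a b : int) : a != 0 -> b != 0 -> eps2 (a * b) = eps2 a + eps2 b.
Proof.
move=> a0 b0; have /odd_mod8 Ea := unit_part_ndvd (isT : prime 2) a0.
have /odd_mod8 Eb := unit_part_ndvd (isT : prime 2) b0.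
rewrite /eps2 unit_partM // !(mod4_mod8 (_ * _)) !(mod4_mod8 (unit_part _ _)) -modzMm.
by case: Ea => ->; case: Eb => ->.
Qed.

Lemma omega2M (a b : int) : a != 0 -> b != 0 -> omega2 (a * b) = omega2 a + omega2 b.
Proof.
move=> a0 b0; have /odd_mod8 Ea := unit_part_ndvd (isT : prime 2) a0.
have /odd_mod8 Eb := unit_part_ndvd (isT : prime 2) b0.
by rewrite /omega2 unit_partM // -modzMm; case: Ea => ->; case: Eb => ->.
Qed.

Lemma eps2_odd u : ~~ (2 %| u)%Z -> eps2 u = ((u %% 4)%Z == 3).
Proof. by move=> u_odd; rewrite /eps2 unit_part_unit. Qed.

Lemma sqclass2_odd u : ~~ (2 %| u)%Z ->
  sqclass 2 u = (false, (u %% 4)%Z == 3, (u %% 8)%Z \in [:: 3; 5]).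
Proof. by move=> u_odd; rewrite /sqclass /eps2 /omega2 oddval_unit // unit_part_unit. Qed.

Section PrimeSquareClass.
Variable q : nat.
Hypothesis q_pr : prime q.
Implicit Types a b c : int.

Lemma unit_nonresM a b : odd q -> a != 0 -> b != 0 ->
  unit_nonres q (a * b) = unit_nonres q a + unit_nonres q b.
Proof. by move=> q_odd a0 b0; rewrite /unit_nonres unit_partM // nonresM // unit_part_ndvd. Qed.

Lemma unit_nonres_unit a : ~~ (q%:Z %| a)%Z -> unit_nonres q a = nonres q a.
Proof. by move=> qa; rewrite /unit_nonres unit_part_unit. Qed.

Lemma oddvalN1 : oddval q (-1) = false.
Proof. by rewrite oddvalN oddval_unit // primez_ndvd1. Qed.

Lemma unit_nonresN1 : unit_nonres q (-1) = nonres q (-1).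
Proof. by rewrite /unit_nonres unit_partN1. Qed.

Lemma unit_nonresN a : odd q -> a != 0 ->
  unit_nonres q (- a) = unit_nonres q (-1) + unit_nonres q a.
Proof. by move=> q_odd a0; rewrite -[- a]mulN1r unit_nonresM. Qed.

Lemma sqclassM a b : a != 0 -> b != 0 -> sqclass q (a * b) = sqclass q a + sqclass q b.
Proof.
move=> a0 b0; have [q2|/(prime_neq2_odd q_pr) q_odd] := eqVneq q 2.
  by rewrite q2 /sqclass /= oddvalM // eps2M // omega2M.
by rewrite !sqclass_odd // oddvalM // unit_nonresM.
Qed.

Lemma sqclass1 : sqclass q 1 = 0.
Proof. by have := @sqclassM 1 1 isT isT; rewrite mul1r addrr_bool3. Qed.

Lemma sqclass_sqr c : c != 0 -> sqclass q (c ^+ 2) = 0.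
Proof. by move=> c0; rewrite expr2 sqclassM // addrr_bool3. Qed.

Lemma sqclassMsqr a c : a != 0 -> c != 0 -> sqclass q (a * c ^+ 2) = sqclass q a.
Proof. by move=> a0 c0; rewrite sqclassM ?expf_neq0 // sqclass_sqr // addr0. Qed.

Lemma sqclassN a : a != 0 -> sqclass q (- a) = sqclass q (-1) + sqclass q a.
Proof. by move=> a0; rewrite -[- a]mulN1r sqclassM. Qed.

Lemma sqclass_unit a : odd q -> ~~ (q%:Z %| a)%Z -> sqclass q a = (false, nonres q a, false).
Proof. by move=> q_odd qa; rewrite sqclass_odd // oddval_unit // unit_nonres_unit. Qed.

Lemma sqclass_residue a : odd q -> ~~ (q%:Z %| a)%Z -> ~~ nonres q a -> sqclass q a = 0.
Proof. by move=> q_odd qa /negbTE na; rewrite sqclass_unit // na. Qed.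

Lemma sqclassN1 : odd q -> sqclass q (-1) = (false, nonres q (-1), false).
Proof. by move=> q_odd; rewrite sqclass_unit // rpredN primez_ndvd1. Qed.

Lemma sqclassD_odd a b : odd q -> a != 0 -> (q%:Z ^+ (valz q a).+1 %| b)%Z ->
  [/\ a + b != 0, valz q (a + b) = valz q a & sqclass q (a + b) = sqclass q a].
Proof.
move=> q_odd a0; rewrite -addn1 => /(unit_partD (j := 1) q_pr a0 isT) [ab0 Ev Eu]; split=> //.
by rewrite !sqclass_odd // /oddval Ev /unit_nonres (nonres_eqmod q_pr Eu).
Qed.

Lemma sqclassD a b : a != 0 -> (q%:Z ^+ (valz q a + 3) %| b)%Z ->
  [/\ a + b != 0, valz q (a + b) = valz q a & sqclass q (a + b) = sqclass q a].
Proof.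
move=> a0 qb; have [q2|/(prime_neq2_odd q_pr) q_odd] := eqVneq q 2; last first.
  by apply: sqclassD_odd => //; apply: dvdz_expW qb; rewrite addn3 !ltnS leqW.
have [ab0 Ev Eu] := unit_partD (j := 3) q_pr a0 isT qb; split=> //; rewrite q2 in Ev Eu *.
have {}Eu : (unit_part 2 (a + b) %% 8)%Z = (unit_part 2 a %% 8)%Z.
  by apply/eqP; rewrite eqz_mod_dvd.
by rewrite /sqclass /= /oddval Ev /eps2 /omega2 !(mod4_mod8 (unit_part _ _)) Eu.
Qed.

Lemma sqclassD_unit a b : odd q -> ~~ (q%:Z %| a)%Z -> (q%:Z %| b)%Z ->
  a + b != 0 /\ sqclass q (a + b) = sqclass q a.
Proof.
move=> q_odd qa qb; have [|ab0 _ Eab] := sqclassD_odd q_odd (ndvdz_neq0 qa) (b := b); last by [].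
by rewrite (valz_unit qa).
Qed.

Lemma is_sq_sqclass a b : a != 0 -> b != 0 -> is_sq (a * b) -> sqclass q a = sqclass q b.
Proof.
move=> a0 b0 [c Ec]; apply/eqP; rewrite -subr_eq0 oppr_bool3 -sqclassM // Ec -expr2 sqclass_sqr //.
by apply: contra_neq (mulf_neq0 a0 b0) => c0; rewrite Ec c0 mul0r.
Qed.

End PrimeSquareClass.

(** * The product formula for Hilbert symbols *)

Definition hilbert_odd (q : nat) (a b : int) : bool :=
  oddval q a * oddval q b * unit_nonres q (-1) + oddval q a * unit_nonres q b
  + oddval q b * unit_nonres q a.

Definition hilbert_two (a b : int) : bool :=
  eps2 a * eps2 b + oddval 2 a * omega2 b + oddval 2 b * omega2 a.

Definition hilbert_real (a b : int) : bool := (a < 0)%R * (b < 0)%R.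

Definition hilbert_sum (N : nat) (a b : int) : bool :=
  \sum_(q < N | prime q && odd q) hilbert_odd q a b + hilbert_two a b + hilbert_real a b.

Lemma hilbert_oddC q a b : hilbert_odd q a b = hilbert_odd q b a.
Proof. by rewrite /hilbert_odd; ring. Qed.

Lemma hilbert_sumC N a b : hilbert_sum N a b = hilbert_sum N b a.
Proof.
rewrite /hilbert_sum (eq_bigr _ (fun (q : 'I_N) _ => hilbert_oddC q a b)).
by rewrite /hilbert_two /hilbert_real; ring.
Qed.

Lemma hilbert_oddMl q a a' b : prime q -> odd q -> a != 0 -> a' != 0 ->
  hilbert_odd q (a * a') b = hilbert_odd q a b + hilbert_odd q a' b.
Proof. by move=> *; rewrite /hilbert_odd oddvalM // unit_nonresM //; ring. Qed.

Lemma hilbert_realMl a a' b : a != 0 -> a' != 0 ->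
  hilbert_real (a * a') b = hilbert_real a b + hilbert_real a' b.
Proof.
move=> a0 a'0; rewrite /hilbert_real -mulrDl; congr (_ * _).
case: (ltrgt0P a) a0 => // a_sgn _; case: (ltrgt0P a') a'0 => // a'_sgn _.
- by rewrite ltNge mulr_ge0 // ltW.
- by rewrite pmulr_rlt0.
- by rewrite pmulr_llt0.
- by rewrite ltNge mulr_le0 // ltW.
Qed.

Lemma hilbert_sumMl N a a' b : a != 0 -> a' != 0 ->
  hilbert_sum N (a * a') b = hilbert_sum N a b + hilbert_sum N a' b.
Proof.
move=> a0 a'0; rewrite /hilbert_sum hilbert_realMl //.
have -> : hilbert_two (a * a') b = hilbert_two a b + hilbert_two a' b.
  by rewrite /hilbert_two oddvalM // eps2M // omega2M //; ring.
have -> : \sum_(q < N | prime q && odd q) hilbert_odd q (a * a') b =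
    \sum_(q < N | prime q && odd q) hilbert_odd q a b
    + \sum_(q < N | prime q && odd q) hilbert_odd q a' b.
  by rewrite -big_split; apply: eq_bigr => q /andP [q_pr q_odd]; exact: hilbert_oddMl.
by ring.
Qed.

Lemma hilbert_sum_diag N a : hilbert_sum N a a = hilbert_sum N (-1) a.
Proof.
have odd_diag (q : 'I_N) : prime q && odd q -> hilbert_odd q a a = hilbert_odd q (-1) a.
  move=> /andP [q_pr _]; rewrite /hilbert_odd oddvalN1 //.
  by case: (oddval q a); case: (unit_nonres q a); case: (unit_nonres q (-1)).
have two_diag : hilbert_two a a = hilbert_two (-1) a.
  rewrite /hilbert_two oddvalN1 // [eps2 (-1)](_ : _ = true) // [omega2 (-1)](_ : _ = false) //.
  by case: (oddval 2 a); case: (eps2 a); case: (omega2 a).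
rewrite /hilbert_sum (eq_bigr _ odd_diag) two_diag.
by rewrite /hilbert_real; case: (a < 0).
Qed.

Lemma eps2_odd_half (p : nat) : odd p -> eps2 p = odd p./2.
Proof. by move=> p_odd; rewrite eps2_odd; lia. Qed.

Lemma oddval_prime q p : prime q -> prime p -> oddval q p = (q == p).
Proof. by move=> q_pr p_pr; rewrite /oddval /valz logn_prime //; case: eqP => //= ->. Qed.

Lemma prime_ndvdz q p : prime q -> prime p -> q != p -> ~~ (q%:Z %| p%:Z)%Z.
Proof. by move=> q_pr p_pr qp; rewrite dvdzE dvdn_prime2. Qed.

Lemma unit_nonres_prime q p : prime q -> prime p -> q != p -> unit_nonres q p = nonres q p.
Proof. by move=> *; rewrite unit_nonres_unit // prime_ndvdz. Qed.

Lemma hilbert_sumN1_prime N p : prime p -> (p < N)%N -> hilbert_sum N (-1) p = 0.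
Proof.
move=> p_pr pN; rewrite /hilbert_sum /hilbert_real mulr0 addr0.
have symb q : prime q -> odd q -> hilbert_odd q (-1) p = (q == p) * unit_nonres q (-1).
  by move=> *; rewrite /hilbert_odd oddvalN1 // oddval_prime // !mul0r !add0r.
have [p2|p2] := eqVneq p 2.
  by rewrite p2 in symb *; rewrite big1 // => q /andP [q_pr q_odd];
    rewrite symb ?(negbTE (odd_prime_neq2 q_odd)) // mul0r.
have p_odd := prime_neq2_odd p_pr p2.
rewrite (big_only1 (Ordinal pN)) /= ?p_pr // => [|q qp /andP [q_pr q_odd]]; last first.
  by rewrite symb // (negbTE qp : q == p :> nat = false) mul0r.
rewrite symb // eqxx mul1r unit_nonresN1 // nonresN1 //.
rewrite /hilbert_two oddvalN1 // oddval_prime // eq_sym (negbTE p2) !mul0r !addr0.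
by rewrite [eps2 (-1)](_ : _ = true) // eps2_odd_half //; case: (odd _).
Qed.

Lemma hilbert_sum_two_prime N p : prime p -> odd p -> (p < N)%N -> hilbert_sum N 2%N p = 0.
Proof.
move=> p_pr p_odd pN; have p2 := negbTE (odd_prime_neq2 p_odd).
rewrite /hilbert_sum /hilbert_real mulr0 addr0.
rewrite (big_only1 (Ordinal pN)) /= ?p_pr // => [|q qp /andP [q_pr q_odd]]; last first.
  rewrite /hilbert_odd !oddval_prime // (negbTE (odd_prime_neq2 q_odd)).
  by rewrite (negbTE qp : q == p :> nat = false) !mul0r.
rewrite /hilbert_odd /hilbert_two !oddval_prime // eqxx p2 [2%N == p]eq_sym p2.
rewrite !(mul0r, mul1r, add0r, addr0).
rewrite unit_nonres_prime ?p2 // nonres_two //.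
rewrite /omega2 unit_part_unit; last by lia.
rewrite !inE.
have -> : ((p%:Z %% 8)%Z == 3) || ((p%:Z %% 8)%Z == 5) = (p %% 8 == 3)%N || (p %% 8 == 5)%N by lia.
exact: addbb.
Qed.

Lemma hilbert_sum_odd_primes N p r : prime p -> prime r -> odd p -> odd r -> p != r ->
  (p < N)%N -> (r < N)%N -> hilbert_sum N p r = 0.
Proof.
move=> p_pr r_pr p_odd r_odd pr pN rN; have rp : r != p by rewrite eq_sym.
have [p2 r2] := (negbTE (odd_prime_neq2 p_odd), negbTE (odd_prime_neq2 r_odd)).
rewrite /hilbert_sum /hilbert_real mulr0 addr0.
rewrite (bigD1 (Ordinal pN)) /= ?p_pr //.
rewrite (big_only1 (Ordinal rN)) /= ?r_pr ?r_odd // => [|q qr /andP [/andP [q_pr q_odd] qp]];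
  last first.
  rewrite /hilbert_odd !oddval_prime //.
  by rewrite (negbTE qp : q == p :> nat = false) (negbTE qr : q == r :> nat = false) !mul0r.
rewrite /hilbert_odd /hilbert_two !oddval_prime // !eqxx (negbTE pr) (negbTE rp).
rewrite ![2%N == _]eq_sym p2 r2 !(mul0r, mul1r, add0r, addr0).
rewrite !unit_nonres_prime // !eps2_odd_half // quadratic_reciprocity //.
by case: (nonres r p); case: (odd _); case: (odd _).
Qed.

Lemma hilbert_sum_primes N p r : prime p -> prime r -> (p < N)%N -> (r < N)%N ->
  hilbert_sum N p r = 0.
Proof.
move=> p_pr r_pr pN rN.
have [->|pr] := eqVneq p r; first by rewrite hilbert_sum_diag hilbert_sumN1_prime.
have [p2|/(prime_neq2_odd p_pr) p_odd] := eqVneq p 2.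
  by rewrite p2 hilbert_sum_two_prime // prime_neq2_odd // -p2 eq_sym.
have [->|/(prime_neq2_odd r_pr) r_odd] := eqVneq r 2; last exact: hilbert_sum_odd_primes.
by rewrite hilbert_sumC hilbert_sum_two_prime.
Qed.

Lemma int_mul_ind (P : int -> Prop) (N : nat) : P 1 -> P (-1) ->
  (forall p : nat, prime p -> (p < N)%N -> P p) ->
  (forall a b, a != 0 -> b != 0 -> P a -> P b -> P (a * b)) ->
  forall a, a != 0 -> (`|a| < N)%N -> P a.
Proof.
move=> P1 PN1 Pprime PM.
have Pnat (m : nat) : (0 < m)%N -> (m < N)%N -> P m.
  elim/ltn_ind: m => m IHm m_gt0 mN; have [m1|->//] : (1 < m \/ m = 1)%N by lia.
  have d_pr := pdiv_prime m1; have d_le := pdiv_leq m_gt0.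
  have c_gt0 : (0 < m %/ pdiv m)%N by rewrite divn_gt0.
  have c_lt : (m %/ pdiv m < m)%N by rewrite ltn_Pdiv ?prime_gt1.
  rewrite -(divnK (pdiv_dvd m)) PoszM; apply: PM; rewrite ?eqz_nat -?lt0n //.
    exact/IHm/(ltn_trans c_lt).
  exact/Pprime/(leq_ltn_trans d_le).
case=> m m0 mN; first by apply: Pnat; lia.
by rewrite NegzE -mulN1r; apply: PM => //; apply: Pnat => //; lia.
Qed.

Theorem hilbert_product_formula N a b : a != 0 -> b != 0 -> (`|a| < N)%N -> (`|b| < N)%N ->
  hilbert_sum N a b = 0.
Proof.
have sum1 c : hilbert_sum N 1 c = 0.
  by have := @hilbert_sumMl N 1 1 c isT isT; rewrite mul1r; case: (hilbert_sum N 1 c).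
have mulr_zero a1 b1 b2 : b1 != 0 -> b2 != 0 ->
    hilbert_sum N a1 b1 = 0 -> hilbert_sum N a1 b2 = 0 -> hilbert_sum N a1 (b1 * b2) = 0.
  by rewrite !(hilbert_sumC N a1) => b10 b20 Eb1 Eb2; rewrite hilbert_sumMl // Eb1 Eb2 addr0.
move=> a0 b0 aN bN; move: a a0 aN; apply: int_mul_ind => //; last 1 first.
- by move=> a1 a2 a10 a20 Ea1 Ea2; rewrite hilbert_sumMl // Ea1 Ea2 addr0.
- move: b b0 bN; apply: int_mul_ind => //; first by rewrite hilbert_sumC.
  + by rewrite /hilbert_sum big1 // => q /andP [q_pr _]; rewrite /hilbert_odd oddvalN1.
  + by move=> r *; exact: hilbert_sumN1_prime.
  + exact: mulr_zero.
- move=> p p_pr pN; move: b b0 bN; apply: int_mul_ind => //; first by rewrite hilbert_sumC.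
  + by rewrite hilbert_sumC hilbert_sumN1_prime.
  + by move=> r *; exact: hilbert_sum_primes.
  + exact: mulr_zero.
Qed.

(* The conic [x + y = z] has a point, so the symbol of [x / z] and [y / z] vanishes. *)
Lemma hilbert_odd_conic q x y z : prime q -> odd q -> x != 0 -> y != 0 -> z != 0 -> x + y = z ->
  hilbert_odd q (x * z) (y * z) = 0.
Proof.
move=> q_pr q_odd; wlog le_xy : x y / (valz q x <= valz q y)%N.
  move=> W x0 y0 z0 Ez; have [/W|/ltnW/W] := leqP (valz q x) (valz q y); first exact.
  by rewrite hilbert_oddC; apply; rewrite // addrC.
move=> x0 y0 z0 Ez; rewrite /hilbert_odd !oddvalM // !unit_nonresM //.
move: le_xy; rewrite leq_eqVlt => /orP [/eqP Exy|lt_xy].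
  have Eox : oddval q x = oddval q y by rewrite /oddval Exy.
  have Ezu : z = q%:Z ^+ valz q x * (unit_part q x + unit_part q y).
    by rewrite -Ez {1}(unit_partE q x) {1}(unit_partE q y) -Exy; ring.
  have [quxy|/(valz_expM q_pr (valz q x))] := boolP (q%:Z %| unit_part q x + unit_part q y)%Z.
    have -> : unit_nonres q x = unit_nonres q (-1) + unit_nonres q y.
      rewrite -unit_nonresN // /unit_nonres unit_partN //.
      by apply: nonres_eqmod => //; rewrite opprK.
    rewrite Eox; case: (oddval q y); case: (oddval q z);
      by case: (unit_nonres q (-1)); case: (unit_nonres q y); case: (unit_nonres q z).
  rewrite -Ezu => Evz; have -> : oddval q z = oddval q x by rewrite /oddval Evz.
  by rewrite Eox; case: (oddval q y).
have qy : (q%:Z ^+ (valz q x).+1 %| y)%Z by rewrite -valz_ge.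
have [_ _] := sqclassD_odd q_pr q_odd x0 qy; rewrite Ez !sqclass_odd // => -[-> ->].
by case: (oddval q x); case: (oddval q y); case: (unit_nonres q x).
Qed.

(** * Hensel's lemma and compactness *)

Lemma modz_inv_ex (q : nat) (b : int) : prime q -> ~~ (q%:Z %| b)%Z ->
  exists a, (q%:Z %| a * b - 1)%Z.
Proof.
move=> q_pr qb; have : coprimez b q.
  by rewrite /coprimez /gcdz eqz_nat -/(coprime _ _) coprime_sym prime_coprime.
case/coprimezP => -[u v] /= Euv; exists u.
by rewrite -Euv opprD addrA addrN add0r -mulNr dvdz_mull.
Qed.

Lemma hensel_odd q (u : int) k : prime q -> odd q -> ~~ (q%:Z %| u)%Z -> ~~ nonres q u ->
  exists2 x : int, ~~ (q%:Z %| x)%Z & (q%:Z ^+ k.+1 %| x ^+ 2 - u)%Z.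
Proof.
move=> q_pr q_odd qu u_sq; elim: k => [|k [x qx /dvdzP [s Es]]].
  exact: nonres_sqrt.
have q2x : ~~ (q%:Z %| 2 * x)%Z.
  rewrite Euclid_dvdzM // negb_or qx andbT dvdzE.
  by apply/negP => /dvdn_leq -/(_ isT); have := odd_prime_gt2 q_odd q_pr; lia.
have [a /dvdzP [b Eb]] := modz_inv_ex q_pr q2x.
exists (x - q%:Z ^+ k.+1 * (s * a)); first by rewrite rpredBr // exprS -mulrA dvdz_mulr.
have -> : (x - q%:Z ^+ k.+1 * (s * a)) ^+ 2 - u =
    (x ^+ 2 - u) - q%:Z ^+ k.+1 * s * (a * (2 * x)) + (q%:Z ^+ k.+1 * (s * a)) ^+ 2 by ring.
rewrite -(subrK 1 (a * (2 * x))) Eb Es.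
by apply/dvdzP; exists (- s * b + q%:Z ^+ k * (s * a) ^+ 2); rewrite !exprS; ring.
Qed.

Lemma hensel_two (u : int) k : (u %% 8)%Z = 1 ->
  exists2 x : int, ~~ (2 %| x)%Z & (2%N%:Z ^+ k.+3 %| x ^+ 2 - u)%Z.
Proof.
move=> u1; elim: k => [|k [x x_odd /dvdzP [s Es]]].
  by exists 1; rewrite // expr1n -eqz_mod_dvd; apply/eqP.
have [/dvdzP [s' Es']|s_odd] := boolP (2 %| s)%Z.
  by exists x => //; apply/dvdzP; exists s'; rewrite Es Es' [in RHS]exprS; ring.
have /dvdzP [r Er] : (2 %| s + x)%Z by lia.
exists (x + 2 ^+ k.+2); first by rewrite rpredDr // exprS dvdz_mulr.
apply/dvdzP; exists (r + 2 ^+ k).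
have -> : (x + 2 ^+ k.+2) ^+ 2 - u = (x ^+ 2 - u) + 2 * x * 2 ^+ k.+2 + (2 ^+ k.+2) ^+ 2 by ring.
have -> : 2 * x = 2 * (r * 2 - s) by rewrite -Er addrC addKr.
by rewrite Es !exprS; ring.
Qed.

Lemma sqclass0_sqrt q (c : int) K : prime q -> c != 0 -> sqclass q c = 0 ->
  exists x : int, (q%:Z ^+ K %| x ^+ 2 - c)%Z.
Proof.
move=> q_pr c0 Ec.
have [x Ex] : exists x, (q%:Z ^+ K.+3 %| x ^+ 2 - unit_part q c)%Z.
  have qu := unit_part_ndvd q_pr c0.
  have [q2|/(prime_neq2_odd q_pr) q_odd] := eqVneq q 2.
    rewrite q2 in Ec qu *; have [|x _] := @hensel_two (unit_part 2 c) K; last by exists x.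
    move: Ec; rewrite /sqclass /= /eps2 /omega2 mod4_mod8 => -[_].
    by case: (odd_mod8 qu) => ->.
  have [|x _] := hensel_odd K.+2 q_pr q_odd qu; last by exists x.
  by move: Ec; rewrite sqclass_odd // /unit_nonres => -[_ ->].
have v_even : valz q c = (valz q c)./2.*2.
  by rewrite even_halfK //; case: Ec => c_even _ _; rewrite -/(oddval q c) c_even.
exists (q%:Z ^+ (valz q c)./2 * x); rewrite {2}(unit_partE q c) exprMn -exprM muln2 -v_even -mulrBr.
by rewrite dvdz_mull //; apply: dvdz_expW Ex; rewrite -addn3 leq_addr.
Qed.

Lemma diagq_eqmod N (c : N.-tuple int) (x y : 'I_N -> int) (m : int) :
  (forall i, (m %| x i - y i)%Z) -> (m %| diagq c x - diagq c y)%Z.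
Proof.
move=> Exy; rewrite /diagq -sumrB; apply: rpred_sum => i _.
by rewrite -mulrBr subr_sqr; apply: dvdz_mull; apply: dvdz_mulr.
Qed.

Lemma diagqZ N (c : N.-tuple int) (x : 'I_N -> int) (m : int) :
  diagq c (fun i => m * x i) = m ^+ 2 * diagq c x.
Proof. by rewrite /diagq mulr_sumr; apply: eq_bigr => i _; rewrite exprMn mulrCA. Qed.

Definition approx_zero (p N K : nat) (cs : seq (N.-tuple int)) (x : 'I_N -> int) : Prop :=
  (exists i, ~~ (p%:Z %| x i)%Z) /\ forall c, c \in cs -> (p%:Z ^+ K %| diagq c x)%Z.

Section Compactness.
Variables (p N : nat) (cs : seq (N.-tuple int)).
Hypothesis p_pr : prime p.

(* Pigeonhole principle on the residues modulo [p ^ m]. *)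
Let common_residue m (Q : ('I_N -> int) -> Prop) :
  (forall K, exists2 y, approx_zero p K cs y & Q y) ->
  exists x : 'I_N -> int, forall K,
    exists y, [/\ approx_zero p K cs y, Q y & forall i, (p%:Z ^+ m %| y i - x i)%Z].
Proof.
move=> approx; apply: contrapT => no_residue.
have pm_gt0 : (0 < p ^ m)%N by rewrite expn_gt0 prime_gt0.
have bound (g : {ffun 'I_N -> 'I_(p ^ m)}) : exists K, forall y, approx_zero p K cs y -> Q y ->
    ~ forall i, (p%:Z ^+ m %| y i - (g i : nat)%:Z)%Z.
  apply: contrapT => no_bound; apply: no_residue; exists (fun i => (g i : nat)%:Z) => K.
  apply: contrapT => no_y; apply: no_bound; exists K => y y_zero Qy Eyg.
  by apply: no_y; exists y.
have [f fP] := choice bound; have [y [y_prim y_zero] Qy] := approx (\max_g f g)%N.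
have mod_lt i : (`|(y i %% (p ^ m)%N)%Z| < p ^ m)%N by lia.
pose g := [ffun i => Ordinal (mod_lt i)].
apply: (fP g y) => [||i] //.
  by split=> // c /y_zero; apply: dvdz_expW; exact: leq_bigmax.
rewrite /g ffunE /= gez0_abs ?modz_ge0 // -?lt0n //.
by rewrite -PoszX -eqz_mod_dvd modz_mod.
Qed.

Let limit_point k (x : 'I_N -> int) : Prop :=
  forall K, exists2 y, approx_zero p K cs y & forall i, (p%:Z ^+ k.+1 %| y i - x i)%Z.

Let limit_point_step k x : exists x', limit_point k x ->
  limit_point k.+1 x' /\ forall i, (p%:Z ^+ k.+1 %| x' i - x i)%Z.
Proof.
have [lim_x|] := pselect (limit_point k x); last by exists x.
have [x' lim_x'] := common_residue k.+2 lim_x; exists x' => _; split=> [K|i].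
  by have [y [y_zero _ Ey]] := lim_x' K; exists y.
have [y [_ /(_ i) Eyx /(_ i) /(dvdz_expW (leqnSn _)) Eyx']] := lim_x' 0%N.
by rewrite -(subrKA (y i)) rpredD // -opprB rpredN.
Qed.

Lemma Qp_solvableP : Qp_solvable p cs <-> forall K, exists x, approx_zero p K cs x.
Proof.
split=> [[x [x_prim [x_zero _]]] K | approx].
  by exists (x K); split=> // c /x_zero-/(_ K); rewrite PoszX.
have [|x0 lim_x0] := @common_residue 1 (fun=> True).
  by move=> K; have [y] := approx K; exists y.
have {}lim_x0 : limit_point 0 x0 by move=> K; have [y [? _ ?]] := lim_x0 K; exists y.
have [next nextP] := choice (fun kx => limit_point_step kx.1 kx.2).
pose x := fix x k := if k is k'.+1 then next (k', x k') else x0.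
have lim_x k : limit_point k (x k) by elim: k => //= k /(nextP (k, x k)) [].
exists x; split=> [k|]; last split=> [k c c_cs|k i].
- have [y [[i pyi] _] /(_ i) Eyx] := lim_x k 0%N; exists i; apply: contra pyi => pxi.
  have pyx : (p%:Z %| y i - x k i)%Z by apply: dvdz_trans Eyx; rewrite dvdz_exp.
  by rewrite -(subrK (x k i) (y i)) rpredD.
- have [y [_ /(_ c c_cs) y_zero] Eyx] := lim_x k k; rewrite PoszX.
  have /(dvdz_expW (leqnSn _)) Eq := diagq_eqmod c Eyx.
  by rewrite -(subKr (diagq c y) (diagq c (x k))) rpredB.
- have [_ /(_ i)] := nextP (k, x k) (lim_x k).
  by rewrite eqz_mod_dvd PoszX; apply: dvdz_expW.
Qed.

Lemma approx_zero_of_imprimitive K j (w : 'I_N -> int) (i0 : 'I_N) :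
  ~~ (p%:Z ^+ j.+1 %| w i0)%Z ->
  (forall c, c \in cs -> (p%:Z ^+ (K + j.*2) %| diagq c w)%Z) ->
  exists x, approx_zero p K cs x.
Proof.
elim: j w => [|j IHj] w wi0 w_zero.
  by exists w; split=> [|c /w_zero]; [exists i0 | rewrite addn0].
have [w_prim|w_imprim] := pselect (exists i, ~~ (p%:Z %| w i)%Z).
  by exists w; split=> // c /w_zero; apply: dvdz_expW; exact: leq_addr.
have divided i : exists v, w i = p%:Z * v.
  have /dvdzP [v ->] : (p%:Z %| w i)%Z by apply: contrapT => /negP pwi; apply: w_imprim; exists i.
  by exists v; rewrite mulrC.
have [v Ev] := choice divided; have p0 := primez_neq0 p_pr; apply: (IHj v) => [|c /w_zero].
  by apply: contra wi0; rewrite Ev [p%:Z ^+ j.+2]exprS dvdz_mul2l.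
have -> : diagq c w = p%:Z * p%:Z * diagq c v.
  by rewrite -expr2 -diagqZ /diagq; apply: eq_bigr => i _; rewrite Ev.
by rewrite doubleS !addnS !exprS mulrA dvdz_mul2l ?mulf_neq0.
Qed.

End Compactness.

(** * Local solubility in terms of square classes *)

Definition rot3 (d : triple) : triple := (t2 d, t3 d, t1 d).

Definition nonzero3 (d : triple) : bool := [&& t1 d != 0, t2 d != 0 & t3 d != 0].

Definition balanced (E : triple) : bool := nonzero3 E && (t1 E + t2 E + t3 E == 0).

Definition sqclass3 (q : nat) (d : triple) :=
  (sqclass q (t1 d), sqclass q (t2 d), sqclass q (t3 d)).

(* The classes of product 1; the Selmer group lives in this kernel. *)
Definition normker (q : nat) (d : triple) : bool :=
  nonzero3 d && (sqclass q (t1 d) + sqclass q (t2 d) + sqclass q (t3 d) == 0).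

Definition on_curve (E X : triple) (t : int) : Prop :=
  [/\ t3 X = t2 X + t1 E * t ^+ 2, t1 X = t3 X + t2 E * t ^+ 2 & t2 X = t1 X + t3 E * t ^+ 2].

(* [X] stands for the triple of the [d_i * u_i ^ 2]: only their square classes in Q_q matter,
   and since integers are dense in Z_q the three equations can be solved exactly. *)
Definition locsol (q : nat) (E d : triple) : Prop :=
  exists X t, [/\ nonzero3 X, on_curve E X t & sqclass3 q X = sqclass3 q d].

Definition quadrics (E d : triple) : seq (4.-tuple int) :=
  [:: [tuple t1 E; 0; t2 d; - t3 d]; [tuple t2 E; - t1 d; 0; t3 d]; [tuple t3 E; t1 d; - t2 d; 0]].

(* The class of the point of order 2 with [X_1 = 0]. *)
Definition torsion1 (E : triple) : triple := (- t2 E * t3 E, t3 E, - t2 E).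

Definition torsion (E : triple) : seq triple :=
  [:: (1, 1, 1); torsion1 E; rot3 (rot3 (torsion1 (rot3 E))); rot3 (torsion1 (rot3 (rot3 E)))].

Definition torsion_class (q : nat) (E d : triple) : bool :=
  sqclass3 q d \in [seq sqclass3 q t | t <- torsion E].

Lemma tripleE (a b c : int) : (t1 (a, b, c) = a) * (t2 (a, b, c) = b) * (t3 (a, b, c) = c).
Proof. by []. Qed.

Lemma mul3E (d d' : triple) : (t1 (mul3 d d') = t1 d * t1 d') * (t2 (mul3 d d') = t2 d * t2 d')
  * (t3 (mul3 d d') = t3 d * t3 d').
Proof. by []. Qed.

Lemma rot3E d : (t1 (rot3 d) = t2 d) * (t2 (rot3 d) = t3 d) * (t3 (rot3 d) = t1 d).
Proof. by []. Qed.

Lemma rot3K d : rot3 (rot3 (rot3 d)) = d.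
Proof. by case: d => [[]]. Qed.

Lemma nonzero3_rot d : nonzero3 (rot3 d) = nonzero3 d.
Proof. by rewrite /nonzero3 /= andbA andbC. Qed.

Lemma nonzero3_mul d d' : nonzero3 d -> nonzero3 d' -> nonzero3 (mul3 d d').
Proof.
by move=> /and3P [d1 d2 d3] /and3P [d1' d2' d3']; rewrite /nonzero3 !mulf_neq0.
Qed.

Lemma balanced_nonzero3 E : balanced E -> nonzero3 E.
Proof. by case/andP. Qed.

Lemma balanced_rot E : balanced E -> balanced (rot3 E).
Proof. by rewrite /balanced nonzero3_rot -addrA [t1 E + _]addrC. Qed.

Lemma balanced_t1 E : balanced E -> t1 E = - t2 E - t3 E.
Proof. by move=> /andP [_ /eqP E0]; rewrite -[RHS]addr0 -E0; ring. Qed.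

Lemma sqclass3P q d d' : sqclass3 q d = sqclass3 q d' <->
  [/\ sqclass q (t1 d) = sqclass q (t1 d'), sqclass q (t2 d) = sqclass q (t2 d')
    & sqclass q (t3 d) = sqclass q (t3 d')].
Proof.
split=> [Ed|[Ed1 Ed2 Ed3]]; last by rewrite /sqclass3 Ed1 Ed2 Ed3.
by split; [exact: (congr1 (fun s => s.1.1) Ed) | exact: (congr1 (fun s => s.1.2) Ed)
  | exact: (congr1 snd Ed)].
Qed.

Lemma sqclass3_rot q d d' : sqclass3 q d = sqclass3 q d' ->
  sqclass3 q (rot3 d) = sqclass3 q (rot3 d').
Proof. by move=> /sqclass3P [Ed1 Ed2 Ed3]; apply/sqclass3P. Qed.

Lemma sqclass3_mul q d d' : prime q -> nonzero3 d -> nonzero3 d' ->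
  sqclass3 q (mul3 d d') = sqclass3 q d + sqclass3 q d'.
Proof.
by move=> q_pr /and3P [d1 d2 d3] /and3P [d1' d2' d3']; rewrite /sqclass3 !sqclassM.
Qed.

Lemma sqclass3_addrr q d : sqclass3 q d + sqclass3 q d = 0.
Proof. by rewrite -[LHS]/(_ + _, _ + _, _ + _) !addrr_bool3. Qed.

Lemma sqclass3_one q : prime q -> sqclass3 q (1, 1, 1) = 0.
Proof. by move=> q_pr; rewrite /sqclass3 sqclass1. Qed.

Lemma normker_nonzero3 q d : normker q d -> nonzero3 d.
Proof. by case/andP. Qed.

Lemma normker_rot q d : normker q d -> normker q (rot3 d).
Proof. by rewrite /normker nonzero3_rot -addrA [sqclass q (t1 d) + _]addrC. Qed.

Lemma normker_t1 q d : normker q d -> sqclass q (t1 d) = sqclass q (t2 d) + sqclass q (t3 d).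
Proof. by move=> /andP [_]; rewrite -addrA addr_eq0 oppr_bool3 => /eqP. Qed.

Lemma normker_sqclass3 q d d' : nonzero3 d' -> sqclass3 q d' = sqclass3 q d ->
  normker q d -> normker q d'.
Proof. by rewrite /normker => -> /sqclass3P [-> -> ->] /andP []. Qed.

Lemma normker_mul q d d' : prime q -> normker q d -> normker q d' -> normker q (mul3 d d').
Proof.
move=> q_pr dN dN'.
rewrite /normker nonzero3_mul ?(normker_nonzero3 dN) ?(normker_nonzero3 dN') //=.
have [/and3P [d1 d2 d3] /and3P [d1' d2' d3']] := (normker_nonzero3 dN, normker_nonzero3 dN').
rewrite !sqclassM // [X in X + (sqclass q (t3 d) + _)]addrACA [X in X == _]addrACA.
by case/andP: dN => _ /eqP ->; case/andP: dN' => _ /eqP ->; rewrite addr0.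
Qed.

Lemma normker_torsion1 q E : prime q -> nonzero3 E -> normker q (torsion1 E).
Proof.
move=> q_pr /and3P [E1 E2 E3].
rewrite /normker /nonzero3 /torsion1 !mulf_neq0 ?oppr_eq0 //= E3 E2 /=.
by rewrite sqclassM ?oppr_eq0 // -addrA [X in _ + X]addrC addrr_bool3.
Qed.

Lemma on_curve_rot E X t : on_curve E X t -> on_curve (rot3 E) (rot3 X) t.
Proof. by case. Qed.

Lemma locsol_rot q E d : locsol q E d -> locsol q (rot3 E) (rot3 d).
Proof.
move=> [X [t [X0 EX Xd]]]; exists (rot3 X), t; split.
- by rewrite nonzero3_rot.
- exact: on_curve_rot.
- exact: sqclass3_rot.
Qed.

Lemma locsol_sqclass3 q E d d' : sqclass3 q d = sqclass3 q d' -> locsol q E d -> locsol q E d'.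
Proof. by move=> Ed [X [t [X0 EX Xd]]]; exists X, t; rewrite -Ed. Qed.

Lemma locsol_trivial q E d : prime q -> sqclass3 q d = 0 -> locsol q E d.
Proof.
move=> q_pr Ed; exists (1, 1, 1), 0; rewrite sqclass3_one //; split=> //.
by split; rewrite /= expr0n mulr0 addr0.
Qed.

Lemma locsol_torsion1 q E : prime q -> balanced E -> locsol q E (torsion1 E).
Proof.
move=> q_pr Ebal; have /and3P [E10 E20 E30] := balanced_nonzero3 Ebal.
pose c : int := q%:Z ^+ (valz q (t2 E) + valz q (t3 E) + 3).
have c0 : c != 0 by rewrite expf_neq0 // primez_neq0.
pose x := - t2 E * t3 E * c ^+ 2.
have nE20 : - t2 E != 0 by rewrite oppr_eq0.
have x0 : x != 0 by exact: (mulf_neq0 (mulf_neq0 nE20 E30) (expf_neq0 2 c0)).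
have x_dvd k : (k <= valz q (t2 E) + valz q (t3 E) + 3)%N -> (q%:Z ^+ k %| x)%Z.
  by move=> le_k; rewrite dvdz_mull // expr2 dvdz_mull // dvdz_exp2l.
have [|X20 _ X2] := @sqclassD q q_pr (t3 E) x E30; first by apply: x_dvd; lia.
have [|X30 _ X3] := @sqclassD q q_pr (- t2 E) x nE20; first by rewrite valzN; apply: x_dvd; lia.
exists (x, t3 E + x, - t2 E + x), 1; split.
- by apply/and3P; split.
- by split; rewrite !tripleE ?(balanced_t1 Ebal); ring.
- by rewrite /sqclass3 !tripleE X2 X3 sqclassMsqr // mulf_neq0.
Qed.

Lemma torsion_nonzero3 E t : balanced E -> t \in torsion E -> nonzero3 t.
Proof.
move=> /balanced_nonzero3 /and3P [E1 E2 E3]; rewrite !inE => /or4P [] /eqP ->;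
  by rewrite /nonzero3 !(rot3E, tripleE) ?mulf_neq0 ?oppr_eq0 ?E1 ?E2 ?E3.
Qed.

Lemma locsol_torsion q E t : prime q -> balanced E -> t \in torsion E -> locsol q E t.
Proof.
move=> q_pr E0; have [E1 E2] := (balanced_rot E0, balanced_rot (balanced_rot E0)).
rewrite !inE => /or4P [] /eqP ->.
- by apply: locsol_trivial; rewrite ?sqclass3_one.
- exact: locsol_torsion1.
- by rewrite -[E]rot3K; do 2 apply: locsol_rot; exact: locsol_torsion1.
- by rewrite -[E in locsol _ E]rot3K; apply: locsol_rot; exact: locsol_torsion1.
Qed.

Lemma torsion_classP q E d :
  reflect (exists2 t, t \in torsion E & sqclass3 q d = sqclass3 q t) (torsion_class q E d).
Proof. exact: mapP. Qed.

Lemma torsion_class_locsol q E d : prime q -> balanced E -> torsion_class q E d -> locsol q E d.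
Proof.
move=> q_pr Ebal /torsion_classP [t tE Ed].
by apply: (locsol_sqclass3 (esym Ed)); exact: locsol_torsion.
Qed.

Lemma torsion_class_trivial q E d : prime q -> sqclass3 q d = 0 -> torsion_class q E d.
Proof.
by move=> q_pr Ed; apply/torsion_classP; exists (1, 1, 1); rewrite ?inE ?eqxx ?sqclass3_one.
Qed.

Lemma torsion_class1 q E d : prime q -> nonzero3 E -> normker q d ->
  sqclass q (t2 d) = sqclass q (t3 E) -> sqclass q (t3 d) = sqclass q (- t2 E) ->
  torsion_class q E d.
Proof.
move=> q_pr E0 dN Ed2 Ed3; apply/torsion_classP; exists (torsion1 E).
  by rewrite !inE eqxx orbT.
apply/sqclass3P; split; rewrite // (normker_t1 dN) (normker_t1 (normker_torsion1 q_pr E0)).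
by rewrite Ed2 Ed3.
Qed.

Lemma torsion_class_rot q E d : torsion_class q (rot3 E) (rot3 d) -> torsion_class q E d.
Proof.
move=> /torsion_classP [t tE /sqclass3_rot/sqclass3_rot]; rewrite rot3K => Ed.
apply/torsion_classP; exists (rot3 (rot3 t)) => //.
by move: tE; rewrite !inE => /or4P [] /eqP ->; rewrite ?rot3K eqxx ?orbT.
Qed.

Lemma ord4P (i : 'I_4) : [\/ i = 0, i = 1, i = 2 | i = 3].
Proof.
by case: i => [[|[|[|[|i]]]] Hi] //; [constructor 1|constructor 2|constructor 3|constructor 4];
  apply: val_inj.
Qed.

Lemma diagq4 (R : comNzRingType) (a b c d : int) (x : 'I_4 -> R) :
  diagq [tuple a; b; c; d] x =
  a%:~R * x 0 ^+ 2 + b%:~R * x 1 ^+ 2 + c%:~R * x 2 ^+ 2 + d%:~R * x 3 ^+ 2.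
Proof.
rewrite /diagq !big_ord_recl big_ord0 !(tnth_nth 0) /= addr0 !addrA.
by congr (_ + _ + _ + _); congr (_ * x _ ^+ 2); apply: val_inj.
Qed.

Lemma quadricsP (R : comNzRingType) (P : R -> Prop) E d (x : 'I_4 -> R) :
  (forall c, c \in quadrics E d -> P (diagq c x)) <->
  [/\ P ((t1 E)%:~R * x 0 ^+ 2 + (t2 d)%:~R * x 2 ^+ 2 - (t3 d)%:~R * x 3 ^+ 2),
      P ((t2 E)%:~R * x 0 ^+ 2 + (t3 d)%:~R * x 3 ^+ 2 - (t1 d)%:~R * x 1 ^+ 2)
    & P ((t3 E)%:~R * x 0 ^+ 2 + (t1 d)%:~R * x 1 ^+ 2 - (t2 d)%:~R * x 2 ^+ 2)].
Proof.
set P1 := P _; set P2 := P _; set P3 := P _.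
have <- : P (diagq [tuple t1 E; 0; t2 d; - t3 d] x) = P1.
  by congr P; rewrite diagq4 rmorphN; ring.
have <- : P (diagq [tuple t2 E; - t1 d; 0; t3 d] x) = P2.
  by congr P; rewrite diagq4 rmorphN; ring.
have <- : P (diagq [tuple t3 E; t1 d; - t2 d; 0] x) = P3.
  by congr P; rewrite diagq4 rmorphN; ring.
split=> [Px | [Px1 Px2 Px3] c].
  by split; apply: Px; rewrite !inE eqxx ?orbT.
by rewrite !inE => /or3P [] /eqP ->.
Qed.

Definition approx_point (q K : nat) (E d : triple) (t : int) (u : triple) : Prop :=
  ~~ [&& (q%:Z %| t)%Z, (q%:Z %| t1 u)%Z, (q%:Z %| t2 u)%Z & (q%:Z %| t3 u)%Z] /\
  [/\ (q%:Z ^+ K %| t1 E * t ^+ 2 + t2 d * t2 u ^+ 2 - t3 d * t3 u ^+ 2)%Z,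
      (q%:Z ^+ K %| t2 E * t ^+ 2 + t3 d * t3 u ^+ 2 - t1 d * t1 u ^+ 2)%Z
    & (q%:Z ^+ K %| t3 E * t ^+ 2 + t1 d * t1 u ^+ 2 - t2 d * t2 u ^+ 2)%Z].

Lemma approx_zero_point q K E d (x : 'I_4 -> int) :
  approx_zero q K (quadrics E d) x -> approx_point q K E d (x 0) (x 1, x 2, x 3).
Proof.
move=> [[i qxi] /(quadricsP (fun a => q%:Z ^+ K %| a)%Z)]; rewrite !intz => x_zero; split=> //.
by apply: contra qxi => /and4P [? ? ? ?]; case: (ord4P i) => ->.
Qed.

Lemma approx_point_rot q K E d t u :
  approx_point q K E d t u -> approx_point q K (rot3 E) (rot3 d) t (rot3 u).
Proof. by move=> [u_prim [? ? ?]]; split=> //; apply: contra u_prim => /and4P [-> -> -> ->]. Qed.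

Lemma approx_pointW q K L E d t u : (L <= K)%N ->
  approx_point q K E d t u -> approx_point q L E d t u.
Proof. by move=> LK [u_prim [? ? ?]]; split=> //; split; apply: (dvdz_expW LK). Qed.

Definition valz_le3 (q M : nat) (d : triple) : bool :=
  [&& (valz q (t1 d) <= M)%N, (valz q (t2 d) <= M)%N & (valz q (t3 d) <= M)%N].

Lemma valz_le3_rot q M d : valz_le3 q M (rot3 d) = valz_le3 q M d.
Proof. by rewrite /valz_le3 andbA andbC. Qed.

Lemma locsol_Qp_solvable q E d : prime q -> nonzero3 d ->
  locsol q E d -> Qp_solvable q (quadrics E d).
Proof.
move=> q_pr /and3P [d1 d2 d3] [X [t [/and3P [X1 X2 X3] [eX3 eX1 eX2] /sqclass3P [s1 s2 s3]]]].
apply/(Qp_solvableP _ q_pr) => K.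
pose D := t1 d * t1 X * (t2 d * t3 d) ^+ 2.
have D0 : D != 0 by rewrite !mulf_neq0 // expf_neq0 // mulf_neq0.
pose j := valz q D; pose L := (K + j.*2 + j.+1)%N.
have sqrt_dX (a x : int) : a != 0 -> x != 0 -> sqclass q x = sqclass q a ->
    exists c : int, (q%:Z ^+ L %| c ^+ 2 - a * x)%Z.
  by move=> a0 x0 Exa; apply: sqclass0_sqrt; rewrite ?mulf_neq0 // sqclassM // Exa addrr_bool3.
have [[c1 /dvdzP [a1 Ec1]] [c2 /dvdzP [a2 Ec2]]] := (sqrt_dX _ _ d1 X1 s1, sqrt_dX _ _ d2 X2 s2).
have [c3 /dvdzP [a3 Ec3]] := sqrt_dX _ _ d3 X3 s3.
pose w (i : 'I_4) := tnth [tuple t * (t1 d * t2 d * t3 d); c1 * (t2 d * t3 d);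
  c2 * (t1 d * t3 d); c3 * (t1 d * t2 d)] i.
apply: (approx_zero_of_imprimitive q_pr (j := j) (w := w) (i0 := 1)).
  rewrite /w (tnth_nth 0) /=; apply/negP => qc1.
  have qc1sqr : (q%:Z ^+ j.+1 %| (c1 * (t2 d * t3 d)) ^+ 2)%Z by rewrite expr2 dvdz_mulr.
  have qL : (q%:Z ^+ j.+1 %| a1 * q%:Z ^+ L * (t2 d * t3 d) ^+ 2)%Z.
    by rewrite dvdz_mulr // dvdz_mull // dvdz_exp2l // leq_addl.
  have := rpredB qc1sqr qL; rewrite -Ec1 (_ : _ - _ = D); last by rewrite /D; ring.
  by rewrite -valz_ge // ltnn.
apply/(quadricsP (fun a => q%:Z ^+ (K + j.*2) %| a)%Z); rewrite !intz /w !(tnth_nth 0) /=.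
have LE (a : int) : (q%:Z ^+ L %| a)%Z -> (q%:Z ^+ (K + j.*2) %| a)%Z.
  by apply: dvdz_expW; exact: leq_addr.
move/(canRL (subrK _)): Ec1 => Ec1; move/(canRL (subrK _)): Ec2 => Ec2.
move/(canRL (subrK _)): Ec3 => Ec3.
move: (q%:Z ^+ L) Ec1 Ec2 Ec3 LE => Q Ec1 Ec2 Ec3 LE; rewrite !exprMn Ec1 Ec2 Ec3.
split; apply: LE; apply/dvdzP.
- exists (t2 d * (t1 d * t3 d) ^+ 2 * a2 - t3 d * (t1 d * t2 d) ^+ 2 * a3); rewrite eX3; ring.
- exists (t3 d * (t1 d * t2 d) ^+ 2 * a3 - t1 d * (t2 d * t3 d) ^+ 2 * a1); rewrite eX1; ring.
- exists (t1 d * (t2 d * t3 d) ^+ 2 * a1 - t2 d * (t1 d * t3 d) ^+ 2 * a2); rewrite eX2; ring.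
Qed.

Lemma dvdz_coef_sqr q (a x : int) : prime q -> a != 0 ->
  (q%:Z ^+ (valz q a).+1 %| a * x ^+ 2)%Z -> (q%:Z %| x)%Z.
Proof.
move=> q_pr a0; apply: contraLR => qx; have x0 := ndvdz_neq0 qx.
rewrite -valz_ge ?mulf_neq0 ?expf_neq0 // valzM ?expf_neq0 // valz_sqr // (valz_unit qx).
by rewrite addn0 ltnn.
Qed.

Lemma sqclass_coef_sqr q (a b c t x : int) : prime q -> a != 0 -> t != 0 -> c != 0 ->
  a * t ^+ 2 + b = c * x ^+ 2 -> (q%:Z ^+ (valz q a + (valz q t).*2 + 3) %| b)%Z ->
  sqclass q a = sqclass q c.
Proof.
move=> q_pr a0 t0 c0 Ex; rewrite -valz_sqr // -valzM ?expf_neq0 // => qb.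
have at0 : a * t ^+ 2 != 0 by rewrite mulf_neq0 ?expf_neq0.
have [cx0 _ Eac] := sqclassD q_pr at0 qb; rewrite Ex in cx0 Eac.
rewrite -(sqclassMsqr q_pr a0 t0) -Eac sqclassMsqr //.
by apply: contraNneq cx0 => ->; rewrite expr0n mulr0.
Qed.

Lemma approx_point_small1_t q E d t u M K : prime q -> nonzero3 d -> valz_le3 q M d ->
  (M < K)%N -> approx_point q K E d t u -> (q%:Z ^+ K %| t1 d * t1 u ^+ 2)%Z ->
  ~~ (q%:Z ^+ M.+1 %| t)%Z.
Proof.
move=> q_pr /and3P [d1 d2 d3] /and3P [vd1 vd2 vd3] MK [u_prim [_ eq2 eq3]] small.
apply: contra u_prim => qt.
have le_K v : (v <= M)%N -> (v.+1 <= K)%N by move=> vM; exact: leq_trans MK.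
have qEt (a : int) v : (v <= M)%N -> (q%:Z ^+ v.+1 %| a * t ^+ 2)%Z.
  by move=> vM; rewrite dvdz_mull // expr2 dvdz_mulr // (dvdz_expW _ qt).
apply/and4P; split.
- by apply: dvdz_trans qt; rewrite dvdz_exp.
- by apply: (dvdz_coef_sqr q_pr d1); apply: dvdz_expW small; exact: le_K.
- apply: (dvdz_coef_sqr q_pr d2); have qW := dvdz_expW (le_K _ vd2).
  have := rpredB (rpredD (qEt (t3 E) _ vd2) (qW _ _ small)) (qW _ _ eq3).
  by rewrite opprB addrC subrK.
- apply: (dvdz_coef_sqr q_pr d3); have qW := dvdz_expW (le_K _ vd3).
  have := rpredB (rpredD (qW _ _ eq2) (qW _ _ small)) (qEt (t2 E) _ vd3).
  by rewrite subrK addrC addKr.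
Qed.

(* If [d_1 u_1 ^ 2] is q-adically small in a primitive approximate point, then [t] is not,
   and the point is close to the point with [X_1 = 0]. *)
Lemma approx_point_small1 q E d t u M : prime q -> balanced E -> normker q d ->
  valz_le3 q M E -> valz_le3 q M d -> approx_point q (3 * M + 3) E d t u ->
  (q%:Z ^+ (3 * M + 3) %| t1 d * t1 u ^+ 2)%Z -> torsion_class q E d.
Proof.
have leM : (M < 3 * M + 3)%N by lia.
have le3M v w : (v <= M)%N -> (w <= M)%N -> (v + w.*2 + 3 <= 3 * M + 3)%N by lia.
move=> q_pr Ebal dN /and3P [_ vE2 vE3] Md uP small; have [_ [_ eq2 eq3]] := uP.
have [/and3P [d1 d2 d3] /and3P [_ E2 E3]] := (normker_nonzero3 dN, balanced_nonzero3 Ebal).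
have qt := approx_point_small1_t q_pr (normker_nonzero3 dN) Md leM uP small.
have [t0 vt] : t != 0 /\ (valz q t <= M)%N by split; [exact: ndvdz_neq0 qt | exact: valz_lt qt].
have s3 : sqclass q (- t2 E) = sqclass q (t3 d).
  have Ex : - t2 E * t ^+ 2
      + (t1 d * t1 u ^+ 2 + (t2 E * t ^+ 2 + t3 d * t3 u ^+ 2 - t1 d * t1 u ^+ 2))
      = t3 d * t3 u ^+ 2 by ring.
  apply: (sqclass_coef_sqr q_pr _ t0 d3 Ex); rewrite ?oppr_eq0 // valzN.
  by apply: dvdz_expW (rpredD small eq2); exact: le3M.
have s2 : sqclass q (t3 E) = sqclass q (t2 d).
  have Ex : t3 E * t ^+ 2
      + (t1 d * t1 u ^+ 2 - (t3 E * t ^+ 2 + t1 d * t1 u ^+ 2 - t2 d * t2 u ^+ 2))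
      = t2 d * t2 u ^+ 2 by ring.
  apply: (sqclass_coef_sqr q_pr _ t0 d2 Ex) => //.
  by apply: dvdz_expW (rpredB small eq3); exact: le3M.
by apply: torsion_class1; rewrite ?balanced_nonzero3.
Qed.

(* When no [d_i u_i ^ 2] is small, the approximate point lifts to a solution with the same [X_1]. *)
Lemma approx_point_locsol q E d t u K : prime q -> balanced E -> nonzero3 d ->
  approx_point q (K + 3) E d t u -> ~~ (q%:Z ^+ K %| t1 d * t1 u ^+ 2)%Z ->
  ~~ (q%:Z ^+ K %| t2 d * t2 u ^+ 2)%Z -> ~~ (q%:Z ^+ K %| t3 d * t3 u ^+ 2)%Z ->
  locsol q E d.
Proof.
move=> q_pr Ebal /and3P [d1 d2 d3] [_ [_ eq2 eq3]] n1 n2 n3.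
have u_neq0 (a x : int) : ~~ (q%:Z ^+ K %| a * x ^+ 2)%Z -> x != 0.
  by move=> /ndvdz_neq0; apply: contraNneq => ->; rewrite expr0n mulr0.
have le_val (y : int) : ~~ (q%:Z ^+ K %| y)%Z -> (valz q y + 3 <= K + 3)%N.
  by move=> qy; rewrite leq_add2r ltnW // valz_lt.
have [X20 _ X2] := sqclassD q_pr (ndvdz_neq0 n2) (dvdz_expW (le_val _ n2) eq3).
have eq2N := rpredNr eq2.
have [X30 _ X3] := sqclassD q_pr (ndvdz_neq0 n3) (dvdz_expW (le_val _ n3) eq2N).
set x2 := _ + _ in X2 X20; set x3 := _ - _ in X3 X30.
exists (t1 d * t1 u ^+ 2, x2, x3), t; split.
- by apply/and3P; split; rewrite // (ndvdz_neq0 n1).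
- by rewrite /x2 /x3; split; rewrite !tripleE ?(balanced_t1 Ebal); ring.
- by rewrite /sqclass3 !tripleE X2 X3 !sqclassMsqr // (u_neq0 _ _ n1, u_neq0 _ _ n2, u_neq0 _ _ n3).
Qed.

Lemma Qp_solvable_locsol q E d : prime q -> balanced E -> normker q d ->
  Qp_solvable q (quadrics E d) -> locsol q E d.
Proof.
move=> q_pr Ebal dN /(Qp_solvableP _ q_pr) approx; have d0 := normker_nonzero3 dN.
have [M [ME Md]] : exists M, valz_le3 q M E /\ valz_le3 q M d.
  exists (valz q (t1 E) + valz q (t2 E) + valz q (t3 E)
    + (valz q (t1 d) + valz q (t2 d) + valz q (t3 d)))%N.
  by clear; split; apply/and3P; split; lia.
have [x /approx_zero_point] := approx (3 * M + 3 + 3)%N.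
move: (x 0) (x 1, x 2, x 3) => t u uP {x}.
have small1 E' d' u' : balanced E' -> normker q d' -> valz_le3 q M E' -> valz_le3 q M d' ->
    approx_point q (3 * M + 3 + 3) E' d' t u' -> (q%:Z ^+ (3 * M + 3) %| t1 d' * t1 u' ^+ 2)%Z ->
    locsol q E' d'.
  move=> E'bal d'N ME' Md' u'P small; apply: torsion_class_locsol => //.
  by apply: approx_point_small1 small => //; apply: approx_pointW u'P; exact: leq_addr.
have [E1 E2] := (balanced_rot Ebal, balanced_rot (balanced_rot Ebal)).
have [d1 d2] := (normker_rot dN, normker_rot (normker_rot dN)).
have [u1 u2] := (approx_point_rot uP, approx_point_rot (approx_point_rot uP)).
have [|n1] := boolP (q%:Z ^+ (3 * M + 3) %| t1 d * t1 u ^+ 2)%Z; first exact: small1 uP.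
have [small|n2] := boolP (q%:Z ^+ (3 * M + 3) %| t2 d * t2 u ^+ 2)%Z.
  rewrite -[E]rot3K -[d]rot3K; do 2 apply: locsol_rot.
  by apply: small1 u1 small; rewrite ?valz_le3_rot.
have [small|n3] := boolP (q%:Z ^+ (3 * M + 3) %| t3 d * t3 u ^+ 2)%Z.
  rewrite -[E]rot3K -[d]rot3K; apply: locsol_rot.
  by apply: small1 u2 small; rewrite ?valz_le3_rot.
exact: approx_point_locsol uP n1 n2 n3.
Qed.

(** * Translation by torsion and primes with equal valuations *)

Lemma normker_t2 q d : normker q d -> sqclass q (t2 d) = sqclass q (t3 d) + sqclass q (t1 d).
Proof. by move/normker_rot/normker_t1. Qed.

Lemma normker_t3 q d : normker q d -> sqclass q (t3 d) = sqclass q (t1 d) + sqclass q (t2 d).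
Proof. by move/normker_rot/normker_t2. Qed.

Lemma normker_const q d : normker q d -> sqclass q (t2 d) = sqclass q (t1 d) ->
  sqclass q (t3 d) = sqclass q (t1 d) -> sqclass3 q d = 0.
Proof.
move=> dN E2 E3; have := normker_t1 dN; rewrite E2 E3 addrr_bool3 => E1.
by rewrite /sqclass3 E2 E3 E1.
Qed.

Lemma normker_oddval q d : normker q d -> oddval q (t1 d) = oddval q (t2 d) + oddval q (t3 d).
Proof. by move=> /normker_t1 []. Qed.

Lemma on_curve0_sqclass3 q E X : on_curve E X 0 -> normker q X -> sqclass3 q X = 0.
Proof.
rewrite /on_curve !expr0n !mulr0 !addr0 => -[EX3 _ EX2] XN.
by apply: normker_const; rewrite // ?EX3 EX2.
Qed.

(* For the lifts [X] of [d], the translate of [(X, t)] by the point with [X_1 = 0] is a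
   multiple of [(- E_2 E_3 / X_1, E_3 X_3 / X_1, - E_2 X_2 / X_1)]. *)
Lemma locsol_translate1 q E d : prime q -> balanced E -> normker q d ->
  locsol q E d -> locsol q E (mul3 (torsion1 E) d).
Proof.
move=> q_pr Ebal dN [X [t [X0 EX Xd]]]; have XN := normker_sqclass3 X0 Xd dN.
have T0 := normker_nonzero3 (normker_torsion1 q_pr (balanced_nonzero3 Ebal)).
suff : locsol q E (mul3 (torsion1 E) X).
  by apply: locsol_sqclass3; rewrite !sqclass3_mul ?(normker_nonzero3 dN) // Xd.
have [tE|t0] := eqVneq t 0.
  rewrite tE in EX; have := locsol_torsion1 q_pr Ebal; apply: locsol_sqclass3.
  by rewrite sqclass3_mul // (on_curve0_sqclass3 EX XN) addr0.
have [/and3P [E1 E2 E3] /and3P [X1 X2 X3]] := (balanced_nonzero3 Ebal, X0).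
have nE2 : - t2 E != 0 by rewrite oppr_eq0.
have [EX3 EX1 EX2] := EX.
exists (- t2 E * t3 E * t1 X * t ^+ 2, t3 E * (t3 X * t1 X), - t2 E * (t1 X * t2 X)), (t1 X); split.
- by apply/and3P; split; rewrite !tripleE ?mulf_neq0 ?expf_neq0 // mulf_neq0.
- have EX3' : t3 X = t1 X - t2 E * t ^+ 2 by rewrite EX1; ring.
  by split; rewrite !tripleE ?EX2 ?EX3' ?(balanced_t1 Ebal); ring.
- apply/sqclass3P; rewrite !mul3E !tripleE; split.
  + by rewrite sqclassMsqr ?mulf_neq0.
  + by rewrite !sqclassM ?mulf_neq0 // (normker_t2 XN).
  + by rewrite !sqclassM ?mulf_neq0 // (normker_t3 XN).
Qed.

Lemma locsol_translate q E d t : prime q -> balanced E -> normker q d -> t \in torsion E ->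
  locsol q E d -> locsol q E (mul3 t d).
Proof.
move=> q_pr Ebal dN tE dL.
have [E1 E2] := (balanced_rot Ebal, balanced_rot (balanced_rot Ebal)).
have [dN1 dN2] := (normker_rot dN, normker_rot (normker_rot dN)).
have [dL1 dL2] := (locsol_rot dL, locsol_rot (locsol_rot dL)).
move: tE; rewrite !inE => /or4P [] /eqP ->.
- by apply: locsol_sqclass3 dL; rewrite /sqclass3 !mul3E !tripleE !mul1r.
- exact: locsol_translate1.
- by have := locsol_rot (locsol_rot (locsol_translate1 q_pr E1 dN1 dL1)); rewrite rot3K.
- by have := locsol_rot (locsol_translate1 q_pr E2 dN2 dL2); rewrite rot3K.
Qed.

Definition equal_valz (q r : nat) (E : triple) : bool :=
  [&& valz q (t1 E) == r, valz q (t2 E) == r & valz q (t3 E) == r].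

Lemma equal_valz_rot q r E : equal_valz q r E -> equal_valz q r (rot3 E).
Proof. by case/and3P=> *; apply/and3P. Qed.

Lemma on_curve_valz_neq q r E X t : prime q -> odd q -> balanced E -> equal_valz q r E ->
  normker q X -> on_curve E X t -> t != 0 -> valz q (t1 X) != (r + (valz q t).*2)%N ->
  torsion_class q E X.
Proof.
move=> q_pr q_odd Ebal /and3P [_ /eqP vE2 /eqP vE3] XN [_ EX1 EX2] t0.
have [/and3P [_ E2 E3] /and3P [X1 X2 X3]] := (balanced_nonzero3 Ebal, normker_nonzero3 XN).
have Et0 e : e != 0 -> e * t ^+ 2 != 0 by move=> e0; rewrite mulf_neq0 ?expf_neq0.
have vEt e : e != 0 -> valz q e = r -> valz q (e * t ^+ 2) = (r + (valz q t).*2)%N.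
  by move=> e0 <-; rewrite valzM ?expf_neq0 // valz_sqr.
have nE2 : - t2 E != 0 by rewrite oppr_eq0.
have vnE2 : valz q (- t2 E) = r by rewrite valzN.
have {}EX1 : t3 X = t1 X + - t2 E * t ^+ 2 by rewrite EX1; ring.
rewrite neq_ltn => /orP [small|large].
  have near e : e != 0 -> valz q e = r -> sqclass q (t1 X + e * t ^+ 2) = sqclass q (t1 X).
    by move=> e0 ve; have [|//] := sqclassD_odd q_pr q_odd X1 (b := e * t ^+ 2);
      rewrite -valz_ge ?Et0 ?vEt.
  by apply: torsion_class_trivial; rewrite // (normker_const XN) // ?EX1 ?EX2 near.
have near e : e != 0 -> valz q e = r -> sqclass q (t1 X + e * t ^+ 2) = sqclass q e.
  move=> e0 ve; rewrite addrC -(sqclassMsqr q_pr e0 t0).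
  by have [|//] := sqclassD_odd q_pr q_odd (Et0 _ e0) (b := t1 X); rewrite vEt // -valz_ge.
by apply: torsion_class1; rewrite ?balanced_nonzero3 // ?EX1 ?EX2 near.
Qed.

Lemma locsol_equal_valz q r E d : prime q -> odd q -> balanced E -> equal_valz q r E ->
  normker q d -> locsol q E d ->
  torsion_class q E d \/
  [/\ oddval q (t1 d) = odd r, oddval q (t2 d) = odd r & oddval q (t3 d) = odd r].
Proof.
move=> q_pr q_odd Ebal Er dN [X [t [X0 EX Xd]]]; have XN := normker_sqclass3 X0 Xd dN.
rewrite /torsion_class -Xd -/(torsion_class q E X).
have [/sqclass_oddval <- /sqclass_oddval <- /sqclass_oddval <-] :=
  iffLR (sqclass3P q X d) Xd.
have [tE|t0] := eqVneq t 0.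
  by left; apply: torsion_class_trivial; rewrite // (on_curve0_sqclass3 (E := E)) // -tE.
have [E1 E2] := (balanced_rot Ebal, balanced_rot (balanced_rot Ebal)).
have [Er1 Er2] := (equal_valz_rot Er, equal_valz_rot (equal_valz_rot Er)).
have [XN1 XN2] := (normker_rot XN, normker_rot (normker_rot XN)).
have [EX1 EX2] := (on_curve_rot EX, on_curve_rot (on_curve_rot EX)).
have [vX1|/(on_curve_valz_neq q_pr q_odd Ebal Er XN EX t0)] :=
  eqVneq (valz q (t1 X)) (r + (valz q t).*2)%N; last by left.
have [vX2|/(on_curve_valz_neq q_pr q_odd E1 Er1 XN1 EX1 t0)/torsion_class_rot] :=
  eqVneq (valz q (t2 X)) (r + (valz q t).*2)%N; last by left.
have [vX3|/(on_curve_valz_neq q_pr q_odd E2 Er2 XN2 EX2 t0)/torsion_class_rot/torsion_class_rot] :=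
  eqVneq (valz q (t3 X)) (r + (valz q t).*2)%N; last by left.
by right; rewrite /oddval vX1 vX2 vX3 oddD odd_double addbF.
Qed.

Lemma locsol_ramified q r E d : prime q -> odd q -> balanced E -> equal_valz q r E -> odd r ->
  normker q d -> locsol q E d <-> torsion_class q E d.
Proof.
move=> q_pr q_odd Ebal Er r_odd dN; split; last exact: torsion_class_locsol.
case/(locsol_equal_valz q_pr q_odd Ebal Er dN) => // -[o1 o2 o3].
by have := normker_oddval dN; rewrite o1 o2 o3 r_odd.
Qed.

Lemma locsol_unramified q r E d : prime q -> odd q -> balanced E -> equal_valz q r E -> ~~ odd r ->
  normker q d -> locsol q E d -> oddval q (t2 d) = false /\ oddval q (t3 d) = false.
Proof.
move=> q_pr q_odd Ebal Er /negbTE r_even dN.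
case/(locsol_equal_valz q_pr q_odd Ebal Er dN) => [|[_ -> ->] //].
have /and3P [E1 E2 E3] := balanced_nonzero3 Ebal.
have even e : valz q e == r -> oddval q e = false by rewrite /oddval => /eqP ->.
have /and3P [/even o1 /even o2 /even o3] := Er.
move=> /torsion_classP [t tE /sqclass3P [_ /sqclass_oddval -> /sqclass_oddval ->]].
move: tE; rewrite !inE => /or4P [] /eqP ->; rewrite /rot3 /torsion1 !tripleE.
all: by rewrite ?oddvalM ?oppr_eq0 ?oddvalN ?o1 ?o2 ?o3 ?(oddval_unit (primez_ndvd1 q_pr)).
Qed.

(** * Odd primes of good reduction *)

Section CharacterSums.
Variable q : nat.
Hypotheses (q_pr : prime q) (q_odd : odd q).
Implicit Types x y a b : 'F_q.

Definition legendre (x : 'F_q) : int := if x == 0 then 0 else (-1) ^+ nonsquare x.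

Lemma legendreM x y : legendre (x * y) = legendre x * legendre y.
Proof.
rewrite /legendre mulf_eq0; have [_|x0] := eqVneq x 0; first by rewrite mul0r.
have [_|y0] := eqVneq y 0; first by rewrite mulr0.
by rewrite nonsquareM // signr_addb.
Qed.

Lemma legendre1 : legendre 1 = 1.
Proof. by have := nonres1 q_pr q_odd; rewrite /legendre oner_eq0 /nonres mulr1z => ->. Qed.

Lemma legendre_sqr x : x != 0 -> legendre x * legendre x = 1.
Proof. by rewrite /legendre => /negbTE ->; rewrite -expr2 sqrr_sign. Qed.

Lemma legendre_geN1 x : -1 <= legendre x.
Proof. by rewrite /legendre; case: ifP => // _; case: (nonsquare x). Qed.

Lemma sum_legendre : \sum_(x : 'F_q) legendre x = 0.
Proof.
have [g g_ns] := nonsquare_ex q_pr q_odd.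
have g0 : g != 0 by apply: contraTneq g_ns => ->; rewrite nonsquare0.
have : \sum_(x : 'F_q) legendre x = - \sum_(x : 'F_q) legendre x; last by lia.
rewrite {1}(reindex_inj (mulfI g0)) -sumrN; apply: eq_bigr => x _.
by rewrite legendreM {1}/legendre (negbTE g0) g_ns mulN1r.
Qed.

Lemma sum_legendre_shift a : \sum_(x : 'F_q) legendre (x + a) = 0.
Proof. by rewrite -[RHS]sum_legendre [RHS](reindex_inj (addIr a)). Qed.

Lemma sum_legendre_mul a : a != 0 -> \sum_(x : 'F_q) legendre x * legendre (x + a) = -1.
Proof.
move=> a0; rewrite (bigD1 0) //= {1}/legendre eqxx mul0r add0r.
rewrite (eq_bigr (fun x => legendre (1 + a / x))) => [|x x0]; last first.
  have -> : x + a = x * (1 + a / x) by rewrite mulrDr mulr1 mulrCA divff // mulr1.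
  by rewrite legendreM mulrA legendre_sqr // mul1r.
have -> : \sum_(x | x != 0) legendre (1 + a / x) = \sum_(x | x != 1) legendre x.
  rewrite [RHS](reindex_onto (fun x => 1 + a / x) (fun y => a / (y - 1))) /=; last first.
    move=> y y1.
    by rewrite invfM invrK mulrA divff // mul1r addrC subrK.
  apply: eq_bigl => x; have [->|x0] := eqVneq x 0; first by rewrite invr0 mulr0 addr0 eqxx.
  rewrite [1 + _]addrC addrK invfM invrK mulrA divff // mul1r eqxx andbT.
  by rewrite -subr_eq0 addrK mulf_neq0 // invr_eq0.
have := sum_legendre; rewrite (bigD1 1) //= legendre1 => sum0.
by apply: (addrI 1); rewrite sum0 subrr.
Qed.

Lemma sum_legendre_mul_shift a b : a != b ->
  \sum_(x : 'F_q) legendre (x + a) * legendre (x + b) = -1.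
Proof.
move=> ab; rewrite -(@sum_legendre_mul (b - a)); last by rewrite subr_eq0 eq_sym.
rewrite [RHS](reindex_inj (addIr a)) /=; apply: eq_bigr => x _.
by rewrite -addrA [a + _]addrC subrK.
Qed.

(* After expansion the sum differs by 1 from a sum of the nonnegative terms
   [1 + legendre (x (x + a) (x + b))], so no estimate for the elliptic sum is needed. *)
Lemma legendre_pattern a b : a != 0 -> b != 0 -> a != b ->
  exists x, (1 + legendre x) * (1 - legendre (x + a)) * (1 - legendre (x + b)) != 0.
Proof.
move=> a0 b0 ab; apply: contrapT => none.
pose F x := (1 + legendre x) * (1 - legendre (x + a)) * (1 - legendre (x + b)).
have sumF0 : \sum_x F x = 0.
  by apply: big1 => x _; apply/eqP; apply: contrapT => /negP Fx; apply: none; exists x.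
have sumFE : \sum_x F x =
    \sum_x (1 + legendre x * legendre (x + a) * legendre (x + b)) + \sum_x legendre x
    - \sum_x legendre (x + a) - \sum_x legendre (x + b)
    - \sum_x legendre x * legendre (x + a) - \sum_x legendre x * legendre (x + b)
    + \sum_x legendre (x + a) * legendre (x + b).
  rewrite -!sumrN -!big_split /=; apply: eq_bigr => x _; rewrite /F.
  by move: (legendre x) (legendre (x + a)) (legendre (x + b)) => lx la lb; ring.
have cubic_ge0 : 0 <= \sum_x (1 + legendre x * legendre (x + a) * legendre (x + b)).
  by apply: sumr_ge0 => x _; rewrite -!legendreM -lerBlDl sub0r legendre_geN1.
move: sumFE; rewrite sumF0 sum_legendre !sum_legendre_shift !sum_legendre_mul //.
by rewrite sum_legendre_mul_shift //; lia.
Qed.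

Lemma legendre_int u : ~~ (q%:Z %| u)%Z -> legendre u%:~R = (-1) ^+ nonres q u.
Proof. by rewrite -intF_eq0 // /legendre => /negbTE ->. Qed.

Lemma sqclass_legendre (b : bool) u s : ~~ (q%:Z %| u)%Z ->
  1 + (-1) ^+ b * legendre u%:~R != 0 -> s = (false, b, false) -> sqclass q u = s.
Proof.
by move=> qu + ->; rewrite legendre_int // sqclass_unit //; case: b; case: (nonres q u).
Qed.

Definition good_reduction (E : triple) : bool :=
  [&& ~~ (q%:Z %| t1 E)%Z, ~~ (q%:Z %| t2 E)%Z & ~~ (q%:Z %| t3 E)%Z].

Lemma good_reduction_rot E : good_reduction E -> good_reduction (rot3 E).
Proof. by case/and3P=> *; apply/and3P. Qed.

Definition matches_units (X d : triple) : Prop :=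
  [/\ ~~ (q%:Z %| t1 X)%Z -> sqclass q (t1 X) = sqclass q (t1 d),
      ~~ (q%:Z %| t2 X)%Z -> sqclass q (t2 X) = sqclass q (t2 d)
    & ~~ (q%:Z %| t3 X)%Z -> sqclass q (t3 X) = sqclass q (t3 d)].

Lemma matches_units_rot X d : matches_units X d -> matches_units (rot3 X) (rot3 d).
Proof. by case. Qed.

Lemma matches_units_torsion_class E d X : balanced E -> good_reduction E -> normker q d ->
  on_curve E X 1 -> matches_units X d -> (q%:Z %| t1 X)%Z -> torsion_class q E d.
Proof.
rewrite /on_curve expr1n !mulr1 => Ebal /and3P [_ qE2 qE3] dN [_ EX1 EX2] [_ m2 m3] qX1.
have qnE2 : ~~ (q%:Z %| - t2 E)%Z by rewrite rpredN.
have {}EX2 : t2 X = t3 E + t1 X by rewrite addrC.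
have EX3 : t3 X = - t2 E + t1 X by rewrite EX1 addrC addrK.
have [qX2 qX3] : ~~ (q%:Z %| t2 X)%Z /\ ~~ (q%:Z %| t3 X)%Z.
  by rewrite EX2 EX3 !rpredDr.
apply: torsion_class1; rewrite ?balanced_nonzero3 // -?m2 -?m3 // ?EX2 ?EX3.
- by have [] := sqclassD_unit q_pr q_odd qE3 qX1.
- by have [] := sqclassD_unit q_pr q_odd qnE2 qX1.
Qed.

Lemma matches_units_locsol E d X : balanced E -> good_reduction E -> normker q d ->
  on_curve E X 1 -> matches_units X d -> locsol q E d.
Proof.
move=> Ebal Egood dN EX Xd.
have [E1 E2] := (balanced_rot Ebal, balanced_rot (balanced_rot Ebal)).
have [G1 G2] := (good_reduction_rot Egood, good_reduction_rot (good_reduction_rot Egood)).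
have [dN1 dN2] := (normker_rot dN, normker_rot (normker_rot dN)).
have [EX1 EX2] := (on_curve_rot EX, on_curve_rot (on_curve_rot EX)).
have [Xd1 Xd2] := (matches_units_rot Xd, matches_units_rot (matches_units_rot Xd)).
have [/(matches_units_torsion_class Ebal Egood dN EX Xd)|qX1] := boolP (q%:Z %| t1 X)%Z.
  exact: torsion_class_locsol.
have [/(matches_units_torsion_class E1 G1 dN1 EX1 Xd1)|qX2] := boolP (q%:Z %| t2 X)%Z.
  by move/torsion_class_rot; exact: torsion_class_locsol.
have [/(matches_units_torsion_class E2 G2 dN2 EX2 Xd2)|qX3] := boolP (q%:Z %| t3 X)%Z.
  by move/torsion_class_rot/torsion_class_rot; exact: torsion_class_locsol.
have [m1 m2 m3] := Xd; exists X, 1; split=> //.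
- by apply/and3P; rewrite !(ndvdz_neq0 (d := q)).
- by apply/sqclass3P; rewrite m1 ?m2 ?m3.
Qed.

Let locsol_good1 E d : balanced E -> good_reduction E -> normker q d ->
  sqclass q (t1 d) = (false, false, false) -> sqclass q (t2 d) = (false, true, false) ->
  sqclass q (t3 d) = (false, true, false) -> locsol q E d.
Proof.
move=> Ebal Egood dN d1 d2 d3; have /and3P [qE1 qE2 qE3] := Egood.
have [a0 b0 ab] : [/\ (t3 E)%:~R != 0 :> 'F_q, (- t2 E)%:~R != 0 :> 'F_q
    & (t3 E)%:~R != (- t2 E)%:~R :> 'F_q].
  by rewrite !intF_eq0 // intF_eq // -(rpredN _ (_ - _)) opprB -(balanced_t1 Ebal) rpredN.
have [x] := legendre_pattern a0 b0 ab.
rewrite -[x]intF_ord; move: (nat_of_ord x)%:Z => {}x.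
rewrite -!rmorphD /= !mulf_eq0 !negb_or => /andP [/andP [x1 x2] x3].
apply: (matches_units_locsol (X := (x, x + t3 E, x - t2 E))) => //.
- by rewrite /on_curve !tripleE (balanced_t1 Ebal); split; ring.
- rewrite /matches_units !tripleE; split=> qx.
  + by apply: (sqclass_legendre (b := false)); rewrite ?mul1r.
  + by apply: (sqclass_legendre (b := true)); rewrite ?mulN1r.
  + by apply: (sqclass_legendre (b := true)); rewrite ?mulN1r.
Qed.

Lemma locsol_good E d : balanced E -> good_reduction E -> normker q d ->
  oddval q (t2 d) = false -> oddval q (t3 d) = false -> locsol q E d.
Proof.
move=> Ebal Egood dN o2 o3.
have o1 : oddval q (t1 d) = false by rewrite (normker_oddval dN) o2 o3.
have := normker_t1 dN; rewrite !sqclass_odd // o1 o2 o3 => -[n1].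
case n2 : (unit_nonres q (t2 d)) n1; case n3 : (unit_nonres q (t3 d)) => n1.
- by apply: locsol_good1; rewrite ?sqclass_odd // ?o1 ?o2 ?o3 ?n1 ?n2 ?n3.
- rewrite -[E]rot3K -[d]rot3K; apply: locsol_rot.
  by apply: locsol_good1; rewrite ?sqclass_odd // ?o1 ?o2 ?o3 ?n1 ?n2 ?n3 //;
    [do 2 apply: balanced_rot | do 2 apply: good_reduction_rot | do 2 apply: normker_rot].
- rewrite -[E]rot3K -[d]rot3K; do 2 apply: locsol_rot.
  by apply: locsol_good1; rewrite ?sqclass_odd // ?o1 ?o2 ?o3 ?n1 ?n2 ?n3 //;
    [apply: balanced_rot | apply: good_reduction_rot | apply: normker_rot].
- by apply: locsol_trivial; rewrite // /sqclass3 !sqclass_odd // o1 o2 o3 n1 n2 n3.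
Qed.

End CharacterSums.

(** * Sign changes at odd primes dividing the second coefficient *)

(* If [m] is the least nonresidue then [m = 1 + (m - 1)] is a sum of two residues;
   multiply by [a / m]. *)
Lemma nonres_sum_residues q (a : int) : prime q -> odd q -> ~~ (q%:Z %| a)%Z ->
  nonres q (-1) -> nonres q a ->
  exists x : int, [/\ ~~ (q%:Z %| x)%Z, ~~ (q%:Z %| a - x)%Z, ~~ nonres q x & ~~ nonres q (a - x)].
Proof.
move=> q_pr q_odd qa n1 na.
have nonres_pred : nonres q q.-1%N.
  by rewrite (@nonres_eqmod q q_pr _ (-1)) // opprK -PoszD addn1 prednK ?prime_gt0.
have ex_nonres : exists m : nat, nonres q m by exists q.-1.
case: (ex_minnP ex_nonres) => m nm m_min.
have m_le := m_min _ nonres_pred.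
have m_gt1 : (1 < m)%N.
  case: m nm {m_min m_le} => [|[|//]]; last by rewrite nonres1.
  by rewrite /nonres mulr0z nonsquare0.
have q_ndvd k : (0 < k < q)%N -> ~~ (q%:Z %| k%:Z)%Z.
  by move=> /andP [k0 kq]; rewrite dvdzE gtnNdvd.
have qm : ~~ (q%:Z %| m%:Z)%Z by apply: q_ndvd; clear -m_gt1 m_le; lia.
have qm1 : ~~ (q%:Z %| m.-1%:Z)%Z by apply: q_ndvd; clear -m_gt1 m_le; lia.
have Em : m%:Z = m.-1%:Z + 1 by clear -m_gt1; lia.
have nm1 : ~~ nonres q m.-1%N.
  by apply/negP => /m_min; clear -m_gt1; lia.
have [i Ei] := modz_inv_ex q_pr qm.
have Eqm : (q%:Z %| a * i * m%:Z - a)%Z by rewrite -[X in _ - X]mulr1 -mulrA -mulrBr dvdz_mull.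
have qc : ~~ (q%:Z %| a * i)%Z.
  by apply: contra qa => qc; rewrite -(subKr (a * i * m%:Z) a) rpredB // dvdz_mulr.
have nc : nonres q (a * i) = false.
  by have := nonres_eqmod q_pr Eqm; rewrite nonresM // nm na; case: (nonres q (a * i)).
have Eac : (q%:Z %| (a - a * i * m.-1%:Z) - a * i)%Z.
  have -> : (a - a * i * m.-1%:Z) - a * i = - (a * i * m%:Z - a) by rewrite Em; ring.
  by rewrite rpredN.
exists (a * i * m.-1%:Z); split.
- by rewrite Euclid_dvdzM // negb_or qc.
- by apply: contra qc => qac; rewrite -(subKr (a - a * i * m.-1%:Z) (a * i)) rpredB.
- by rewrite nonresM // nc add0r.
- by rewrite (nonres_eqmod q_pr Eac) nc.
Qed.

Definition negate13 : triple := (-1, 1, -1).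

Section SignChange.
Variables (q : nat) (E : triple).
Hypotheses (q_pr : prime q) (q_odd : odd q) (Ebal : balanced E).
Hypotheses (qE2 : (q%:Z %| t2 E)%Z) (qE3 : ~~ (q%:Z %| t3 E)%Z).

Lemma normker_negate13 : normker q negate13.
Proof. by rewrite /normker /negate13 /nonzero3 !tripleE sqclass1 // addr0 addrr_bool3. Qed.

Lemma locsol_negate13 : locsol q E negate13.
Proof.
have dN := normker_negate13; have E3E1 := balanced_t1 Ebal.
have [n1|n1] := boolP (nonres q (-1)); last first.
  by apply: locsol_trivial; rewrite // /sqclass3 !tripleE sqclass1 // sqclass_residue //
    rpredN primez_ndvd1.
have qnE3 : ~~ (q%:Z %| - t3 E)%Z by rewrite rpredN.
have qnE2 : (q%:Z %| - t2 E)%Z by rewrite rpredN.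
have E30 := ndvdz_neq0 qE3.
have [n3|n3] := boolP (nonres q (t3 E)); last first.
  have sN3 : sqclass q (- t3 E) = sqclass q (-1).
    by rewrite sqclassN // (sqclass_residue q_odd qE3 n3) addr0.
  apply: torsion_class_locsol => //; apply: torsion_class_rot.
  apply: (torsion_class1 q_pr (balanced_nonzero3 (balanced_rot Ebal)) (normker_rot dN)).
    by rewrite !rot3E !tripleE -sN3 E3E1 addrC; have [_ ->] := sqclassD_unit q_pr q_odd qnE3 qnE2.
  by rewrite !rot3E !tripleE sN3.
have [x [qx qEx nx nEx]] := nonres_sum_residues q_pr q_odd qE3 n1 n3.
have qnx : ~~ (q%:Z %| - x)%Z by rewrite rpredN.
have [X30 X3] := sqclassD_unit q_pr q_odd qnx qnE2.
have Enx : sqclass q (- x) = sqclass q (-1).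
  by rewrite sqclassN ?(ndvdz_neq0 qx) // (sqclass_residue q_odd qx nx) addr0.
exists (- x, t3 E - x, - x - t2 E), 1; split.
- by apply/and3P; split; rewrite !tripleE // ?(ndvdz_neq0 qnx) // (ndvdz_neq0 qEx).
- by rewrite /on_curve !tripleE E3E1; split; ring.
- by apply/sqclass3P; rewrite !tripleE X3 Enx sqclass1 // (sqclass_residue q_odd qEx nEx).
Qed.

(* [(X_1, X_2, X_3) -> (- X_3, E_3 t ^ 2 - X_3, - X_1)] is an involution of the solutions; it
   does not change the class of [X_2] when [X_1] is small compared to [t ^ 2]. *)
Lemma locsol_node_cases d : normker q d -> locsol q E d ->
  (sqclass q (t2 d) = 0 /\ oddval q (t1 d) = false) \/
  (sqclass q (t2 d) = sqclass q (t3 E) /\ locsol q E (- t3 d, t2 d, - t1 d)).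
Proof.
move=> dN [X [t [X0 EX Xd]]]; have XN := normker_sqclass3 X0 Xd dN.
have [s1 s2 s3] := iffLR (sqclass3P q X d) Xd; rewrite -s2 -(sqclass_oddval s1).
have [tE|t0] := eqVneq t 0.
  rewrite tE in EX; have XE0 := on_curve0_sqclass3 EX XN.
  by left; split; [exact: (congr1 (fun s => s.1.2) XE0) | exact: (congr1 (fun s => s.1.1.1.1) XE0)].
have [EX3 EX1 EX2] := EX; have /and3P [_ E2 E3] := balanced_nonzero3 Ebal.
have /and3P [X1 X2 X3] := X0; have /and3P [d1 d2 d3] := normker_nonzero3 dN.
pose s := valz q (t ^+ 2).
have s_even : odd s = false by rewrite /s valz_sqr // odd_double.
have E3t0 : t3 E * t ^+ 2 != 0 by rewrite mulf_neq0 ?expf_neq0.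
have vE3t : valz q (t3 E * t ^+ 2) = s by rewrite valzM ?expf_neq0 // (valz_unit qE3).
have dvdE2t : (q%:Z ^+ s.+1 %| t2 E * t ^+ 2)%Z.
  by rewrite [q%:Z ^+ _]exprS dvdz_mul // -valz_ge ?expf_neq0.
have {}EX3 : t3 X = t1 X - t2 E * t ^+ 2 by rewrite EX1 addrK.
have [X1_small|X1_large] := leqP (valz q (t1 X)) s.
  have sX3 : sqclass q (t3 X) = sqclass q (t1 X).
    rewrite EX3; have [|//] := sqclassD_odd q_pr q_odd X1 (b := - (t2 E * t ^+ 2)).
    by rewrite rpredN; apply: dvdz_expW dvdE2t.
  have sX2 : sqclass q (t2 X) = 0 by rewrite (normker_t2 XN) sX3 addrr_bool3.
  left; split=> //; move: X1_small; rewrite leq_eqVlt => /orP [/eqP vX1|vX1].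
    by rewrite /oddval vX1.
  suff : sqclass q (t2 X) = sqclass q (t1 X) by rewrite sX2 => /(congr1 (fun s => s.1.1)).
  rewrite EX2; have [|//] := sqclassD_odd q_pr q_odd X1 (b := t3 E * t ^+ 2).
  by rewrite -valz_ge ?vE3t.
have near_E3 b : (q%:Z ^+ s.+1 %| b)%Z ->
    t3 E * t ^+ 2 + b != 0 /\ sqclass q (t3 E * t ^+ 2 + b) = sqclass q (t3 E).
  rewrite -vE3t => qb; have [? _ ->] := sqclassD_odd q_pr q_odd E3t0 qb.
  by rewrite sqclassMsqr.
have dvdX1 : (q%:Z ^+ s.+1 %| t1 X)%Z by rewrite -valz_ge.
have dvdX3 : (q%:Z ^+ s.+1 %| - t3 X)%Z by rewrite rpredN EX3 rpredB.
have sX2 : sqclass q (t2 X) = sqclass q (t3 E) by rewrite EX2 addrC; have [] := near_E3 _ dvdX1.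
have [Y20 sY2] := near_E3 _ dvdX3.
right; split=> //; exists (- t3 X, t3 E * t ^+ 2 - t3 X, - t1 X), t; split.
- by apply/and3P; split; rewrite !tripleE ?oppr_eq0.
- by rewrite /on_curve !tripleE EX3 (balanced_t1 Ebal); split; ring.
- apply/sqclass3P; rewrite !tripleE sY2 -s2 sX2.
  by split; rewrite // sqclassN ?(sqclassN q_pr d1) ?(sqclassN q_pr d3) // ?s1 ?s3.
Qed.

Lemma locsol_negate13_unit d : nonres q (-1) -> normker q d ->
  sqclass q (t2 d) = 0 -> oddval q (t1 d) = false -> locsol q E (mul3 negate13 d).
Proof.
move=> n1 dN d2 o1.
have d13 : sqclass q (t1 d) = sqclass q (t3 d) by rewrite (normker_t1 dN) d2 add0r.
have E1 : sqclass q (t1 d) = (false, unit_nonres q (t1 d), false) by rewrite sqclass_odd // o1.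
have d0 := normker_nonzero3 dN.
case: (unit_nonres q (t1 d)) E1 => E1.
  by apply: locsol_trivial; rewrite // sqclass3_mul // /sqclass3 !tripleE -d13 d2 E1 sqclass1 //
    sqclassN1 // n1.
apply: locsol_sqclass3 locsol_negate13; rewrite sqclass3_mul //.
by rewrite [sqclass3 q d](_ : _ = 0) ?addr0 // /sqclass3 -d13 d2 E1.
Qed.

Lemma locsol_sign_change d : normker q d -> locsol q E d -> locsol q E (mul3 negate13 d).
Proof.
move=> dN dL; have d0 := normker_nonzero3 dN.
have [n1|n1] := boolP (nonres q (-1)); last first.
  apply: locsol_sqclass3 dL; rewrite sqclass3_mul //.
  by rewrite [sqclass3 q negate13](_ : _ = 0) ?add0r // /sqclass3 !tripleE sqclass1 //
    sqclass_residue // rpredN primez_ndvd1.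
have [[d2 o1]|[d2 swapL]] := locsol_node_cases dN dL; first exact: locsol_negate13_unit.
have [n3|n3] := boolP (nonres q (t3 E)); last first.
  apply: locsol_sqclass3 swapL; apply/sqclass3P; rewrite !mul3E !tripleE mul1r !mulN1r.
  have d13 : sqclass q (t1 d) = sqclass q (t3 d).
    by rewrite (normker_t1 dN) d2 (sqclass_residue q_odd qE3 n3) add0r.
  have /and3P [d1 _ d3] := d0.
  by rewrite (sqclassN q_pr d1) (sqclassN q_pr d3) d13.
have TN := normker_torsion1 q_pr (balanced_nonzero3 Ebal); have T0 := normker_nonzero3 TN.
have TdN := normker_mul q_pr TN dN.
have Td2 : sqclass q (t2 (mul3 (torsion1 E) d)) = 0.
  by have [/and3P [_ d20 _] /and3P [_ T20 _]] := (d0, T0); rewrite mul3E sqclassM // d2 addrr_bool3.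
have [[_ o1]|[Td2E _]] := locsol_node_cases TdN (locsol_translate1 q_pr Ebal dN dL); last first.
  by move: Td2E; rewrite Td2 sqclass_unit // n3.
have NTdN := normker_mul q_pr normker_negate13 TdN.
have := locsol_translate1 q_pr Ebal NTdN (locsol_negate13_unit n1 TdN Td2 o1).
apply: locsol_sqclass3; rewrite !sqclass3_mul ?nonzero3_mul //.
by rewrite addrCA (addrA (sqclass3 q (torsion1 E))) sqclass3_addrr add0r.
Qed.

End SignChange.

(** * The prime 2 *)

Lemma two_exact_valz e : two_exact e -> valz 2 e = 1%N.
Proof.
move=> [e2 e4]; have e0 : e != 0 by apply: contraNneq e4 => ->; rewrite dvdz0.
have v_lt2 : (valz 2 e < 2)%N by apply: (valz_lt (isT : prime 2)).
have v_gt0 : (0 < valz 2 e)%N by rewrite (valz_gt0 (isT : prime 2)).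
by case: (valz 2 e) v_lt2 v_gt0 => [|[]].
Qed.

Lemma two_exact_oddval e : two_exact e -> oddval 2 e = true.
Proof. by move=> /two_exact_valz; rewrite /oddval => ->. Qed.

Lemma two_exactE e : two_exact e -> e = 2 * unit_part 2 e.
Proof. by move=> /two_exact_valz ve; rewrite {1}(unit_partE 2 e) ve. Qed.

Lemma valz_lt_sub q (x y : int) : prime q -> x != 0 -> y != 0 -> ~~ odd (valz q x) ->
  ~~ odd (valz q y) -> odd (valz q (x - y)) -> (valz q x < valz q (x - y))%N.
Proof.
move=> q_pr x0 y0 x_even y_even xy_odd.
have ny0 : - y != 0 by rewrite oppr_eq0.
have xy0 : x - y != 0 by apply: contraTneq xy_odd => ->; rewrite /valz logn0.
case: (ltngtP (valz q x) (valz q y)) => [lt_xy|lt_yx|eq_xy].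
- by move: xy_odd; rewrite valzD_lt ?valzN // (negbTE x_even).
- by move: xy_odd; rewrite addrC valzD_lt ?valzN // (negbTE y_even).
- rewrite ltn_neqAle valz_ge // rpredB -?valz_ge ?eq_xy // andbT.
  by apply: contraNneq y_even => ->.
Qed.

Lemma normker_eps2 d : normker 2 d -> eps2 (t3 d) = eps2 (t1 d) + eps2 (t2 d).
Proof. by move=> /normker_t3 []. Qed.

Lemma normker_omega2 d : normker 2 d -> omega2 (t1 d) = omega2 (t2 d) + omega2 (t3 d).
Proof. by move=> /normker_t1 []. Qed.

Lemma locsol_two_eps2 E d : balanced E -> two_exact (t2 E) -> (4 %| t3 E)%Z -> normker 2 d ->
  oddval 2 (t2 d) = false -> oddval 2 (t3 d) = false -> locsol 2 E d -> eps2 (t3 d) = false.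
Proof.
move=> Ebal E2two E3four dN o2 o3 [X [t [X0 EX Xd]]]; have XN := normker_sqclass3 X0 Xd dN.
have o1 : oddval 2 (t1 d) = false by rewrite (normker_oddval dN) o2 o3.
have [s1 s2 s3] := iffLR (sqclass3P 2 X d) Xd.
have -> : eps2 (t3 d) = eps2 (t3 X) by case: s3.
have [tE|t0] := eqVneq t 0.
  by rewrite tE in EX; have := on_curve0_sqclass3 EX XN; case.
have [/and3P [X1 X2 X3] /and3P [_ E2 E3]] := (X0, balanced_nonzero3 Ebal); have [_ EX1 EX2] := EX.
have t20 : t ^+ 2 != 0 by rewrite expf_neq0.
have vE2t : valz 2 (t1 X - t3 X) = (valz 2 (t ^+ 2)).+1.
  by rewrite EX1 addrC addKr valzM // (two_exact_valz E2two).
have X1_small : (valz 2 (t1 X) <= valz 2 (t ^+ 2))%N.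
  rewrite -ltnS -vE2t valz_lt_sub // -/(oddval 2 _) ?(sqclass_oddval s1) ?(sqclass_oddval s3)
    ?o1 ?o3 //.
  by rewrite /oddval vE2t valz_sqr //= odd_double.
have qE3t : (2%N%:Z ^+ (valz 2 (t1 X) + 2) %| t3 E * t ^+ 2)%Z.
  by rewrite exprD mulrC dvdz_mul // -valz_ge.
have [_ _] := unit_partD (j := 2) (isT : prime 2) X1 isT qE3t; rewrite -EX2 => E12.
have E12e : eps2 (t2 X) = eps2 (t1 X).
  by rewrite /eps2; congr (_ == _); apply/eqP; rewrite eqz_mod_dvd.
by rewrite (normker_eps2 XN) E12e; case: (eps2 (t1 X)).
Qed.

Lemma hilbert_odd_sqclass q a b a' b' : odd q ->
  sqclass q a = sqclass q a' -> sqclass q b = sqclass q b' ->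
  hilbert_odd q a b = hilbert_odd q a' b'.
Proof. by move=> q_odd; rewrite !sqclass_odd // /hilbert_odd => -[-> ->] [-> ->]. Qed.

(* The equation [X_3 + E_2 t ^ 2 = X_1] defines a conic covered by [D]. *)
Lemma locsol_hilbert_odd q E d : prime q -> odd q -> balanced E -> normker q d -> locsol q E d ->
  hilbert_odd q (t2 d) (t2 E * t1 d) = 0.
Proof.
move=> q_pr q_odd Ebal dN [X [t [X0 EX Xd]]]; have XN := normker_sqclass3 X0 Xd dN.
have [s1 s2 s3] := iffLR (sqclass3P q X d) Xd.
have [/and3P [X1 X2 X3] /and3P [d1 _ _]] := (X0, normker_nonzero3 dN).
have /and3P [_ E2 _] := balanced_nonzero3 Ebal.
have [tE|t0] := eqVneq t 0.
  rewrite tE in EX; have XE := on_curve0_sqclass3 EX XN.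
  have d2 : sqclass q (t2 d) = 0 by rewrite -s2; exact: (congr1 (fun s => s.1.2) XE).
  by move: d2; rewrite sqclass_odd // /hilbert_odd => -[-> ->]; rewrite !mul0r mulr0.
have E2t0 : t2 E * t ^+ 2 != 0 by rewrite mulf_neq0 ?expf_neq0.
have [_ EX1 _] := EX; rewrite -(hilbert_odd_conic q_pr q_odd X3 E2t0 X1 (esym EX1)).
apply: hilbert_odd_sqclass => //; first by rewrite sqclassM // -(normker_t2 XN).
by rewrite (sqclassM q_pr E2t0 X1) sqclassMsqr // s1 -sqclassM.
Qed.

Lemma hilbert_two_eq0 (a b : int) : a != 0 -> b != 0 ->
  (forall q, prime q -> odd q -> hilbert_odd q a b = 0) -> hilbert_real a b = 0 ->
  hilbert_two a b = 0.
Proof.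
move=> a0 b0 odd0 real0; have := @hilbert_product_formula (`|a| + `|b|).+1 a b a0 b0.
rewrite !ltnS leq_addr leq_addl /hilbert_sum real0 addr0 => /(_ isT isT).
by rewrite big1 ?add0r // => q /andP [q_pr q_odd]; exact: odd0.
Qed.

Definition two_point (E : triple) : triple := (1 + t2 E - t3 E, 1 + t2 E, 1 - t3 E).

Section TwoPoint.
Variable E : triple.
Hypotheses (Ebal : balanced E) (E1two : two_exact (t1 E)) (E2two : two_exact (t2 E)).
Hypothesis E3four : (4 %| t3 E)%Z.

Lemma on_curve_two_point : on_curve E (two_point E) 1.
Proof. by rewrite /on_curve !tripleE (balanced_t1 Ebal); split; ring. Qed.

Let odd_t2 : ~~ (2 %| 1 + t2 E)%Z.
Proof. by have [E2 _] := E2two; rewrite rpredDr. Qed.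

Let odd_t3 : ~~ (2 %| 1 - t3 E)%Z.
Proof. by rewrite rpredBr // (dvdz_trans _ E3four). Qed.

Lemma normker_two_point : normker 2 (two_point E).
Proof.
have [X2 X3] := (ndvdz_neq0 odd_t2, ndvdz_neq0 odd_t3).
have odd23 : ~~ (2 %| (1 + t2 E) * (1 - t3 E))%Z by rewrite (@Euclid_dvdzM 2) // negb_or odd_t2.
have dvd8 : (2%N%:Z ^+ (valz 2 ((1 + t2 E) * (1 - t3 E)) + 3) %| t2 E * t3 E)%Z.
  by rewrite valz_unit // exprS dvdz_mul //; have [] := E2two.
have EX1 : (1 + t2 E) * (1 - t3 E) + t2 E * t3 E = 1 + t2 E - t3 E by ring.
have [X1 _ sX1] := sqclassD (isT : prime 2) (mulf_neq0 X2 X3) dvd8.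
rewrite EX1 in X1 sX1; rewrite sqclassM // in sX1.
rewrite /normker /nonzero3 !tripleE X1 X2 X3 /= sX1.
by rewrite -addrA addrr_bool3.
Qed.

Lemma sqclass2_two_point2 : sqclass 2 (t2 (two_point E)) = (false, true, ~~ eps2 (t2 E)).
Proof.
rewrite sqclass2_odd // /eps2.
move: (two_exactE E2two) (unit_part_ndvd (isT : prime 2) (ndvdz_neq0 (proj2 E2two))).
rewrite !tripleE; move: (t2 E) (unit_part 2 (t2 E)); clear => e u Ee u_odd.
by rewrite !inE; congr (_, _, _); lia.
Qed.

Lemma sqclass2_two_point3 :
  sqclass 2 (t3 (two_point E)) = (false, false, eps2 (t1 E) (+) ~~ eps2 (t2 E)).
Proof.
have [u1_odd u2_odd] := (unit_part_ndvd (isT : prime 2) (ndvdz_neq0 (proj2 E1two)),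
  unit_part_ndvd (isT : prime 2) (ndvdz_neq0 (proj2 E2two))).
have := balanced_t1 Ebal; have := (two_exactE E1two, two_exactE E2two).
rewrite sqclass2_odd // /eps2 !tripleE !inE; move: E3four u1_odd u2_odd.
move: (t1 E) (t2 E) (t3 E) (unit_part 2 (t1 E)) (unit_part 2 (t2 E)); clear.
move=> e1 e2 e3 u v e3_four u_odd v_odd [Eu Ev] E0; congr (_, _, _); lia.
Qed.

End TwoPoint.

(* The vanishing of the two symbols leaves only two classes modulo 8, given by the trivial
   solution and by [t = 1], [X = (1 + E_2 - E_3, 1 + E_2, 1 - E_3)]. *)
Lemma locsol_two_of_symbols E d : balanced E -> two_exact (t1 E) -> two_exact (t2 E) ->
  (4 %| t3 E)%Z -> normker 2 d -> oddval 2 (t2 d) = false -> oddval 2 (t3 d) = false ->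
  eps2 (t3 d) = false -> hilbert_two (t2 d) (t2 E * t1 d) = 0 ->
  hilbert_two (t1 d) (t1 E * t3 d) = 0 -> locsol 2 E d.
Proof.
move=> Ebal E1two E2two E3four dN o2 o3 e3.
have [/and3P [E1 E2 _] /and3P [d1 d2 d3]] := (balanced_nonzero3 Ebal, normker_nonzero3 dN).
have o1 : oddval 2 (t1 d) = false by rewrite (normker_oddval dN) o2 o3.
have e12 : eps2 (t1 d) = eps2 (t2 d).
  by have := normker_eps2 dN; rewrite e3; case: (eps2 (t1 d)); case: (eps2 (t2 d)).
rewrite /hilbert_two !(oddvalM, eps2M, omega2M) // o1 o2 o3 e12 e3 !two_exact_oddval //=.
rewrite (normker_omega2 dN) => symbol2 symbol1.
case e2 : (eps2 (t2 d)) symbol1 symbol2 => symbol1 symbol2; last first.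
  have w2 : omega2 (t2 d) = false by move: symbol2; case: (omega2 (t2 d)).
  have w3 : omega2 (t3 d) = false by move: symbol1; rewrite w2; case: (omega2 (t3 d)).
  apply: locsol_trivial; rewrite // [sqclass3 2 d](_ : _ = 0) //.
  by rewrite /sqclass3 /sqclass /= o1 o2 o3 e12 e2 e3 (normker_omega2 dN) w2 w3.
have w2 : omega2 (t2 d) = ~~ eps2 (t2 E).
  by move: symbol2; case: (eps2 (t2 E)); case: (omega2 (t2 d)).
have w3 : omega2 (t3 d) = eps2 (t1 E) (+) ~~ eps2 (t2 E).
  by move: symbol1; rewrite w2; case: (eps2 (t1 E)); case: (eps2 (t2 E)); case: (omega2 (t3 d)).
have PN := normker_two_point E2two E3four; exists (two_point E), 1; split.
- exact: normker_nonzero3 PN.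
- exact: on_curve_two_point.
- have s2 : sqclass 2 (t2 (two_point E)) = sqclass 2 (t2 d).
    by rewrite sqclass2_two_point2 // /sqclass /= o2 e2 w2.
  have s3 : sqclass 2 (t3 (two_point E)) = sqclass 2 (t3 d).
    by rewrite sqclass2_two_point3 // /sqclass /= o3 e3 w3.
  by apply/sqclass3P; split; rewrite // (normker_t1 PN) (normker_t1 dN) s2 s3.
Qed.

Lemma locsol_two E d : balanced E -> t1 E < 0 -> two_exact (t1 E) -> two_exact (t2 E) ->
  (4 %| t3 E)%Z -> (forall q, prime q -> normker q d) -> 0 < t2 d -> 0 < t1 d * t3 d ->
  oddval 2 (t2 d) = false -> oddval 2 (t3 d) = false -> eps2 (t3 d) = false ->
  (forall q, prime q -> odd q -> locsol q E d) -> locsol 2 E d.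
Proof.
move=> Ebal E1_lt0 E1two E2two E3four dN d2_gt0 d13_gt0 o2 o3 e3 dL.
have [/and3P [E1 E2 _] /and3P [d1 d2 d3]] := (balanced_nonzero3 Ebal, normker_nonzero3 (dN 2 isT)).
apply: locsol_two_of_symbols => //; first exact: dN.
- apply: hilbert_two_eq0 => [||q q_pr q_odd|]; rewrite ?mulf_neq0 //.
    by apply: locsol_hilbert_odd; [| | |exact: dN|exact: dL].
  by rewrite /hilbert_real ltNge ltW ?mul0r.
- apply: hilbert_two_eq0 => [||q q_pr q_odd|]; rewrite ?mulf_neq0 //.
    have dL2 := locsol_rot (locsol_rot (dL q q_pr q_odd)).
    apply: (locsol_hilbert_odd q_pr q_odd _ _ dL2); first by do 2 apply: balanced_rot.
    by do 2 apply: normker_rot; exact: dN.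
  rewrite /hilbert_real; case: (ltrP (t1 d) 0) => [d1_lt0|_]; last by rewrite mul0r.
  have d3_lt0 : t3 d < 0 by move: d13_gt0; rewrite nmulr_rgt0.
  by rewrite ltNge mulr_le0 // ltW.
Qed.

(** * The real place *)

Lemma sum3_sqr_eq0 (R : realFieldType) (a b c x y z : R) : 0 < a -> 0 < b -> 0 < c ->
  a * x ^+ 2 + b * y ^+ 2 + c * z ^+ 2 = 0 -> [/\ x = 0, y = 0 & z = 0].
Proof.
move=> a_gt0 b_gt0 c_gt0 /eqP.
have ge0 (e u : R) : 0 < e -> 0 <= e * u ^+ 2 by move=> e_gt0; rewrite mulr_ge0 ?sqr_ge0 ?ltW.
rewrite !paddr_eq0 ?addr_ge0 ?ge0 // !mulf_eq0.
rewrite (gt_eqF a_gt0) (gt_eqF b_gt0) (gt_eqF c_gt0) /= !orbb.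
by move=> /andP [/andP [/eqP -> /eqP ->] /eqP ->].
Qed.

Section RealPlace.
Variables (R : rcfType) (E d : triple).
Hypotheses (Ebal : balanced E) (E1_lt0 : t1 E < 0) (E3_gt0 : 0 < t3 E).
Hypotheses (d0 : nonzero3 d) (d_gt0 : 0 < t1 d * t2 d * t3 d).

Definition quadrics_point (x : 'I_4 -> R) : Prop :=
  (exists i, x i != 0) /\ forall c, c \in quadrics E d -> diagq c x = 0.

Lemma quadrics_point_of_curve (t X1 X2 X3 : R) :
  X3 = X2 + (t1 E)%:~R * t ^+ 2 -> X1 = X3 + (t2 E)%:~R * t ^+ 2 ->
  X2 = X1 + (t3 E)%:~R * t ^+ 2 -> 0 <= X1 / (t1 d)%:~R -> 0 <= X2 / (t2 d)%:~R ->
  0 <= X3 / (t3 d)%:~R -> (t != 0) || (X1 != 0) -> exists x, quadrics_point x.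
Proof.
move=> EX3 EX1 EX2 X1_ge0 X2_ge0 X3_ge0 nontrivial; have /and3P [d1 d2 d3] := d0.
pose u (X : R) (c : int) := Num.sqrt (X / c%:~R).
have uE (X : R) c : c != 0 -> 0 <= X / c%:~R -> c%:~R * u X c ^+ 2 = X.
  by move=> c0 Xc; rewrite sqr_sqrtr // mulrC divfK // intr_eq0.
pose x (i : 'I_4) := tnth [tuple t; u X1 (t1 d); u X2 (t2 d); u X3 (t3 d)] i.
exists x; split; last first.
  apply/(quadricsP (fun a => a = 0)); rewrite /x !(tnth_nth 0) /= !uE //.
  by split; lra.
case/orP: nontrivial => [t0|X10]; first by exists 0; rewrite /x (tnth_nth 0).
exists 1; rewrite /x (tnth_nth 0) /=; apply: contraNneq X10 => u0.
by rewrite -(uE X1 (t1 d)) // u0 expr0n mulr0.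
Qed.

Lemma quadrics_zero_unique (x : 'I_4 -> R) : t2 d < 0 ->
  (forall c, c \in quadrics E d -> diagq c x = 0) -> forall i, x i = 0.
Proof.
move=> d2_lt0 /(quadricsP (fun a => a = 0)) [eq1 eq2 eq3]; have /and3P [d1 _ d3] := d0.
have E1R : 0 < - ((t1 E)%:~R : R) by rewrite oppr_gt0 ltrz0.
have E3R : 0 < ((t3 E)%:~R : R) by rewrite ltr0z.
have d2R : 0 < - ((t2 d)%:~R : R) by rewrite oppr_gt0 ltrz0.
have coef_neq0 (c : int) (y : R) : c != 0 -> c%:~R * y ^+ 2 = 0 -> y = 0.
  by move=> c0 /eqP; rewrite mulf_eq0 intr_eq0 (negbTE c0) sqrf_eq0 => /eqP.
suff [x0 x1 x2 x3] : [/\ x 0 = 0, x 1 = 0, x 2 = 0 & x 3 = 0].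
  by move=> i; case: (ord4P i) => ->.
have d13_lt0 : t1 d * t3 d < 0 by move: d_gt0; rewrite mulrAC nmulr_lgt0.
case: (ltrgt0P (t1 d)) d1 => // d1_sgn _.
  have d1R : 0 < ((t1 d)%:~R : R) by rewrite ltr0z.
  have [|x0 x1 x2] := @sum3_sqr_eq0 R _ _ _ (x 0) (x 1) (x 2) E3R d1R d2R; first by lra.
  split=> //; apply: (coef_neq0 (t3 d)) => //.
  by move: eq1; rewrite x0 x2 expr0n /= !mulr0; lra.
have d3R : 0 < ((t3 d)%:~R : R) by rewrite ltr0z; move: d13_lt0; rewrite nmulr_rlt0.
have [|x0 x2 x3] := @sum3_sqr_eq0 R _ _ _ (x 0) (x 2) (x 3) E1R d2R d3R; first by lra.
split=> //; apply: (coef_neq0 (t1 d)); first by rewrite lt_eqF.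
by move: eq3; rewrite x0 x2 expr0n /= !mulr0; lra.
Qed.

Lemma quadrics_point_ex : 0 < t2 d -> exists x, quadrics_point x.
Proof.
move=> d2_gt0; have /and3P [d1 _ _] := d0.
have d2R : 0 < ((t2 d)%:~R : R) by rewrite ltr0z.
have d13_gt0 : 0 < t1 d * t3 d by move: d_gt0; rewrite mulrAC pmulr_lgt0.
case: (ltrgt0P (t1 d)) d1 => // d1_sgn _.
  have d1R : 0 < ((t1 d)%:~R : R) by rewrite ltr0z.
  have d3R : 0 < ((t3 d)%:~R : R) by rewrite ltr0z; move: d13_gt0; rewrite pmulr_rgt0.
  apply: (@quadrics_point_of_curve 0 1 1 1); rewrite ?expr0n ?mulr0 ?addr0 ?oner_neq0 ?orbT //;
    by rewrite divr_ge0 // ltW.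
have E1R : 0 < - ((t1 E)%:~R : R) by rewrite oppr_gt0 ltrz0.
have E3R : 0 < ((t3 E)%:~R : R) by rewrite ltr0z.
have d1R : 0 < - ((t1 d)%:~R : R) by rewrite oppr_gt0 ltrz0.
have d3R : 0 < - ((t3 d)%:~R : R) by rewrite oppr_gt0 ltrz0; move: d13_gt0; rewrite nmulr_rgt0.
apply: (@quadrics_point_of_curve 1 (- (t3 E)%:~R) 0 (t1 E)%:~R);
  rewrite ?expr1n ?mulr1 ?oner_neq0 //.
- by rewrite add0r.
- by rewrite (balanced_t1 Ebal) rmorphB rmorphN /=; ring.
- by rewrite addNr.
- by rewrite -mulrNN -invrN opprK divr_ge0 // ltW.
- by rewrite mul0r.
- by rewrite -mulrNN -invrN divr_ge0 // ltW.
Qed.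

Lemma quadrics_pointP : (exists x, quadrics_point x) <-> 0 < t2 d.
Proof.
split=> [[x [[i xi] x_zero]]|]; last exact: quadrics_point_ex.
have /and3P [_ d2 _] := d0; case: (ltrgt0P (t2 d)) d2 => // d2_lt0 _.
by move: xi; rewrite quadrics_zero_unique ?eqxx.
Qed.

End RealPlace.

(** * Square-free representatives *)

Lemma sqfree_valz q (a : int) : prime q -> sqfree a -> (valz q a <= 1)%N.
Proof.
move=> q_pr [a0 a_sqf]; rewrite leqNgt valz_ge // -PoszX dvdzE.
by apply/negP => /a_sqf q1; rewrite q1 in q_pr.
Qed.

Lemma oddval_sqfree q (a : int) : prime q -> sqfree a -> oddval q a = (q%:Z %| a)%Z.
Proof.
move=> q_pr a_sqf; have [a0 _] := a_sqf; rewrite -valz_gt0 // /oddval.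
by case: (valz q a) (sqfree_valz q_pr a_sqf) => [|[]].
Qed.

Lemma sqfree1 : sqfree 1.
Proof. by split=> // d; rewrite dvdn1 -(exp1n 2) => /eqP /(@expIn 2 isT). Qed.

Lemma sqfree_ex (a : int) : a != 0 -> exists2 b, sqfree b & is_sq (a * b).
Proof.
have [m] := ubnP `|a|%N; elim: m a => // m IHm a am a0.
have [a_sqf|a_nsqf] := pselect (sqfree a); first by exists a => //; exists a.
have [d [d_sqr d1]] : exists d, (d ^ 2 %| `|a|)%N /\ d <> 1%N.
  apply: contrapT => none; apply: a_nsqf; split=> // d d_sqr.
  by apply: contrapT => d1; apply: none; exists d.
have /dvdzP [c Ec] : ((d ^ 2)%N%:Z %| a)%Z by rewrite dvdzE.
have c0 : c != 0 by apply: contraNneq a0 => c0; rewrite Ec c0 mul0r.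
have d_gt1 : (1 < d)%N by case: d d1 Ec {d_sqr} => [|[]] // _ Ec; move: a0; rewrite Ec mulr0.
have [|//|b b_sqf [e Ee]] := IHm c.
  rewrite ltnS in am; apply: leq_trans am.
  by rewrite Ec abszM /= ltn_Pmulr ?absz_gt0 // (ltn_exp2l 0 2).
exists b => //; exists (d%:Z * e).
by rewrite Ec PoszX mulrAC Ee; ring.
Qed.

Lemma is_sqM (a b : int) : is_sq a -> is_sq b -> is_sq (a * b).
Proof. by move=> [c ->] [d ->]; exists (c * d); ring. Qed.

Lemma is_sq_cancel (a b : int) : b != 0 -> is_sq b -> is_sq (a * b) -> is_sq a.
Proof.
move=> b0 [e Ee] [c Ec].
have : (e ^+ 2 %| c ^+ 2)%Z by rewrite !expr2 -Ec Ee dvdz_mull.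
rewrite dvdz_pexp2r // => /dvdzP [f Ef]; exists f.
by apply: (mulIf b0); rewrite Ec Ef Ee; ring.
Qed.

Lemma is_sq_gt0 (a : int) : a != 0 -> is_sq a -> 0 < a.
Proof. by move=> a0 [c Ec]; rewrite lt_neqAle eq_sym a0 Ec -expr2 sqr_ge0. Qed.

Lemma sqfree_absz_eq (a b : int) : sqfree a -> sqfree b ->
  (forall q, prime q -> oddval q a = oddval q b) -> `|a|%N = `|b|%N.
Proof.
move=> a_sqf b_sqf Eab; apply: eqn_from_log; rewrite ?absz_gt0; try by [case: a_sqf|case: b_sqf].
move=> q; have [q_pr|/negbTE q_npr] := boolP (prime q); last first.
  by rewrite /= [LHS]lognE [RHS]lognE q_npr.
move: (Eab q q_pr) (sqfree_valz q_pr a_sqf) (sqfree_valz q_pr b_sqf); rewrite /oddval /valz.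
by case: (logn q `|a|) => [|[]] //; case: (logn q `|b|) => [|[]].
Qed.

Lemma sqfree_eq (a b : int) : sqfree a -> sqfree b -> is_sq (a * b) -> a = b.
Proof.
move=> a_sqf b_sqf ab_sq; have [[a0 _] [b0 _]] := (a_sqf, b_sqf).
have Eab : `|a|%N = `|b|%N.
  by apply: sqfree_absz_eq => // q q_pr; apply/sqclass_oddval/is_sq_sqclass.
by have := is_sq_gt0 (mulf_neq0 a0 b0) ab_sq; move: Eab a0 b0; clear; nia.
Qed.

Lemma sqfree_dvd (a b : int) : sqfree b -> (a %| b)%Z -> sqfree a.
Proof.
move=> [b0 b_sqf] ab; split; first by apply: contraNneq b0 => a0; move: ab; rewrite a0 dvd0z.
by move=> d d_sqr; apply: b_sqf; apply: dvdn_trans d_sqr _; rewrite dvdzE in ab.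
Qed.

Lemma sqfree_dvd_of_primes (a : int) (n : nat) : (0 < n)%N -> sqfree a ->
  (forall q, prime q -> oddval q a -> (q %| n)%N) -> (a %| n%:Z)%Z.
Proof.
move=> n_gt0 a_sqf a_dvd; have [a0 _] := a_sqf; rewrite dvdzE.
apply/dvdn_partP; rewrite ?absz_gt0 // => q; rewrite mem_primes => /andP [q_pr _].
have := sqfree_valz q_pr a_sqf; have := a_dvd q q_pr; rewrite p_part /oddval /valz.
by case: (logn q `|a|) => [_ _|[/(_ isT) qn _|[]//]] //; rewrite ?expn0 ?expn1 ?dvd1n.
Qed.

(** * The Selmer group through local square classes *)

Definition twist (e1 e2 e3 m : int) : triple := (e1 * m, e2 * m, e3 * m).

Definition sqfree3 (d : triple) : Prop := [/\ sqfree (t1 d), sqfree (t2 d) & sqfree (t3 d)].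

Definition norm_square (d : triple) : Prop := is_sq (t1 d * t2 d * t3 d).

Lemma sqfree3_nonzero3 d : sqfree3 d -> nonzero3 d.
Proof. by move=> [[d1 _] [d2 _] [d3 _]]; apply/and3P. Qed.

Lemma sqfree3_ex d : nonzero3 d -> exists2 c, sqfree3 c & sqeq3 d c.
Proof.
move=> /and3P [d1 d2 d3]; have [c1 c1_sqf E1] := sqfree_ex d1.
have [[c2 c2_sqf E2] [c3 c3_sqf E3]] := (sqfree_ex d2, sqfree_ex d3).
by exists (c1, c2, c3).
Qed.

Lemma sqeq3_sqclass3 q d d' : prime q -> nonzero3 d -> nonzero3 d' -> sqeq3 d d' ->
  sqclass3 q d = sqclass3 q d'.
Proof.
move=> q_pr /and3P [d1 d2 d3] /and3P [d1' d2' d3'] [E1 [E2 E3]].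
by apply/sqclass3P; split; apply: is_sq_sqclass.
Qed.

Lemma norm_square_normker q d : prime q -> nonzero3 d -> norm_square d -> normker q d.
Proof.
move=> q_pr d0 d_sq; have /and3P [d1 d2 d3] := d0; rewrite /normker d0 -!sqclassM ?mulf_neq0 //=.
by apply/eqP; rewrite -(sqclass1 q_pr); apply: is_sq_sqclass; rewrite ?mulf_neq0 ?mulr1.
Qed.

Lemma norm_square_mul d d' : norm_square d -> norm_square d' -> norm_square (mul3 d d').
Proof. by move=> dN d'N; have := is_sqM dN d'N; congr is_sq; rewrite !mul3E; ring. Qed.

Lemma norm_square_sqeq3 d d' : nonzero3 d -> norm_square d -> sqeq3 d d' -> norm_square d'.
Proof.
move=> /and3P [d1 d2 d3] dN [E1 [E2 E3]].
apply: (is_sq_cancel (b := t1 d * t2 d * t3 d)) => //; first by rewrite !mulf_neq0.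
have := is_sqM (is_sqM E1 E2) E3; congr is_sq; ring.
Qed.

Lemma norm_square_gt0 d : nonzero3 d -> norm_square d -> 0 < t1 d * t2 d * t3 d.
Proof. by move=> /and3P [d1 d2 d3]; apply: is_sq_gt0; rewrite !mulf_neq0. Qed.

Lemma uniq_map_inj (T1 T2 : eqType) (f : T1 -> T2) (s : seq T1) :
  uniq [seq f x | x <- s] -> {in s &, injective f}.
Proof.
elim: s => //= x s IHs /andP [fx_notin fs_uniq] y z.
rewrite !inE => /predU1P [->|ys] /predU1P [->|zs] // Ef; last exact: IHs.
  by case/negP: fx_notin; rewrite Ef map_f.
by case/negP: fx_notin; rewrite -Ef map_f.
Qed.

Definition parity (q : nat) (d : triple) : bool * bool := (oddval q (t2 d), oddval q (t3 d)).

Lemma parity_eq0 q d : parity q d = 0 <-> oddval q (t2 d) = false /\ oddval q (t3 d) = false.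
Proof. by split=> [[-> ->] | [E2 E3]] //; rewrite /parity E2 E3. Qed.

Lemma parityM q d d' : nonzero3 d -> nonzero3 d' -> parity q (mul3 d d') = parity q d + parity q d'.
Proof. by move=> /and3P [_ d2 d3] /and3P [_ d2' d3']; rewrite /parity !mul3E !oddvalM. Qed.

Lemma sqeq3_parity q d d' : prime q -> nonzero3 d -> nonzero3 d' -> sqeq3 d d' ->
  parity q d = parity q d'.
Proof.
move=> q_pr d0 d'0 /(sqeq3_sqclass3 q_pr d0 d'0) /sqclass3P [_].
by rewrite /parity => /sqclass_oddval -> /sqclass_oddval ->.
Qed.

Section SelmerGroup.
Variables e1 e2 e3 : int.
Hypotheses (e_sum : e1 + e2 + e3 = 0) (e1_lt0 : e1 < 0) (e2_neq0 : e2 != 0) (e3_gt0 : 0 < e3).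
Hypotheses (e1_two : two_exact e1) (e2_two : two_exact e2).

Section Twist.
Variable m : int.
Hypothesis m_gt0 : 0 < m.

Lemma balanced_twist : balanced (twist e1 e2 e3 m).
Proof.
rewrite /balanced /nonzero3 !tripleE -!mulrDl e_sum mul0r eqxx andbT.
by rewrite !mulf_neq0 ?(lt_eqF e1_lt0) ?(gt_eqF e3_gt0) ?(gt_eqF m_gt0).
Qed.

Lemma Sel2P s : Sel2 e1 e2 e3 m s <->
  [/\ sqfree3 s, norm_square s, 0 < t2 s
    & forall q, prime q -> locsol q (twist e1 e2 e3 m) s].
Proof.
have real_iff : sqfree3 s -> norm_square s -> real_solvable (D_eqs e1 e2 e3 m s) <-> 0 < t2 s.
  move=> /sqfree3_nonzero3 s0 sN.
  apply: (quadrics_pointP _ balanced_twist) => //; last exact: norm_square_gt0.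
    by rewrite pmulr_llt0.
  by rewrite pmulr_lgt0.
split=> [[s1 [s2 [s3 [sN [sR sQ]]]]]|[s_sqf sN s2_gt0 sL]].
  have s_sqf : sqfree3 s by split.
  split=> // [|q q_pr]; first by apply/real_iff.
  have sNq := norm_square_normker q_pr (sqfree3_nonzero3 s_sqf) sN.
  exact: (Qp_solvable_locsol q_pr balanced_twist sNq (sQ q q_pr)).
have [s1 s2 s3] := s_sqf; do 4!split=> //; split=> [|q q_pr]; first by apply/real_iff.
exact: (locsol_Qp_solvable q_pr (sqfree3_nonzero3 s_sqf) (sL q q_pr)).
Qed.

Lemma Sel2_normker q s : prime q -> Sel2 e1 e2 e3 m s -> normker q s.
Proof. by move=> q_pr /Sel2P [/sqfree3_nonzero3 s0 sN _ _]; exact: norm_square_normker. Qed.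

Lemma tors_nonzero3 t : t \in tors e1 e2 e3 m -> nonzero3 t.
Proof.
have [e10 e30 m0] := And3 (ltr0_neq0 e1_lt0) (lt0r_neq0 e3_gt0) (lt0r_neq0 m_gt0).
by rewrite !inE => /or4P [] /eqP ->; rewrite /nonzero3 !tripleE ?mulf_neq0 ?oppr_eq0.
Qed.

Lemma tors_norm_square t : t \in tors e1 e2 e3 m -> norm_square t.
Proof.
rewrite /norm_square !inE => /or4P [] /eqP ->; rewrite !tripleE.
- by exists 1.
- by exists (e1 * e3 * m); ring.
- by exists (e2 * e3 * m); ring.
- by exists (e1 * e2 * m); ring.
Qed.

Lemma tors_t2_gt0 t : t \in tors e1 e2 e3 m -> 0 < t2 t.
Proof.
have ne1_gt0 : 0 < - e1 by rewrite oppr_gt0.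
by rewrite !inE => /or4P [] /eqP ->; rewrite !tripleE // mulr_gt0.
Qed.

Lemma tors_torsion q t : prime q -> t \in tors e1 e2 e3 m ->
  exists2 t', t' \in torsion (twist e1 e2 e3 m) & sqclass3 q t = sqclass3 q t'.
Proof.
move=> q_pr; have [e10 e30 m0] := And3 (ltr0_neq0 e1_lt0) (lt0r_neq0 e3_gt0) (lt0r_neq0 m_gt0).
have twistM a b : a != 0 -> b != 0 -> sqclass q (a * b) = sqclass q (a * m * (b * m)).
  by move=> a0 b0; rewrite mulrACA -expr2 sqclassMsqr ?mulf_neq0.
rewrite !inE => /or4P [] /eqP ->.
- by exists (1, 1, 1); rewrite ?inE ?eqxx.
- exists (rot3 (rot3 (torsion1 (rot3 (twist e1 e2 e3 m))))); first by rewrite !inE eqxx !orbT.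
  by apply/sqclass3P; rewrite (twistM (- e1) e3) ?oppr_eq0 //; split; congr (sqclass q _);
    rewrite !(rot3E, tripleE); ring.
- exists (torsion1 (twist e1 e2 e3 m)); first by rewrite !inE eqxx !orbT.
  by apply/sqclass3P; rewrite (twistM (- e2) e3) ?oppr_eq0 //; split; congr (sqclass q _);
    rewrite !tripleE; ring.
- exists (rot3 (torsion1 (rot3 (rot3 (twist e1 e2 e3 m))))); first by rewrite !inE eqxx !orbT.
  by apply/sqclass3P; rewrite (twistM (- e1) e2) ?oppr_eq0 //; split; congr (sqclass q _);
    rewrite !(rot3E, tripleE); ring.
Qed.

Lemma Sel2_translate s t : Sel2 e1 e2 e3 m s -> t \in tors e1 e2 e3 m ->
  exists2 r, Sel2 e1 e2 e3 m r & sqeq3 (mul3 s r) t.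
Proof.
move=> /Sel2P [s_sqf sN s2_gt0 sL] ht; have s0 := sqfree3_nonzero3 s_sqf.
have [t0 tN] := (tors_nonzero3 ht, tors_norm_square ht); have ts0 := nonzero3_mul t0 s0.
have [r r_sqf Er] := sqfree3_ex ts0; have r0 := sqfree3_nonzero3 r_sqf.
have [Er1 [Er2 Er3]] := Er; exists r; last first.
  by split; [|split]; [move: Er1|move: Er2|move: Er3]; congr is_sq; rewrite !mul3E; ring.
apply/Sel2P; split=> //.
- exact: norm_square_sqeq3 ts0 (norm_square_mul tN sN) Er.
- have /and3P [_ r2 _] := r0; have /and3P [_ ts2 _] := ts0.
  have := is_sq_gt0 (mulf_neq0 ts2 r2) Er2; rewrite pmulr_rgt0 // mul3E mulr_gt0 //.
  exact: tors_t2_gt0.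
- move=> q q_pr; have sNq := norm_square_normker q_pr s0 sN.
  have [t' t'E Ett'] := tors_torsion q_pr ht.
  have t'0 : nonzero3 t' by apply: torsion_nonzero3 t'E; exact: balanced_twist.
  apply: locsol_sqclass3 (locsol_translate q_pr balanced_twist sNq t'E (sL q q_pr)).
  by rewrite -(sqeq3_sqclass3 q_pr ts0 r0 Er) !sqclass3_mul // Ett'.
Qed.

End Twist.

Lemma Sel2_one m : 0 < m -> Sel2 e1 e2 e3 m (1, 1, 1).
Proof.
move=> m_gt0; apply/Sel2P => //; split=> // [||q q_pr].
- by split; exact: sqfree1.
- by exists 1.
- by apply: locsol_trivial; rewrite ?sqclass3_one.
Qed.

Lemma tors_parity2 m : 0 < m -> ~~ (2 %| m)%Z ->
  [seq parity 2 t | t <- tors e1 e2 e3 m] =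
  [:: (false, false); (~~ oddval 2 e3, true); (oddval 2 e3, true); (true, false)].
Proof.
move=> m_gt0 m_odd.
have [e10 e30 m0] := And3 (ltr0_neq0 e1_lt0) (lt0r_neq0 e3_gt0) (lt0r_neq0 m_gt0).
rewrite /tors /parity /= !tripleE !oddvalM ?oppr_eq0 // !oddvalN.
rewrite (two_exact_oddval e1_two) (two_exact_oddval e2_two).
by rewrite (oddval_unit (q := 2) m_odd) (oddval_unit (q := 2) (a := 1)) // addr0;
  case: (oddval 2 e3).
Qed.

Lemma tors_parity2_inj m : 0 < m -> ~~ (2 %| m)%Z -> {in tors e1 e2 e3 m &, injective (parity 2)}.
Proof.
by move=> m_gt0 m_odd; apply: uniq_map_inj; rewrite tors_parity2 //; case: (oddval 2 e3).
Qed.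

Lemma tors_parity2_ex m b : 0 < m -> ~~ (2 %| m)%Z ->
  exists2 t, t \in tors e1 e2 e3 m & parity 2 t = b.
Proof.
move=> m_gt0 m_odd; have /mapP [t ht ->] : b \in [seq parity 2 t | t <- tors e1 e2 e3 m].
  by rewrite tors_parity2 //; case: b => -[] []; case: (oddval 2 e3).
by exists t.
Qed.

Lemma Sel2_nonzero3 m s : Sel2 e1 e2 e3 m s -> nonzero3 s.
Proof. by move=> [[s1 _] [[s2 _] [[s3 _] _]]]; apply/and3P. Qed.

(* The torsion classes realise all parities, so when there are only four classes the parity
   determines the class. *)
Lemma Sel2_parity2_inj s r : Sel2_iso_Z2sq e1 e2 e3 1 ->
  Sel2 e1 e2 e3 1 s -> Sel2 e1 e2 e3 1 r -> parity 2 s = parity 2 r -> s = r.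
Proof.
move=> [f [_ [f_inj _]]] Ss Sr Esr; have one_gt0 : 0 < 1 :> int by [].
have S1 := Sel2_one one_gt0.
have par_ex b : exists u, Sel2 e1 e2 e3 1 u /\ parity 2 u = b.
  have [t ht Et] := tors_parity2_ex b one_gt0 isT.
  have [u Su Eu] := Sel2_translate one_gt0 S1 ht; exists u; split=> //.
  rewrite -Et -(sqeq3_parity (isT : prime 2) _ (tors_nonzero3 one_gt0 ht) Eu).
    by rewrite parityM ?(Sel2_nonzero3 Su) // [parity 2 (1, 1, 1)](_ : _ = 0) ?add0r.
  by rewrite nonzero3_mul ?(Sel2_nonzero3 Su).
have [g gP] := choice par_ex.
have fg_inj : injective (fun b => f (g b)).
  move=> b c /f_inj Ebc; have [[Sb <-] [Sc <-]] := (gP b, gP c).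
  by rewrite (Ebc Sb Sc).
have fg_surj v : exists b, v = f (g b).
  have card_le : (#|{: 'rV['F_2]_2}| <= #|{: bool * bool}|)%N.
    by rewrite card_mx card_Fp // card_prod card_bool.
  by have /codomP [b ->] := inj_card_onto fg_inj card_le v; exists b.
have SgP u : Sel2 e1 e2 e3 1 u -> u = g (parity 2 u).
  move=> Su; have [b Eb] := fg_surj (f u); have [Sb Pb] := gP b.
  by have := f_inj _ _ Su Sb Eb => ->; rewrite Pb.
by rewrite (SgP s Ss) (SgP r Sr) Esr.
Qed.

End SelmerGroup.

(** * Residue symbols and Hilbert symbols with values in F_2 *)

Definition F2_of_bool (b : bool) : 'F_2 := b%:R.

Lemma F2_of_bool_is_nmod_morphism : nmod_morphism F2_of_bool.
Proof. by split=> [|b c]; apply: val_inj => //; case: b; case: c. Qed.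

Lemma F2_of_bool_is_monoid_morphism : monoid_morphism F2_of_bool.
Proof. by split=> [|b c]; apply: val_inj => //; case: b; case: c. Qed.

HB.instance Definition _ :=
  GRing.isNmodMorphism.Build bool 'F_2 F2_of_bool F2_of_bool_is_nmod_morphism.
HB.instance Definition _ :=
  GRing.isMonoidMorphism.Build bool 'F_2 F2_of_bool F2_of_bool_is_monoid_morphism.

Lemma F2_of_bool_inj : injective F2_of_bool.
Proof. by case=> -[]. Qed.

Lemma F2_of_bool_eq0 b : F2_of_bool b = 0 <-> ~~ b.
Proof. by split=> [/(F2_of_bool_inj (x2 := false)) ->|/negbTE ->]. Qed.

Lemma F2_of_bool_neq0 (x : 'F_2) : F2_of_bool (x != 0) = x.
Proof. by case: x => [[|[|x]] ltx] //; apply: val_inj. Qed.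

Section ResidueSymbols.
Variable q : nat.
Hypotheses (q_pr : prime q) (q_odd : odd q).

Lemma nqrE (u : int) : ~~ (q%:Z %| u)%Z -> nqr u q = F2_of_bool (nonres q u).
Proof.
move=> qu; rewrite /nqr; case: existsP => [[x Ex]|none].
  by rewrite (nonres_sqr_eqmod (v := 1) (w := x%:Z) q_pr q_odd qu) ?primez_ndvd1 // expr1n mulr1.
case Eu : (nonres q u) => //; have [|y _ Ey] := nonres_sqrt q_pr q_odd qu; first by rewrite Eu.
have q0 := primez_neq0 q_pr; have y_ge0 := modz_ge0 y q0.
have lt_y : (`|(y %% q%:Z)%Z| < q)%N by rewrite -ltz_nat gez0_abs // ltz_mod.
case: none; exists (Ordinal lt_y); rewrite /= gez0_abs // -(subrK (y ^+ 2) (_ ^+ 2)) -addrA.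
by rewrite rpredD // subr_sqr dvdz_mulr // -eqz_mod_dvd modz_mod.
Qed.

Lemma nqr_eq0 (u : int) : ~~ (q%:Z %| u)%Z -> nqr u q = 0 -> ~~ nonres q u.
Proof. by move=> qu; rewrite nqrE // => /F2_of_bool_eq0. Qed.

Lemma nqr0_sqclass (u : int) : ~~ (q%:Z %| u)%Z -> nqr u q = 0 -> sqclass q u = 0.
Proof. by move=> qu /(nqr_eq0 qu); exact: sqclass_residue. Qed.

Lemma ord3P (i : 'I_3) : [\/ i = 0, i = 1 | i = 2].
Proof.
by case: i => [[|[|[|i]]] lti] //; [constructor 1|constructor 2|constructor 3]; apply: val_inj.
Qed.

Lemma diagq3 (a b c : int) (x : 'I_3 -> int) :
  diagq [tuple a; b; c] x = a * x 0 ^+ 2 + b * x 1 ^+ 2 + c * x 2 ^+ 2.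
Proof.
rewrite /diagq !big_ord_recl big_ord0 !(tnth_nth 0) /= addr0 !addrA !intz.
by congr (_ + _ + _); congr (_ * x _ ^+ 2); apply: val_inj.
Qed.

Definition conic_zero (K : nat) (a b x y z : int) : Prop :=
  ~~ [&& (q%:Z %| x)%Z, (q%:Z %| y)%Z & (q%:Z %| z)%Z] /\
  (q%:Z ^+ K %| a * x ^+ 2 + b * y ^+ 2 - z ^+ 2)%Z.

Lemma hilb_conicP (a b : int) (s : bool) :
  (forall x y z, conic_zero 2 a b x y z -> ~~ s) ->
  (~~ s -> forall K, exists x y z, conic_zero K a b x y z) -> hilb q a b = F2_of_bool s.
Proof.
move=> conic_s s_conic; rewrite /hilb; case: asboolP => [/(Qp_solvableP _ q_pr) sol|nsol].
  have [x [[i xi] /(_ _ (mem_head _ _))]] := sol 2; rewrite diagq3 mulN1r => Ex.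
  rewrite (negbTE (conic_s (x 0) (x 1) (x 2) _)) //; split=> //.
  by apply: contra xi => /and3P [? ? ?]; case: (ord3P i) => ->.
case: s conic_s s_conic => // _ s_conic; case: nsol; apply/(Qp_solvableP _ q_pr) => K.
have [x [y [z [prim_xyz Exyz]]]] := s_conic isT K.
exists (fun i => tnth [tuple x; y; z] i); split=> [|c]; last first.
  by rewrite inE => /eqP ->; rewrite diagq3 !(tnth_nth 0) /= mulN1r.
apply: contrapT => imprim; case/negP: prim_xyz; apply/and3P.
have dvd i : (q%:Z %| tnth [tuple x; y; z] i)%Z by apply: contraT => ndvd; case: imprim; exists i.
by split; [have := dvd 0|have := dvd 1|have := dvd 2]; rewrite (tnth_nth 0).
Qed.

Lemma hilb_unit (a b : int) : ~~ (q%:Z %| a)%Z -> valz q b = 1%N ->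
  hilb q a b = F2_of_bool (nonres q a).
Proof.
move=> qa vb; have b0 : b != 0 by apply: contra_eq_neq vb => ->; rewrite /valz logn0.
have qb : (q%:Z %| b)%Z by rewrite -valz_gt0 // vb.
apply: hilb_conicP => [x y z [prim Exyz]|a_sq K]; last first.
  have [x qx Ex] := hensel_odd K q_pr q_odd qa a_sq; exists 1, 0, x; split.
    by rewrite (negbTE (primez_ndvd1 q_pr)).
  rewrite expr1n mulr1 expr0n mulr0 addr0 -opprB rpredN.
  exact: dvdz_expW (leqnSn K) Ex.
have Exz : (q%:Z %| z ^+ 2 - a * x ^+ 2)%Z.
  have -> : z ^+ 2 - a * x ^+ 2 = b * y ^+ 2 - (a * x ^+ 2 + b * y ^+ 2 - z ^+ 2) by ring.
  by rewrite rpredB ?dvdz_mulr //; apply: dvdz_trans Exyz; rewrite dvdz_exp.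
have [qx|qx] := boolP (q%:Z %| x)%Z; last by rewrite (nonres_sqr_eqmod q_pr q_odd qa qx Exz).
have qz : (q%:Z %| z)%Z.
  have : (q%:Z %| z ^+ 2)%Z by rewrite -(subrK (a * x ^+ 2) (z ^+ 2)) rpredD // dvdz_mull ?dvdz_exp.
  by rewrite Euclid_dvdzX // andbT.
have qy : (q%:Z %| y)%Z.
  have : (q%:Z ^+ 2 %| b * y ^+ 2)%Z.
    have -> : b * y ^+ 2 = (a * x ^+ 2 + b * y ^+ 2 - z ^+ 2) - a * x ^+ 2 + z ^+ 2 by ring.
    by rewrite rpredD ?dvdz_exp2r // rpredB // dvdz_mull // dvdz_exp2r.
  apply: contraTT => qy; have y0 := ndvdz_neq0 qy.
  by rewrite -valz_ge ?mulf_neq0 ?expf_neq0 // valzM ?expf_neq0 // vb valz_sqr // (valz_unit qy).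
by rewrite qx qy qz in prim.
Qed.

Lemma hilb_uniformizer (b : int) : valz q b = 1%N ->
  hilb q q%:Z b = F2_of_bool (nonres q (- unit_part q b)).
Proof.
move=> vb; have b0 : b != 0 by apply: contra_eq_neq vb => ->; rewrite /valz logn0.
have qu : ~~ (q%:Z %| - unit_part q b)%Z by rewrite rpredN unit_part_ndvd.
have Eb : b = q%:Z * unit_part q b by rewrite {1}(unit_partE q b) vb.
apply: hilb_conicP => [x y z [prim]|u_sq K]; rewrite {1}Eb; last first.
  have [x qx Ex] := hensel_odd K q_pr q_odd qu u_sq; exists x, 1, 0; split.
    by rewrite (negbTE (primez_ndvd1 q_pr)) andbF.
  rewrite expr0n subr0 expr1n mulr1 -mulrDr dvdz_mull //.
  by rewrite opprK in Ex; exact: dvdz_expW (leqnSn K) Ex.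
rewrite -mulrA -mulrDr => Exyz; have qz : (q%:Z %| z)%Z.
  have : (q%:Z %| z ^+ 2)%Z.
    rewrite -(subKr (q%:Z * (x ^+ 2 + unit_part q b * y ^+ 2)) (z ^+ 2)) rpredB ?dvdz_mulr //.
    by apply: dvdz_trans Exyz; rewrite dvdz_exp.
  by rewrite Euclid_dvdzX // andbT.
have Exy : (q%:Z %| x ^+ 2 - - unit_part q b * y ^+ 2)%Z.
  rewrite mulNr opprK -(dvdz_mul2l (primez_neq0 q_pr)) -expr2.
  by rewrite -[q%:Z * (_ + _)](subrK (z ^+ 2)) rpredD // dvdz_exp2r.
have [qy|qy] := boolP (q%:Z %| y)%Z; last by rewrite (nonres_sqr_eqmod q_pr q_odd qu qy Exy).
have qx : (q%:Z %| x)%Z.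
  have : (q%:Z %| x ^+ 2)%Z.
    by rewrite -(subrK (- unit_part q b * y ^+ 2) (x ^+ 2)) rpredD // dvdz_mull ?dvdz_exp.
  by rewrite Euclid_dvdzX // andbT.
by rewrite qx qy qz in prim.
Qed.

End ResidueSymbols.

(** * Signed products of primes *)

Lemma absz_pstar m : `|pstar m|%N = m.
Proof. by rewrite /pstar; case: ifP; rewrite ?abszN. Qed.

Lemma pstar_mod4 m : odd m -> (pstar m == 1 %[mod 4])%Z.
Proof. by rewrite /pstar; case: ifP; lia. Qed.

Lemma mod4_eps2 (a : int) : (a == 1 %[mod 4])%Z -> eps2 a = false.
Proof. by move=> a1; rewrite eps2_odd; lia. Qed.

Lemma unit_nonres_self q : prime q -> odd q -> unit_nonres q q = false.
Proof.
move=> q_pr q_odd; rewrite /unit_nonres -[q%:Z]mulr1 -[q%:Z]expr1.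
by rewrite unit_part_expM ?primez_ndvd1 // nonres1.
Qed.

(* Quadratic reciprocity in the form (p/q) = (q*/p); on the diagonal it accounts for the sign
   of p*. *)
Lemma unit_nonres_pstar q r : prime q -> prime r -> odd q -> odd r ->
  unit_nonres r q = unit_nonres q (pstar r) + (q == r) * unit_nonres q (-1).
Proof.
move=> q_pr r_pr q_odd r_odd.
have r0 : r%:Z != 0 by rewrite primez_neq0.
have pstarE : unit_nonres q (pstar r) = odd r./2 * odd q./2 + unit_nonres q r.
  rewrite /pstar (_ : (r %% 4 == 1)%N = ~~ odd r./2); last by lia.
  case: (odd r./2) => /=; last by rewrite mul0r add0r.
  by rewrite unit_nonresN // unit_nonresN1 // nonresN1 // mul1r.
rewrite pstarE unit_nonresN1 // nonresN1 //; have [<-|qr] := eqVneq q r.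
  by rewrite unit_nonres_self //; case: (odd q./2).
rewrite mul0r addr0 !unit_nonres_prime // 1?eq_sym //.
rewrite (quadratic_reciprocity q_pr r_pr q_odd r_odd qr) addrC [_ * _]andbC -addrA.
by case: (_ && _); rewrite ?addr0 // [true + _]addrC -addrA ?addr0.
Qed.

Section PrimeFamily.
Variables (k : nat) (p : 'I_k -> nat).
Hypotheses (p_pr : forall i, prime (p i)) (p_inj : injective p).

Section SignedProduct.
Variable F : nat -> int.
Hypothesis absF : forall m, `|F m|%N = m.

Definition signed_prod (b : 'I_k -> bool) : int := \prod_(i | b i) F (p i).

Lemma absz_signed_prod b : `|signed_prod b|%N = (\prod_(i | b i) p i)%N.
Proof.
by rewrite (big_morph _ abszM (erefl : `|1|%N = 1%N)); apply: eq_bigr => i _; rewrite absF.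
Qed.

Lemma signed_prime_neq0 i : F (p i) != 0.
Proof. by rewrite -absz_gt0 absF prime_gt0. Qed.

Lemma signed_prod_neq0 b : signed_prod b != 0.
Proof. by apply/prodf_neq0 => i _; exact: signed_prime_neq0. Qed.

Lemma signed_prod_morph (V : nmodType) (f : int -> V) b : f 1 = 0 ->
  (forall x y, x != 0 -> y != 0 -> f (x * y) = f x + f y) ->
  f (signed_prod b) = \sum_(i | b i) f (F (p i)).
Proof.
move=> f1 fM; suff [] : signed_prod b != 0 /\ f (signed_prod b) = \sum_(i | b i) f (F (p i)) by [].
rewrite /signed_prod; elim/big_rec2: _ => [//|i x y _ [y0 Ey]].
by rewrite mulf_neq0 ?signed_prime_neq0 // fM ?signed_prime_neq0 // Ey.
Qed.

Lemma oddval_signed_prime q i : prime q -> oddval q (F (p i)) = (q == p i).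
Proof. by move=> q_pr; rewrite -(oddval_prime q_pr (p_pr i)) /oddval /valz absF. Qed.

Lemma oddval_signed_prod q b : prime q -> oddval q (signed_prod b) = \sum_(i | b i) (q == p i).
Proof.
move=> q_pr; rewrite (@signed_prod_morph bool) => [||x y x0 y0]; last exact: oddvalM.
  by apply: eq_bigr => i _; rewrite oddval_signed_prime.
by rewrite oddval_unit // primez_ndvd1.
Qed.

Lemma oddval_signed_prod_in i b : oddval (p i) (signed_prod b) = b i.
Proof.
rewrite oddval_signed_prod // big_mkcond /= (bigD1 i) //= eqxx big1 ?addr0 => [|j].
  by case: (b i).
by rewrite (inj_eq p_inj) eq_sym => /negbTE ->; case: (b j).
Qed.

Lemma sqclass_signed_prod0 q b : prime q -> (forall i, sqclass q (F (p i)) = 0) ->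
  sqclass q (signed_prod b) = 0.
Proof.
move=> q_pr Fp; rewrite (signed_prod_morph b (sqclass1 q_pr)) ?big1 // => x y x0 y0.
exact: sqclassM.
Qed.

Lemma unit_nonres_signed_prod q b : prime q -> odd q ->
  unit_nonres q (signed_prod b) = \sum_(i | b i) unit_nonres q (F (p i)).
Proof.
move=> q_pr q_odd; apply: signed_prod_morph => [|x y x0 y0]; last exact: unit_nonresM.
by rewrite unit_nonres_unit ?primez_ndvd1 // nonres1.
Qed.

Variable n : nat.
Hypotheses (nE : n = (\prod_(i < k) p i)%N) (n_sqf : sqfree n%:Z).

Lemma signed_prod_dvd b : (signed_prod b %| n%:Z)%Z.
Proof. by rewrite dvdzE absz_signed_prod nE [X in (_ %| X)%N](bigID b) dvdn_mulr. Qed.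

Lemma signed_prod_sqfree b : sqfree (signed_prod b).
Proof. exact: sqfree_dvd n_sqf (signed_prod_dvd b). Qed.

Lemma prime_dvd_family q : prime q -> (q %| n)%N -> exists i, q = p i.
Proof.
move=> q_pr; rewrite nE; elim/big_ind: _ => [|a b Ia Ib|i _].
- by rewrite dvdn1 => /eqP q1; rewrite q1 in q_pr.
- by rewrite Euclid_dvdM // => /orP [/Ia|/Ib].
- by rewrite dvdn_prime2 // => /eqP ->; exists i.
Qed.

Lemma family_dvd i : (p i %| n)%N.
Proof. by rewrite nE (bigD1 i) //= dvdn_mulr. Qed.

Lemma absz_dvd_signed_prod a : (a %| n%:Z)%Z ->
  `|a|%N = `|signed_prod (fun i => oddval (p i) a)|%N.
Proof.
move=> an; have a_sqf := sqfree_dvd n_sqf an; apply: sqfree_absz_eq => // [|q q_pr].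
  exact: signed_prod_sqfree.
have [/(prime_dvd_family q_pr) [i ->]|qn] := boolP (q %| n)%N.
  by rewrite oddval_signed_prod_in.
have out b : (b %| n%:Z)%Z -> oddval q b = false.
  by move=> bn; apply: oddval_unit; apply: contra qn => qb; exact: dvdz_trans qb bn.
by rewrite !out ?signed_prod_dvd.
Qed.

End SignedProduct.

End PrimeFamily.

(** * Normalized triples and the descent to the untwisted curve *)

Definition normalized (n : nat) (d : triple) : Prop :=
  [/\ sqfree3 d, norm_square d, (t2 d %| n%:Z)%Z /\ (t3 d %| n%:Z)%Z, 0 < t2 d
    & (t3 d == 1 %[mod 4])%Z].

Lemma sqeq3_sqfree3_eq d d' : sqfree3 d -> sqfree3 d' -> sqeq3 d d' -> d = d'.
Proof.
case: d d' => [[d1 d2] d3] [[d1' d2'] d3'] [s1 s2 s3] [s1' s2' s3'] [E1 [E2 E3]].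
by move: (sqfree_eq s1 s1' E1) (sqfree_eq s2 s2' E2) (sqfree_eq s3 s3' E3);
  rewrite !tripleE => -> -> ->.
Qed.

Lemma is_sq_mul_cancel (a b c u : int) : a != 0 -> u != 0 ->
  is_sq (a * b * u) -> is_sq (a * c * u) -> is_sq (b * c).
Proof.
move=> a0 u0 Eab Eac; apply: (is_sq_cancel (b := (a * u) ^+ 2)); rewrite ?expf_neq0 ?mulf_neq0 //.
  by exists (a * u).
by have := is_sqM Eab Eac; congr is_sq; ring.
Qed.

Lemma sqeq3_cancel s r r' t : nonzero3 s -> nonzero3 t ->
  sqeq3 (mul3 s r) t -> sqeq3 (mul3 s r') t -> sqeq3 r r'.
Proof.
move=> /and3P [s1 s2 s3] /and3P [u1 u2 u3] [E1 [E2 E3]] [E1' [E2' E3']].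
by split; [|split]; [exact: is_sq_mul_cancel E1 E1' | exact: is_sq_mul_cancel E2 E2'
  | exact: is_sq_mul_cancel E3 E3'].
Qed.

Lemma normalized_eq n d d' : normalized n d -> normalized n d' ->
  t2 d = t2 d' -> t3 d = t3 d' -> d = d'.
Proof.
move=> [d_sqf dN _ _ _] [d'_sqf d'N _ _ _] E2 E3.
have /and3P [_ d2' d3'] := sqfree3_nonzero3 d'_sqf.
apply: sqeq3_sqfree3_eq => //; rewrite /sqeq3 E2 E3.
split; last by split; [exists (t2 d') | exists (t3 d')].
apply: (is_sq_mul_cancel (a := t2 d') (u := t3 d')) => //.
  by move: dN; rewrite /norm_square E2 E3; congr is_sq; ring.
by move: d'N; congr is_sq; ring.
Qed.

Lemma sqclass3_eq23 q d d' : normker q d -> normker q d' ->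
  (sqclass3 q d == sqclass3 q d') =
  (sqclass q (t2 d) == sqclass q (t2 d')) && (sqclass q (t3 d) == sqclass q (t3 d')).
Proof.
move=> dN d'N; apply/eqP/andP => [/sqclass3P [_ -> ->] //|[/eqP Ed2 /eqP Ed3]].
by apply/sqclass3P; rewrite (normker_t1 dN) (normker_t1 d'N) Ed2 Ed3.
Qed.

Lemma normker_one q : prime q -> normker q (1, 1, 1).
Proof. by move=> q_pr; rewrite /normker !tripleE !sqclass1. Qed.

Definition ramified_form2 (q : nat) (e1 e3 m : int) (d : triple) : bool :=
  unit_nonres q (t2 d) + oddval q (t2 d) * (unit_nonres q m + unit_nonres q (- e1))
  + oddval q (t3 d) * unit_nonres q (- e1 * e3).

Definition ramified_form3 (q : nat) (e1 e2 m : int) (d : triple) : bool :=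
  unit_nonres q (t3 d) + oddval q (t3 d) * (unit_nonres q m + unit_nonres q e1)
  + oddval q (t2 d) * unit_nonres q (- e1 * e2).

Lemma torsion_class_linear q e1 e2 e3 m d : prime q -> odd q ->
  ~~ (q%:Z %| e1)%Z -> ~~ (q%:Z %| e2)%Z -> ~~ (q%:Z %| e3)%Z ->
  oddval q m -> m != 0 -> normker q d ->
  torsion_class q (twist e1 e2 e3 m) d =
  ~~ ramified_form2 q e1 e3 m d && ~~ ramified_form3 q e1 e2 m d.
Proof.
move=> q_pr q_odd qe1 qe2 qe3 m_odd m0 dN.
have [e10 e20 e30] := And3 (ndvdz_neq0 qe1) (ndvdz_neq0 qe2) (ndvdz_neq0 qe3).
have E0 : nonzero3 (twist e1 e2 e3 m) by rewrite /nonzero3 !tripleE !mulf_neq0.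
have E0' : nonzero3 (rot3 (twist e1 e2 e3 m)) by rewrite nonzero3_rot.
have E0'' : nonzero3 (rot3 (rot3 (twist e1 e2 e3 m))) by rewrite nonzero3_rot.
have t1N := normker_torsion1 q_pr E0.
have t2N := normker_rot (normker_rot (normker_torsion1 q_pr E0')).
have t3N := normker_rot (normker_torsion1 q_pr E0'').
rewrite /ramified_form2 /ramified_form3 /torsion_class !inE.
rewrite (sqclass3_eq23 dN (normker_one q_pr)) (sqclass3_eq23 dN t1N).
rewrite (sqclass3_eq23 dN t2N) (sqclass3_eq23 dN t3N).
rewrite !(tripleE, rot3E) sqclass1 // !sqclass_odd // !(@mulNr int) !oddvalN !oddvalM ?mulf_neq0 //.
rewrite m_odd !(oddval_unit qe1) !(oddval_unit qe2) !(oddval_unit qe3).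
have [c unrN] : exists c, forall a, a != 0 -> unit_nonres q (- a) = c + unit_nonres q a.
  by exists (unit_nonres q (-1)) => a; exact: unit_nonresN.
rewrite !unrN ?mulf_neq0 // !unit_nonresM ?mulf_neq0 // !xpair_eqE !andbT.
move: c (unit_nonres q m) (unit_nonres q e1) (unit_nonres q e2) (unit_nonres q e3) {unrN}.
move: (oddval q (t2 d)) (oddval q (t3 d)) (unit_nonres q (t2 d)) (unit_nonres q (t3 d)).
by case=> -[] [] [] [] [] [] [] [].
Qed.

Section Descent.
Variables (e1 e2 e3 : int) (k : nat) (p : 'I_k -> nat) (n : nat).
Hypotheses (e_sum : e1 + e2 + e3 = 0) (e1_lt0 : e1 < 0) (e2_neq0 : e2 != 0) (e3_gt0 : 0 < e3).
Hypotheses (e1_two : two_exact e1) (e2_two : two_exact e2) (e3_four : (4 %| e3)%Z).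
Hypotheses (p_pr : forall i, prime (p i)) (p_inj : injective p) (nE : n = (\prod_(i < k) p i)%N).
Hypotheses (n_odd : odd n) (n_gt0 : (0 < n)%N) (n_sqf : sqfree n%:Z).
Hypothesis n_coprime : coprimez n%:Z (e1 * e2 * e3).
Hypothesis residue : forall q r : nat, prime q -> (q %| n)%N -> prime r -> odd r ->
  (r%:Z %| e1 * e2 * e3)%Z -> nqr q%:Z r = 0.
Hypothesis residue_star : forall q r : nat, prime q -> (q %| n)%N -> prime r -> odd r ->
  (r%:Z %| e1 * e3)%Z -> nqr (pstar q) r = 0.
Local Notation E := (twist e1 e2 e3 n%:Z).
Local Notation E1 := (twist e1 e2 e3 1).

Let nz_gt0 : 0 < n%:Z := n_gt0.
Let nz_neq0 : n%:Z != 0 := lt0r_neq0 nz_gt0.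
Let n_odd2 : ~~ (2 %| n%:Z)%Z.
Proof. by rewrite dvdzE dvdn2 n_odd. Qed.
Let Ebal : balanced E := balanced_twist e_sum e1_lt0 e2_neq0 e3_gt0 nz_gt0.
Let SelP s : Sel2 e1 e2 e3 n%:Z s <->
    [/\ sqfree3 s, norm_square s, 0 < t2 s & forall q, prime q -> locsol q E s] :=
  Sel2P e_sum e1_lt0 e2_neq0 e3_gt0 nz_gt0 s.

Lemma family_odd i : odd (p i).
Proof. by move: n_odd; rewrite nE (bigD1 i) //= oddM => /andP []. Qed.

Lemma prime_dvd_n_good q : prime q -> (q %| n)%N ->
  [/\ ~~ (q%:Z %| e1)%Z, ~~ (q%:Z %| e2)%Z & ~~ (q%:Z %| e3)%Z].
Proof.
move=> q_pr qn; have : ~~ (q%:Z %| e1 * e2 * e3)%Z.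
  apply/negP => qe; have : (q %| gcdn n `|(e1 * e2 * e3)%R|)%N.
    by rewrite dvdn_gcd qn; rewrite dvdzE in qe.
  move: n_coprime; rewrite /coprimez /gcdz eqz_nat /= => /eqP ->.
  by rewrite dvdn1 => /eqP q1; rewrite q1 in q_pr.
by rewrite !Euclid_dvdzM // !negb_or -andbA => /and3P.
Qed.

Lemma oddval_family i : oddval (p i) n%:Z.
Proof. by rewrite oddval_sqfree // dvdzE family_dvd. Qed.

Lemma oddval_dvd_n q a : (a %| n%:Z)%Z -> ~~ (q %| n)%N -> oddval q a = false.
Proof. by move=> an qn; apply: oddval_unit; apply: contra qn => qa; exact: dvdz_trans qa an. Qed.

Lemma equal_valz_twist q : prime q -> ~~ (q%:Z %| e1)%Z -> ~~ (q%:Z %| e2)%Z -> ~~ (q%:Z %| e3)%Z ->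
  equal_valz q (valz q n%:Z) E.
Proof.
move=> q_pr qe1 qe2 qe3.
rewrite /equal_valz !tripleE !valzM ?(ndvdz_neq0 qe1) ?(ndvdz_neq0 qe3) //.
by rewrite (valz_unit qe1) (valz_unit qe2) (valz_unit qe3) eqxx.
Qed.

Lemma pos_dvd_signed_prod a : (a %| n%:Z)%Z -> 0 < a ->
  a = signed_prod p Posz (fun i => oddval (p i) a).
Proof.
move=> an a_gt0; have /(congr1 Posz) := absz_dvd_signed_prod p_pr p_inj absz_nat nE n_sqf an.
by rewrite !gez0_abs ?(ltW a_gt0) //; apply: prodr_ge0.
Qed.

Lemma signed_prod_pstar_mod4 b : (signed_prod p pstar b == 1 %[mod 4])%Z.
Proof.
rewrite /signed_prod; elim/big_ind: _ => // [x y /eqP Ex /eqP Ey|i _].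
  by rewrite -modzMm Ex Ey.
exact: pstar_mod4 (family_odd i).
Qed.

Lemma mod4_dvd_signed_prod a : (a %| n%:Z)%Z -> (a == 1 %[mod 4])%Z ->
  a = signed_prod p pstar (fun i => oddval (p i) a).
Proof.
move=> an; have := absz_dvd_signed_prod p_pr p_inj absz_pstar nE n_sqf an.
have := signed_prod_pstar_mod4 (fun i => oddval (p i) a).
by move: (signed_prod _ _ _) => b; clear; lia.
Qed.

Section NormalizedTriple.
Variable d : triple.
Hypothesis d_norm : normalized n d.

Lemma normalized_nonzero3 : nonzero3 d.
Proof. by case: d_norm => /sqfree3_nonzero3. Qed.

Lemma normalized_normker q : prime q -> normker q d.
Proof. by case: d_norm => /sqfree3_nonzero3 d0 dN _ _ _ q_pr; exact: norm_square_normker. Qed.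

Lemma normalized_parity_out q : ~~ (q %| n)%N -> parity q d = 0.
Proof. by case: d_norm => _ _ [d2n d3n] _ _ qn; apply/parity_eq0; rewrite !oddval_dvd_n. Qed.

Lemma normalized_eps2 : eps2 (t3 d) = false.
Proof. by case: d_norm => _ _ _ _ /mod4_eps2. Qed.

Lemma normalized_parity2 : parity 2 d = 0.
Proof. by apply: normalized_parity_out; rewrite dvdn2 n_odd. Qed.

Lemma normalized_t13_gt0 : 0 < t1 d * t3 d.
Proof.
have [_ dN _ d2_gt0 _] := d_norm.
by have := norm_square_gt0 normalized_nonzero3 dN; rewrite mulrAC pmulr_lgt0.
Qed.

Section BadPrime.
Variable r : nat.
Hypotheses (r_pr : prime r) (r_odd : odd r) (r_bad : (r%:Z %| e1 * e2 * e3)%Z).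

Lemma bad_ndvd_n : ~~ (r %| n)%N.
Proof.
apply/negP => /(prime_dvd_n_good r_pr) [re1 re2 re3].
by move: r_bad; rewrite !Euclid_dvdzM // (negbTE re1) (negbTE re2) (negbTE re3).
Qed.

Lemma bad_ndvd_family i : ~~ (r%:Z %| (p i)%:Z)%Z.
Proof. by apply: contra bad_ndvd_n => ri; exact: dvdn_trans ri (family_dvd nE i). Qed.

Lemma bad_sqclass_dvd a : (a %| n%:Z)%Z -> 0 < a -> sqclass r a = 0.
Proof.
move=> an /(pos_dvd_signed_prod an) ->; apply: (sqclass_signed_prod0 p_pr absz_nat) => // i.
by apply: nqr0_sqclass => //; [exact: bad_ndvd_family | exact: residue (family_dvd nE i) _ _ _].
Qed.

Lemma bad_sqclass_t3 : sqclass r (t3 d) = 0 \/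
  [/\ (r%:Z %| e2)%Z, ~~ (r%:Z %| e3)%Z & sqclass r (t3 d) = sqclass r (-1)].
Proof.
have [r13|] := boolP (r%:Z %| e1 * e3)%Z.
  left; have [_ _ [_ d3n] _ d3_mod4] := d_norm; rewrite (mod4_dvd_signed_prod d3n d3_mod4).
  apply: (sqclass_signed_prod0 p_pr absz_pstar) => // i.
  apply: nqr0_sqclass => //; last exact: residue_star (family_dvd nE i) _ _ _.
  by have := bad_ndvd_family i; rewrite !dvdzE absz_pstar.
rewrite Euclid_dvdzM // negb_or => /andP [re1 re3].
have re2 : (r%:Z %| e2)%Z by move: r_bad; rewrite !Euclid_dvdzM // (negbTE re1) (negbTE re3) orbF.
have [_ _ [_ d3n] _ _] := d_norm; have /and3P [_ _ d30] := normalized_nonzero3.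
have [d3_gt0|d3_lt0|d3_eq0] := ltrgt0P (t3 d); last by rewrite d3_eq0 in d30.
  by left; exact: bad_sqclass_dvd.
right; split=> //; rewrite -[t3 d]opprK sqclassN ?oppr_eq0 //.
by rewrite (@bad_sqclass_dvd (- t3 d)) ?addr0 ?oppr_gt0 // dvdzE abszN -dvdzE.
Qed.

Lemma locsol_bad_mul s : normker r s -> locsol r E s -> locsol r E (mul3 d s).
Proof.
move=> sN sL; have dN := normalized_normker r_pr; have s0 := normker_nonzero3 sN.
have d2_class : sqclass r (t2 d) = 0.
  by have [_ _ [d2n _] d2_gt0 _] := d_norm; exact: bad_sqclass_dvd.
have mulE d' : nonzero3 d' -> sqclass3 r d = sqclass3 r d' ->
    locsol r E (mul3 d' s) -> locsol r E (mul3 d s).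
  move=> d'0 Ed; apply: locsol_sqclass3.
  by rewrite !sqclass3_mul ?Ed // normalized_nonzero3.
have rn : ~~ (r%:Z %| n%:Z)%Z by exact: bad_ndvd_n.
have [d3_class|[re2 re3 d3_class]] := bad_sqclass_t3.
  apply: (mulE (1, 1, 1)) => //.
    by rewrite sqclass3_one // /sqclass3 (normker_t1 dN) d2_class d3_class.
  by apply: locsol_sqclass3 sL; rewrite sqclass3_mul // sqclass3_one // add0r.
apply: (mulE negate13) => //.
  by apply/sqclass3P; rewrite (normker_t1 dN) d2_class d3_class !tripleE sqclass1 ?add0r.
apply: locsol_sign_change => //; first by rewrite tripleE dvdz_mulr.
by rewrite tripleE Euclid_dvdzM // negb_or re3.
Qed.
End BadPrime.

Lemma two_exact_twist e : two_exact e -> two_exact (e * n%:Z).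
Proof.
move=> [e_even e4]; split; first by rewrite dvdz_mulr.
have n4 : coprimez 4 n%:Z.
  by rewrite /coprimez /gcdz eqz_nat -/(coprime _ _) (@coprimeXl 2 2) // coprime2n.
by rewrite Gauss_dvdzl.
Qed.

Lemma locsol_normalized_odd q : prime q -> odd q -> ~~ (q %| n)%N -> locsol q E d.
Proof.
move=> q_pr q_odd qn; have dN := normalized_normker q_pr.
have [q_bad|] := boolP (q%:Z %| e1 * e2 * e3)%Z.
  have := locsol_bad_mul q_pr q_odd q_bad (s := (1, 1, 1)).
  rewrite (_ : mul3 d (1, 1, 1) = d); last by case: (d) => [[a b] c]; rewrite /mul3 !tripleE !mulr1.
  apply; last by apply: locsol_trivial; rewrite ?sqclass3_one.
  by rewrite /normker !sqclass1.
rewrite !Euclid_dvdzM // !negb_or -andbA => /and3P [qe1 qe2 qe3].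
have /parity_eq0 [o2 o3] := normalized_parity_out qn; apply: locsol_good => //.
by rewrite /good_reduction !tripleE !Euclid_dvdzM // !negb_or qe1 qe2 qe3 qn.
Qed.

Lemma locsol_ramified_twist i s : normker (p i) s ->
  locsol (p i) E s <-> torsion_class (p i) E s.
Proof.
move=> sN; have [pe1 pe2 pe3] := prime_dvd_n_good (p_pr i) (family_dvd nE i).
exact: (locsol_ramified (p_pr i) (family_odd i) Ebal (equal_valz_twist (p_pr i) pe1 pe2 pe3)
  (oddval_family i)).
Qed.

Lemma Sel2_normalizedP : Sel2 e1 e2 e3 n%:Z d <-> forall i, torsion_class (p i) E d.
Proof.
have [d_sqf dN _ d2_gt0 _] := d_norm.
split=> [/SelP [_ _ _ dL] i|d_tors].
  by apply/(locsol_ramified_twist (normalized_normker (p_pr i))); exact: dL.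
apply/SelP; split=> //.
have dL q : prime q -> odd q -> locsol q E d.
  move=> q_pr q_odd; have [qn|] := boolP (q %| n)%N; last exact: locsol_normalized_odd.
  have [i Eq] := prime_dvd_family p_pr nE q_pr qn; rewrite Eq.
  by apply/(locsol_ramified_twist (normalized_normker (p_pr i))); exact: d_tors.
move=> q q_pr; have [->|/(prime_neq2_odd q_pr) q_odd] := eqVneq q 2; last exact: dL.
have /parity_eq0 [o2 o3] := normalized_parity2.
apply: locsol_two => //; rewrite ?tripleE.
- by rewrite pmulr_llt0.
- exact: two_exact_twist.
- exact: two_exact_twist.
- exact: dvdz_mulr.
- exact: normalized_normker.
- exact: normalized_t13_gt0.
- exact: normalized_eps2.
Qed.

End NormalizedTriple.

Lemma normalized_ex b c : exists d,
  [/\ normalized n d, t2 d = signed_prod p Posz b & t3 d = signed_prod p pstar c].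
Proof.
have d2_dvd := signed_prod_dvd absz_nat nE b; have d3_dvd := signed_prod_dvd absz_pstar nE c.
have d2_0 := signed_prod_neq0 p_pr absz_nat b; have d3_0 := signed_prod_neq0 p_pr absz_pstar c.
have [d1 d1_sqf Ed1] := sqfree_ex (mulf_neq0 d2_0 d3_0).
exists (d1, signed_prod p Posz b, signed_prod p pstar c); split=> //; split=> //.
- by split; rewrite // tripleE; [exact: sqfree_dvd d2_dvd | exact: sqfree_dvd d3_dvd].
- by rewrite /norm_square !tripleE -mulrA mulrC.
- by rewrite tripleE lt_neqAle eq_sym d2_0 prodr_ge0.
- by rewrite tripleE signed_prod_pstar_mod4.
Qed.

Section Untwisting.
Variables s d c : triple.
Hypotheses (Ss : Sel2 e1 e2 e3 n%:Z s) (s_even : parity 2 s = 0).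
Hypotheses (d_norm : normalized n d) (c_sqf : sqfree3 c) (Ec : sqeq3 (mul3 d s) c).
Hypothesis sd_parity : forall i, parity (p i) s = parity (p i) d.

Let s0 : nonzero3 s := Sel2_nonzero3 Ss.
Let d0 : nonzero3 d := normalized_nonzero3 d_norm.
Let c0 : nonzero3 c := sqfree3_nonzero3 c_sqf.
Let ds0 : nonzero3 (mul3 d s) := nonzero3_mul d0 s0.

Lemma untwist_norm_square : norm_square c.
Proof.
have [_ dN _ _ _] := d_norm; have [_ [_ [_ [sN _]]]] := Ss.
exact: norm_square_sqeq3 ds0 (norm_square_mul dN sN) Ec.
Qed.

Lemma untwist_parity q : prime q -> parity q c = parity q d + parity q s.
Proof. by move=> q_pr; rewrite -(sqeq3_parity q_pr ds0 c0 Ec) parityM. Qed.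

Lemma untwist_normker q : prime q -> normker q c.
Proof. by move=> q_pr; apply: norm_square_normker q_pr c0 untwist_norm_square. Qed.

Lemma untwist_t2_gt0 : 0 < t2 c.
Proof.
have [_ _ _ d2_gt0 _] := d_norm; have /and3P [_ ds2 _] := ds0; have /and3P [_ c2 _] := c0.
have /SelP [_ _ s2_gt0 _] := Ss; have [_ [Ec2 _]] := Ec.
by have := is_sq_gt0 (mulf_neq0 ds2 c2) Ec2; rewrite pmulr_rgt0 // mul3E mulr_gt0.
Qed.

Lemma untwist_parity2 : parity 2 c = 0.
Proof. by rewrite untwist_parity // s_even (normalized_parity2 d_norm). Qed.

Lemma untwist_eps2 : eps2 (t3 c) = false.
Proof.
have /SelP [_ _ _ sL] := Ss.
have /parity_eq0 [s2_even s3_even] := s_even.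
have s_eps : eps2 (t3 s) = false.
  apply: locsol_two_eps2 Ebal _ _ (Sel2_normker _ _ _ _ _ _ Ss) s2_even s3_even (sL 2 isT) => //.
    exact: two_exact_twist.
  by rewrite dvdz_mulr.
have /sqclass3P [_ _ /sqclass_eps2 <-] := sqeq3_sqclass3 (isT : prime 2) ds0 c0 Ec.
have [/and3P [_ _ d3] /and3P [_ _ s3]] := (d0, s0).
by rewrite mul3E eps2M // s_eps (normalized_eps2 d_norm).
Qed.

Lemma locsol_untwist_bad q : prime q -> odd q -> (q%:Z %| e1 * e2 * e3)%Z -> locsol q E1 c.
Proof.
move=> q_pr q_odd q_bad.
have /SelP [_ _ _ sL] := Ss.
have sN : normker q s by apply: Sel2_normker Ss.
have [X [t [X0 EX Xc]]] := locsol_bad_mul d_norm q_pr q_odd q_bad sN (sL q q_pr).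
have n_class : sqclass q n%:Z = 0 by exact: bad_sqclass_dvd.
exists (mul3 (n%:Z, n%:Z, n%:Z) X), (n%:Z * t).
have nn0 : nonzero3 (n%:Z, n%:Z, n%:Z) by rewrite /nonzero3 !tripleE nz_neq0.
split; first exact: nonzero3_mul.
  by case: EX => EX1 EX2 EX3; split; rewrite !mul3E; [rewrite EX1|rewrite EX2|rewrite EX3];
    rewrite !tripleE; ring.
by rewrite sqclass3_mul // Xc (sqeq3_sqclass3 q_pr ds0 c0 Ec) /sqclass3 !tripleE n_class add0r.
Qed.

Lemma locsol_untwist_odd q : prime q -> odd q -> locsol q E1 c.
Proof.
move=> q_pr q_odd; have [|] := boolP (q%:Z %| e1 * e2 * e3)%Z; first exact: locsol_untwist_bad.
rewrite !Euclid_dvdzM // !negb_or -andbA => /and3P [qe1 qe2 qe3].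
suff sd : parity q s = parity q d.
  have /parity_eq0 [c2_even c3_even] : parity q c = 0.
    by rewrite untwist_parity // sd; case: (parity q d) => -[] [].
  apply: locsol_good => //; first exact: balanced_twist.
    by rewrite /good_reduction !tripleE !mulr1 qe1 qe2 qe3.
  exact: untwist_normker.
have [/(prime_dvd_family p_pr nE q_pr) [i ->] //|qn] := boolP (q %| n)%N.
have sN : normker q s by apply: Sel2_normker Ss.
have /SelP [_ _ _ sL] := Ss.
have n_val : ~~ odd (valz q n%:Z) by rewrite valz_unit.
rewrite (normalized_parity_out d_norm qn); apply/parity_eq0.
exact: locsol_unramified q_pr q_odd Ebal (equal_valz_twist q_pr qe1 qe2 qe3) n_val sN (sL q q_pr).
Qed.

Lemma locsol_untwist_two : locsol 2 E1 c.
Proof.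
have /parity_eq0 [c2_even c3_even] := untwist_parity2.
have c13_gt0 : 0 < t1 c * t3 c.
  have := norm_square_gt0 c0 untwist_norm_square.
  by rewrite mulrAC pmulr_lgt0 // untwist_t2_gt0.
apply: locsol_two => //; rewrite ?tripleE ?mulr1 //.
- exact: balanced_twist.
- exact: untwist_normker.
- exact: untwist_t2_gt0.
- exact: untwist_eps2.
- exact: locsol_untwist_odd.
Qed.

Lemma Sel2_untwist : Sel2 e1 e2 e3 1 c.
Proof.
have one_gt0 : 0 < 1 :> int by [].
apply/(Sel2P e_sum e1_lt0 e2_neq0 e3_gt0 one_gt0); split=> // [||q q_pr].
- exact: untwist_norm_square.
- exact: untwist_t2_gt0.
- have [->|/(prime_neq2_odd q_pr) q_odd] := eqVneq q 2; first exact: locsol_untwist_two.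
  exact: locsol_untwist_odd.
Qed.

End Untwisting.

(* Splitting off the normalized part [d] of [s] leaves a class of the untwisted curve with even
   parities, which is trivial. *)
Lemma Sel2_even_normalized s : Sel2_iso_Z2sq e1 e2 e3 1 -> Sel2 e1 e2 e3 n%:Z s ->
  parity 2 s = 0 -> normalized n s.
Proof.
move=> iso Ss s_even; have s0 := Sel2_nonzero3 Ss; have [s1_sqf [s2_sqf [s3_sqf _]]] := Ss.
have [d [d_norm Ed2 Ed3]] :=
  normalized_ex (fun i => oddval (p i) (t2 s)) (fun i => oddval (p i) (t3 s)).
have d0 := normalized_nonzero3 d_norm; have [d_sqf _ _ _ _] := d_norm.
have [c c_sqf Ec] := sqfree3_ex (nonzero3_mul d0 s0).
have sd i : parity (p i) s = parity (p i) d.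
  rewrite /parity Ed2 Ed3 (oddval_signed_prod_in p_pr p_inj absz_nat).
  by rewrite (oddval_signed_prod_in p_pr p_inj absz_pstar).
have c_one : c = (1, 1, 1).
  have Sc := Sel2_untwist Ss s_even d_norm c_sqf Ec sd.
  have S1 : Sel2 e1 e2 e3 1 (1, 1, 1) by exact: Sel2_one.
  apply: (Sel2_parity2_inj e_sum e1_lt0 e2_neq0 e3_gt0 e1_two e2_two iso Sc S1).
  exact: (untwist_parity2 Ss s_even d_norm c_sqf Ec).
rewrite c_one in Ec; suff -> : s = d by [].
apply: sqeq3_sqfree3_eq => //; move: Ec; rewrite /sqeq3 !mul3E !tripleE !mulr1.
by rewrite ![t1 s * _]mulrC ![t2 s * _]mulrC ![t3 s * _]mulrC.
Qed.

(** * The Monsky matrix *)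

Lemma hilb_family i j : hilb (p i) (p j)%:Z (- n%:Z) =
  F2_of_bool (unit_nonres (p i) (p j) + (i == j) * unit_nonres (p i) n%:Z).
Proof.
have [pi_pr pi_odd] := (p_pr i, family_odd i).
have vn : valz (p i) (- n%:Z) = 1%N.
  by apply/eqP; rewrite valzN eqn_leq sqfree_valz // valz_gt0 // dvdzE family_dvd.
have [<-|ij] := eqVneq i j; last first.
  have pij : p i != p j by rewrite (inj_eq p_inj).
  by rewrite hilb_unit ?prime_ndvdz // unit_nonres_prime // mul0r addr0.
by rewrite hilb_uniformizer // unit_partN // opprK unit_nonres_self // add0r mul1r.
Qed.

Definition F2_col (b : 'I_k -> bool) : 'cV['F_2]_k := \col_i F2_of_bool (b i).

Lemma yzE d : yz p d =
  col_mx (F2_col (fun i => oddval (p i) (t2 d))) (F2_col (fun i => oddval (p i) (t3 d))).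
Proof. by []. Qed.

Lemma Dmat_F2_col u b i : ~~ ((p i)%:Z %| u)%Z ->
  (Dmat p u *m F2_col b) i 0 = F2_of_bool (b i * unit_nonres (p i) u).
Proof.
move=> pu; rewrite /Dmat mul_diag_mx !mxE nqrE ?family_odd // unit_nonres_unit //.
by rewrite rmorphM mulrC.
Qed.

Lemma sum_delta (b : 'I_k -> bool) (i : 'I_k) (c : bool) :
  \sum_(j | b j) (i == j) * c = b i * c.
Proof.
rewrite big_mkcond (bigD1 i) //= eqxx mul1r big1 ?addr0 => [|j]; first by case: (b i).
by rewrite eq_sym => /negbTE ->; rewrite mul0r; case: (b j).
Qed.

Lemma F2_col_sum (b f : 'I_k -> bool) :
  \sum_j F2_of_bool (f j) * F2_of_bool (b j) = F2_of_bool (\sum_(j | b j) f j).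
Proof.
rewrite [in RHS]big_mkcond rmorph_sum; apply: eq_bigr => j _.
by rewrite -rmorphM; case: (b j); rewrite ?mulr1 ?mulr0.
Qed.

Lemma Amat_F2_col b i : (Amat p n *m F2_col b) i 0 =
  F2_of_bool (unit_nonres (p i) (signed_prod p Posz b) + b i * unit_nonres (p i) n%:Z).
Proof.
rewrite (unit_nonres_signed_prod p_pr absz_nat) ?family_odd // -sum_delta -big_split.
rewrite -F2_col_sum mxE; apply: eq_bigr => j _.
by rewrite !mxE hilb_family.
Qed.

Lemma Amat_tr_F2_col b i : ((Amat p n)^T *m F2_col b) i 0 =
  F2_of_bool (unit_nonres (p i) (signed_prod p pstar b)
              + b i * (unit_nonres (p i) (-1) + unit_nonres (p i) n%:Z)).
Proof.
rewrite (unit_nonres_signed_prod p_pr absz_pstar) ?family_odd // -sum_delta -big_split.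
rewrite -F2_col_sum mxE; apply: eq_bigr => j _.
rewrite !mxE hilb_family unit_nonres_pstar ?family_odd // (inj_eq p_inj) -addrA [j == i]eq_sym.
by have [->|_] := eqVneq i j; rewrite ?mul1r // !mul0r.
Qed.

Lemma block_col_eq0 (A B C D : 'M['F_2]_k) (u v : 'cV['F_2]_k) :
  block_mx A B C D *m col_mx u v = 0 <->
  forall i, (A *m u + B *m v) i 0 = 0 /\ (C *m u + D *m v) i 0 = 0.
Proof.
rewrite mul_block_col; split=> [/eqP|rows].
  by rewrite col_mx_eq0 => /andP [/eqP -> /eqP ->] i; rewrite !mxE.
apply/eqP; rewrite col_mx_eq0; apply/andP; split; apply/eqP/matrixP => i j;
  by rewrite (ord1 j) [RHS]mxE; case: (rows i).
Qed.

Section Kernel.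
Variable d : triple.
Hypothesis d_norm : normalized n d.
Local Notation y := (fun j => oddval (p j) (t2 d)).
Local Notation z := (fun j => oddval (p j) (t3 d)).

Lemma Mmat_upper_row i :
  ((Amat p n + Dmat p (- e1)) *m F2_col y + Dmat p (- e1 * e3) *m F2_col z) i 0 =
  F2_of_bool (ramified_form2 (p i) e1 e3 n%:Z d).
Proof.
have [pe1 _ pe3] := prime_dvd_n_good (p_pr i) (family_dvd nE i).
have [_ _ [d2n _] d2_gt0 _] := d_norm.
rewrite mxE mulmxDl [X in X + _]mxE Amat_F2_col -pos_dvd_signed_prod //.
rewrite !Dmat_F2_col ?Euclid_dvdzM ?negb_or ?rpredN ?pe1 // -!rmorphD.
by rewrite /ramified_form2 mulrDr addrA.
Qed.

Lemma Mmat_lower_row i :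
  (Dmat p (- e1 * e2) *m F2_col y + ((Amat p n)^T + Dmat p (- e1)) *m F2_col z) i 0 =
  F2_of_bool (ramified_form3 (p i) e1 e2 n%:Z d).
Proof.
have [pe1 pe2 _] := prime_dvd_n_good (p_pr i) (family_dvd nE i).
have [_ _ [_ d3n] _ d3_mod4] := d_norm.
rewrite mxE mulmxDl [X in _ + X]mxE Amat_tr_F2_col -mod4_dvd_signed_prod //.
rewrite !Dmat_F2_col ?Euclid_dvdzM ?negb_or ?rpredN ?pe1 // -!rmorphD addrC /ramified_form3.
rewrite unit_nonresN ?family_odd ?(ndvdz_neq0 pe1) //; congr F2_of_bool.
move: (y i * _) (z i) (unit_nonres (p i) (t3 d)) (unit_nonres (p i) n%:Z) (unit_nonres (p i) e1).
by case: (unit_nonres (p i) (-1)) => -[] [] [] [] [].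
Qed.

Lemma Mmat_yz_eq0 :
  Mmat e1 e2 e3 p n *m yz p d = 0 <-> forall i, torsion_class (p i) E d.
Proof.
rewrite yzE block_col_eq0.
have rowsE i : torsion_class (p i) E d =
    ~~ ramified_form2 (p i) e1 e3 n%:Z d && ~~ ramified_form3 (p i) e1 e2 n%:Z d.
  have [pe1 pe2 pe3] := prime_dvd_n_good (p_pr i) (family_dvd nE i).
  have dN := normalized_normker d_norm (p_pr i).
  exact: torsion_class_linear (p_pr i) (family_odd i) pe1 pe2 pe3 (oddval_family i) nz_neq0 dN.
split=> rows i; have := rows i; rewrite Mmat_upper_row Mmat_lower_row rowsE.
  by move=> [/F2_of_bool_eq0 -> /F2_of_bool_eq0 ->].
by case/andP; split; apply/F2_of_bool_eq0.
Qed.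

Lemma Sel2_Mmat_kernel : Sel2 e1 e2 e3 n%:Z d <-> Mmat e1 e2 e3 p n *m yz p d = 0.
Proof.
by split=> [/(Sel2_normalizedP d_norm)/Mmat_yz_eq0 | /Mmat_yz_eq0/(Sel2_normalizedP d_norm)].
Qed.

End Kernel.

Lemma normrepP d : normrep e1 e2 e3 n d <-> Sel2 e1 e2 e3 n%:Z d /\ normalized n d.
Proof.
split=> [[Sd [_ d2n d3n d2_gt0 d3_mod4]]|[Sd d_norm]].
  by have /SelP [d_sqf dN _ _] := Sd.
have [[d1_sqf _ _] _ [d2n d3n] d2_gt0 d3_mod4] := d_norm.
split=> //; split=> //; apply: sqfree_dvd_of_primes => // q q_pr.
rewrite (normker_oddval (normalized_normker d_norm q_pr)).
by apply: contraTT => qn; rewrite !oddval_dvd_n.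
Qed.

Lemma normalized_yz_inj d d' : normalized n d -> normalized n d' -> yz p d = yz p d' -> d = d'.
Proof.
move=> d_norm d'_norm; rewrite !yzE => /eq_col_mx [/matrixP E2 /matrixP E3].
have [_ _ [d2n d3n] d2_gt0 d3_mod4] := d_norm; have [_ _ [d2'n d3'n] d2'_gt0 d3'_mod4] := d'_norm.
apply: normalized_eq d_norm d'_norm _ _.
  rewrite (pos_dvd_signed_prod d2n d2_gt0) (pos_dvd_signed_prod d2'n d2'_gt0).
  by apply: eq_bigl => i; have := E2 i 0; rewrite !mxE => /F2_of_bool_inj.
rewrite (mod4_dvd_signed_prod d3n d3_mod4) (mod4_dvd_signed_prod d3'n d3'_mod4).
by apply: eq_bigl => i; have := E3 i 0; rewrite !mxE => /F2_of_bool_inj.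
Qed.

Lemma normalized_yz_ex v : exists2 d, normalized n d & yz p d = v.
Proof.
have [d [d_norm Ed2 Ed3]] :=
  normalized_ex (fun i => usubmx v i 0 != 0) (fun i => dsubmx v i 0 != 0).
exists d; rewrite // yzE -[v]vsubmxK.
congr col_mx; apply/matrixP => i j; rewrite (ord1 j) [LHS]mxE.
  by rewrite Ed2 (oddval_signed_prod_in p_pr p_inj absz_nat) F2_of_bool_neq0.
by rewrite Ed3 (oddval_signed_prod_in p_pr p_inj absz_pstar) F2_of_bool_neq0.
Qed.

Lemma Sel2_normalized_rep s : Sel2_iso_Z2sq e1 e2 e3 1 -> Sel2 e1 e2 e3 n%:Z s ->
  exists r, [/\ normrep e1 e2 e3 n r, equivT e1 e2 e3 n%:Z s r &
    forall r', normrep e1 e2 e3 n r' -> equivT e1 e2 e3 n%:Z s r' -> r' = r].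
Proof.
move=> iso Ss; have s0 := Sel2_nonzero3 Ss.
have parityE t r : t \in tors e1 e2 e3 n%:Z -> nonzero3 r -> sqeq3 (mul3 s r) t ->
    parity 2 s + parity 2 r = parity 2 t.
  move=> ht r0 /(sqeq3_parity (isT : prime 2) (nonzero3_mul s0 r0)) <-; first by rewrite parityM.
  by apply: tors_nonzero3 ht.
have [t ht Et] := tors_parity2_ex e1_lt0 e2_neq0 e3_gt0 e1_two e2_two (parity 2 s) nz_gt0 n_odd2.
have [r Sr Er] := Sel2_translate e_sum e1_lt0 e2_neq0 e3_gt0 nz_gt0 Ss ht.
have r_norm : normalized n r.
  apply: (Sel2_even_normalized iso Sr); apply: (addrI (parity 2 s)).
  by rewrite (parityE t) ?(Sel2_nonzero3 Sr) // Et addr0.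
exists r; split; [exact/normrepP | by exists t |].
move=> r' /normrepP [Sr' r'_norm] [t' ht' Er'].
have Ett' : t' = t.
  apply: (tors_parity2_inj e1_lt0 e2_neq0 e3_gt0 e1_two e2_two nz_gt0 n_odd2) => //.
  rewrite Et -(parityE t' r' ht' _ Er') ?(Sel2_nonzero3 Sr') //.
  by rewrite (normalized_parity2 r'_norm) addr0.
rewrite Ett' in Er'; have [[r'_sqf _ _ _ _] [r_sqf _ _ _ _]] := (r'_norm, r_norm).
have t0 : nonzero3 t by apply: tors_nonzero3 ht.
exact: sqeq3_sqfree3_eq r'_sqf r_sqf (sqeq3_cancel s0 t0 Er' Er).
Qed.

Lemma normalized_yzD r r' r'' : normalized n r -> normalized n r' -> normalized n r'' ->
  equivT e1 e2 e3 n%:Z (mul3 r r') r'' -> yz p r'' = yz p r + yz p r'.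
Proof.
move=> r_norm r'_norm r''_norm [t ht Et].
have [r0 r'0 r''0] := And3 (normalized_nonzero3 r_norm) (normalized_nonzero3 r'_norm)
  (normalized_nonzero3 r''_norm).
have rr'0 := nonzero3_mul r0 r'0; have t0 : nonzero3 t by apply: tors_nonzero3 ht.
have parityE q : prime q -> parity q r + parity q r' + parity q r'' = parity q t.
  by move=> q_pr; rewrite -(sqeq3_parity q_pr (nonzero3_mul rr'0 r''0) t0 Et) !parityM.
have t_one : t = (1, 1, 1).
  apply: (tors_parity2_inj e1_lt0 e2_neq0 e3_gt0 e1_two e2_two nz_gt0 n_odd2) => //.
  rewrite -parityE // (normalized_parity2 r_norm) (normalized_parity2 r'_norm).
  by rewrite (normalized_parity2 r''_norm).
have yzDE i : parity (p i) r'' = parity (p i) r + parity (p i) r'.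
  have := parityE (p i) (p_pr i); rewrite t_one [parity _ (1, 1, 1)](_ : _ = 0).
    by move=> /eqP; rewrite addr_eq0 => /eqP ->; case: (parity _ r'').
  by rewrite /parity !tripleE oddval_unit ?primez_ndvd1.
rewrite !yzE add_col_mx; congr col_mx; apply/matrixP => i j; rewrite !mxE -rmorphD.
  by congr F2_of_bool; exact: (congr1 fst (yzDE i)).
by congr F2_of_bool; exact: (congr1 snd (yzDE i)).
Qed.

End Descent.

Theorem theorem4p5 (e1 e2 e3 : int) (n k : nat) (p : 'I_k -> nat) :
  e1 != 0 -> e2 != 0 -> e3 != 0 -> e1 + e2 + e3 = 0 ->
  two_exact e1 -> two_exact e2 -> (4 %| e3)%Z ->
  odd n -> (0 < n)%N -> sqfree n%:Z -> coprimez n%:Z (e1 * e2 * e3) ->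
  (forall i, prime (p i)) -> injective p -> (n = \prod_(i < k) p i)%N ->
  (forall q r : nat, prime q -> (q %| n)%N -> prime r -> odd r ->
     (r%:Z %| e1 * e2 * e3)%Z -> nqr q%:Z r = 0) ->
  ~ has_pt4 e1 e2 1 -> ~ has_pt4 e1 e2 n%:Z ->
  0 < e3 -> e1 < 0 ->
  (forall q r : nat, prime q -> (q %| n)%N -> prime r -> odd r ->
     (r%:Z %| e1 * e3)%Z -> nqr (pstar q) r = 0) ->
  Sel2_iso_Z2sq e1 e2 e3 1 ->
  (* unique normalized representative in every class of Sel_2'(E^(n)) *)
  (forall s, Sel2 e1 e2 e3 n%:Z s ->
     exists r, [/\ normrep e1 e2 e3 n r, equivT e1 e2 e3 n%:Z s r &
                forall r', normrep e1 e2 e3 n r' -> equivT e1 e2 e3 n%:Z s r' -> r' = r]) /\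
  (* the induced map Sel_2'(E^(n)) -> ker M is a group isomorphism *)
  (forall r r' r'', normrep e1 e2 e3 n r -> normrep e1 e2 e3 n r' -> normrep e1 e2 e3 n r'' ->
     equivT e1 e2 e3 n%:Z (mul3 r r') r'' -> yz p r'' = yz p r + yz p r') /\
  (forall r r', normrep e1 e2 e3 n r -> normrep e1 e2 e3 n r' -> yz p r = yz p r' -> r = r') /\
  (forall r, normrep e1 e2 e3 n r -> Mmat e1 e2 e3 p n *m yz p r = 0) /\
  (forall v : 'cV['F_2]_(k + k), Mmat e1 e2 e3 p n *m v = 0 ->
     exists2 r, normrep e1 e2 e3 n r & yz p r = v).
Proof.
move=> _ e20 _ e_sum e1_two e2_two e3_four n_odd n_gt0 n_sqf n_coprime p_pr p_inj nE residue _ _.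
move=> e3_gt0 e1_lt0 residue_star iso.
have normP := normrepP e_sum e1_lt0 e20 e3_gt0 n_gt0.
have kerP d : normalized n d -> Sel2 e1 e2 e3 n%:Z d <-> Mmat e1 e2 e3 p n *m yz p d = 0.
  exact: Sel2_Mmat_kernel.
split; last split; last split; last split.
- by move=> s; exact: Sel2_normalized_rep.
- move=> r r' r'' /normP [_ r_norm] /normP [_ r'_norm] /normP [_ r''_norm].
  exact: normalized_yzD.
- by move=> r r' /normP [_ r_norm] /normP [_ r'_norm];
    exact: (normalized_yz_inj p_pr p_inj nE n_odd n_sqf).
- by move=> r /normP [Sr r_norm]; apply/kerP.
- move=> v; have [d d_norm <-] := normalized_yz_ex p_pr p_inj nE n_odd n_sqf v.
  by move=> /(kerP d d_norm) Sd; exists d => //; apply/normP.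
Qed.
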